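(* Let $\mathsf{G}_0,\mathsf{G}_1\in\mathcal{M}(\Omega,\mathbb{S}^n_+)$. The optimization problem $$\mathrm{WB}_\Lambda^2(\mathsf{G}_0,\mathsf{G}_1)=\inf_{\mu\in\mathcal{CE}([0,1];\mathsf{G}_0,\mathsf{G}_1)}\mathcal{J}_{\Lambda,Q}(\mu)\qquad(\mathcal{P})$$ always admits a minimizer $\mu\in\mathcal{CE}([0,1];\mathsf{G}_0,\mathsf{G}_1)$ and a dual formulation with zero duality gap: $$\mathrm{WB}^2_\Lambda(\mathsf{G}_0,\mathsf{G}_1)=\sup_{\Phi\in C^1(Q,\mathbb{S}^n)}\Big\{\langle\mathsf{G}_1,\Phi_1\rangle_\Omega-\langle\mathsf{G}_0,\Phi_0\rangle_\Omega-\iota_{C(Q,\mathcal{O}_\Lambda)}(\partial_t\Phi,\mathsf{D}^*\Phi,\Phi)\Big\},$$ where the supremum is attained at $\Phi\in C^1(Q,\mathbb{S}^n)$ if and only if there exists $\mu=(\mathsf{G},\mathsf{q},\mathsf{R})\in\mathcal{CE}([0,1];\mathsf{G}_0,\mathsf{G}_1)$ such that $$q_\lambda=G_\lambda(\mathsf{D}^*\Phi)\Lambda_1^2,\qquad R_\lambda=G_\lambda\Phi\Lambda_2^2,$$ and $$G_\lambda\cdot\Big(\partial_t\Phi+\tfrac12(\mathsf{D}^*\Phi)\Lambda_1^2(\mathsf{D}^*\Phi)^{\mathrm T}+\tfrac12\Phi\Lambda_2^2\Phi\Big)=0$$ for $\lambda$-a.e. $(t,x)\in Q$. Here $\lambda\in\mathcal{M}(Q,\mathbb{R}_+)$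 is a reference measure with $|\mu|\ll\lambda$ and $(G_\lambda,q_\lambda,R_\lambda)=\frac{\mathrm{d}\mu}{\mathrm{d}\lambda}$. In this case, $\mu$ is also the minimizer to the problem $(\mathcal{P})$.
   Context: Matrices: $\mathbb{S}^n,\mathbb{S}^n_+,\mathbb{S}^n_{++}$ are the real symmetric, positive semidefinite, positive definite $n\times n$ matrices; $\mathbb{M}^n=\mathbb{R}^{n\times n}$; $A\cdot B=\mathrm{Tr}(A^{\mathrm T}B)$; $\preceq$ is the Loewner order; $A^\dagger$ is the pseudoinverse; $\mathrm{Ran}$ is the range. $\mathcal{M}(\mathcal{X},V)$ denotes finite $V$-valued Radon measures on a compact separable metric space $\mathcal{X}$, $\mathbb{R}_+=[0,\infty)$, $|\mu|$ is the total variation measure, and $\langle\cdot,\cdot\rangle_{\mathcal{X}}$ is the duality pairing with continuous functions (using $A\cdot B$ on matrices). Weights and action: fix positive integers $n,k,d$ and $\Lambda=(\Lambda_1,\Lambda_2)$ with $\Lambda_1\in\mathbb{S}^k_+$, $\Lambda_2\in\mathbb{S}^n_{++}$. Put $\mathbb{X}=\mathbb{S}^n\times\mathbb{R}^{n\times k}\times\mathbb{M}^n$ and $$\mathcal{O}_\Lambda=\{(A,B,C)\in\mathbb{X}:\ A+\tfrac12B\Lambda_1^2B^{\mathrm T}+\tfrac12C\Lambda_2^2C^{\mathrm T}\preceq0\}.$$ $C(Q,\mathcal{O}_\Lambda)$ is the set of continuous $\mathbb{X}$-valued functions on $Q$ with values in $\mathcal{O}_\Lambda$; $\iota_S$ equals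 $0$ on $S$ and $+\infty$ off $S$. Define $J_\Lambda(X,Y,Z)=\frac12(Y\Lambda_1^\dagger)\cdot(X^\dagger Y\Lambda_1^\dagger)+\frac12(Z\Lambda_2^{-1})\cdot(X^\dagger Z\Lambda_2^{-1})$ if $X\in\mathbb{S}^n_+$, $\mathrm{Ran}(Y^{\mathrm T})\subset\mathrm{Ran}(\Lambda_1)$ and $\mathrm{Ran}([Y,Z])\subset\mathrm{Ran}(X)$, and $J_\Lambda=+\infty$ otherwise ($J_\Lambda$ is the convex conjugate of $\iota_{\mathcal{O}_\Lambda}$). For $\mu=(\mathsf{G},\mathsf{q},\mathsf{R})\in\mathcal{M}(\mathcal{X},\mathbb{X})$, $\mathcal{J}_{\Lambda,\mathcal{X}}(\mu)=\int_{\mathcal{X}}J_\Lambda(\frac{\mathrm{d}\mu}{\mathrm{d}\lambda})\,\mathrm{d}\lambda$ for any nonnegative finite Radon $\lambda$ with $|\mu|\ll\lambda$ (independent of $\lambda$). Continuity equation: $\Omega\subset\mathbb{R}^d$ is compact with nonempty interior and smooth boundary; $Q=[0,1]\times\Omega$. $\mathsf{D}^*$ is a first-order constant-coefficient linear differential operator from $\mathbb{S}^n$-valued to $\mathbb{R}^{n\times k}$-valued functions on $\mathbb{R}^d$ with $\mathsf{D}^*(I)=0$; i.e. $\mathsf{D}^*\Phi=L_0(\Phi)+\sum_{j=1}^dL_j(\partial_{x_j}\Phi)$ with linear $L_j:\mathbb{S}^n\to\mathbb{R}^{n\times k}$ and $L_0(I)=0$; on functions of $(t,x)$ it acts in $x$.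 $C^1(Q,\mathbb{S}^n)$: derivatives exist in the interior and extend continuously to the boundary. $\Phi_t=\Phi(t,\cdot)$. $\mathcal{CE}([0,1];\mathsf{G}_0,\mathsf{G}_1)$ is the set of $\mu=(\mathsf{G},\mathsf{q},\mathsf{R})\in\mathcal{M}(Q,\mathbb{X})$ with $$\int_Q\partial_t\Phi\cdot\mathrm{d}\mathsf{G}+\mathsf{D}^*\Phi\cdot\mathrm{d}\mathsf{q}+\Phi\cdot\mathrm{d}\mathsf{R}=\int_\Omega\Phi_1\cdot\mathrm{d}\mathsf{G}_1-\int_\Omega\Phi_0\cdot\mathrm{d}\mathsf{G}_0\quad\forall\Phi\in C^1(Q,\mathbb{S}^n).$$
   Formalization: In the attainment criterion and the final ''in this case'' clause, two conditions are added without which the claim fails: the triple (∂_tΦ, D*Φ, Φ) lies in C(Q,O_Λ), and G_λ is positive semidefinite λ-a.e.; both are also proved as consequences of attainment. *)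

(* Defs.v *)
From HB Require Import structures.
From mathcomp Require Import all_boot all_order all_algebra.
From mathcomp Require Import all_classical all_reals all_analysis.

Set Implicit Arguments.
Unset Strict Implicit.
Unset Printing Implicit Defensive.

Import Order.TTheory GRing.Theory Num.Theory.
Import numFieldNormedType.Exports.

Local Open Scope classical_set_scope.
Local Open Scope ring_scope.

Section Matrices.
Context {R : realType}.

Definition dotm m p (A B : 'M[R]_(m, p)) : R := \tr (A^T *m B).

Definition psd n (A : 'M[R]_n) : Prop :=
  A^T = A /\ forall x : 'cV[R]_n, 0 <= (x^T *m A *m x) 0 0.

Definition pd n (A : 'M[R]_n) : Prop :=
  A^T = A /\ forall x : 'cV[R]_n, x != 0 -> 0 < (x^T *m A *m x) 0 0.

Definition loewner_le n (A B : 'M[R]_n) : Prop := psd (B - A).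

(* Ran denotes the column space, whereas [<=]%MS compares row spaces. *)
Definition ran_sub m p q (A : 'M[R]_(m, p)) (B : 'M[R]_(m, q)) : bool :=
  (A^T <= B^T)%MS.

(* The library's [pinvmx] is only a generalized inverse, not the Moore-Penrose
   one: its products with A need not be symmetric. *)
Definition penrose m p (A : 'M[R]_(m, p)) (B : 'M[R]_(p, m)) : Prop :=
  [/\ A *m B *m A = A, B *m A *m B = B,
      (A *m B)^T = A *m B & (B *m A)^T = B *m A].

Definition mpinv m p (A : 'M[R]_(m, p)) : 'M[R]_(p, m) :=
  xget 0 [set B | penrose A B].

Lemma gram_unit r p (B : 'M[R]_(r, p)) : row_free B -> B *m B^T \in unitmx.
Proof.
move=> fB; rewrite -row_free_unit; apply/inj_row_free => v vBB.
have {}vBB : v *m B *m (v *m B)^T = 0.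
  by rewrite trmx_mul -!mulmxA (mulmxA B) mulmxA vBB mul0mx.
apply/(row_free_inj fB)/rowP => j; rewrite mul0mx mxE; apply/eqP.
have /eqP := congr1 (fun M : 'M[R]_1 => M 0 0) vBB.
rewrite !mxE psumr_eq0 => [/allP /(_ j)|i _]; rewrite !mxE -expr2 ?sqr_ge0//.
by rewrite mem_index_enum sqrf_eq0 => /(_ isT).
Qed.

Lemma penrose_exists m p (A : 'M[R]_(m, p)) : exists B, penrose A B.
Proof.
have [s [c [r [-> cU rU]]]] : exists s (c : 'M[R]_(m, s)) (r : 'M[R]_(s, p)),
    [/\ A = c *m r, c^T *m c \in unitmx & r *m r^T \in unitmx].
  exists (\rank A), (col_base A), (row_base A); rewrite mulmx_base; split => //.
    by rewrite -{2}[col_base A]trmxK gram_unit// /row_free mxrank_tr; exact: col_base_full.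
  by rewrite gram_unit// row_base_free.
pose c' := invmx (c^T *m c) *m c^T; pose r' := r^T *m invmx (r *m r^T).
have c'c : c' *m c = 1%:M by rewrite -mulmxA mulVmx.
have rr' : r *m r' = 1%:M by rewrite mulmxA mulmxV.
have E1 : c *m r *m (r' *m c') = c *m c'.
  by rewrite mulmxA -(mulmxA c) rr' mulmx1.
have E2 : r' *m c' *m (c *m r) = r' *m r.
  by rewrite mulmxA -(mulmxA r') c'c mulmx1.
exists (r' *m c'); split.
- by rewrite E1 mulmxA -(mulmxA c) c'c mulmx1.
- by rewrite E2 mulmxA -(mulmxA r') rr' mulmx1.
- by rewrite E1 /c' mulmxA !trmx_mul trmxK trmx_inv trmx_mul trmxK mulmxA.
- by rewrite E2 /r' !trmx_mul trmxK trmx_inv trmx_mul trmxK mulmxA.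
Qed.

Lemma mpinvP m p (A : 'M[R]_(m, p)) : penrose A (mpinv A).
Proof. by have [B AB] := penrose_exists A; exact: (xgetPex 0 (ex_intro [set B | penrose A B] B AB)). Qed.

Lemma penrose_uniq m p (A : 'M[R]_(m, p)) B C :
  penrose A B -> penrose A C -> B = C.
Proof.
move=> [ABA BAB AB BA] [ACA CAC AC CA].
have ABC : A *m B *m (A *m C) = A *m B.
  by rewrite -AB -AC -trmx_mul mulmxA ACA.
have BAC : B *m A *m (C *m A) = C *m A.
  by rewrite -BA -CA -trmx_mul -mulmxA (mulmxA A) ABA.
have <- : B *m A *m C = B by rewrite -{1}BAB -!mulmxA (mulmxA A) ABC mulmxA.
by rewrite -{1}CAC mulmxA BAC.
Qed.
End Matrices.

Section Indicator.
Context {R : realType} {T : Type}.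

Definition cvx_indic (S : set T) (x : T) : \bar R :=
  if x \in S then 0%E else +oo%E.

End Indicator.

Section Weights.
Context {R : realType} {n k : nat}.
Variables (L1 : 'M[R]_k) (L2 : 'M[R]_n).

(* The first component is symmetric because [loewner_le] requires it of the
   difference and the two other summands are symmetric. *)
Definition O_set : set ('M[R]_n * 'M[R]_(n, k) * 'M[R]_n) :=
  [set u | loewner_le
    (u.1.1 + 2^-1 *: (u.1.2 *m (L1 *m L1) *m u.1.2^T)
           + 2^-1 *: (u.2 *m (L2 *m L2) *m u.2^T)) 0].

Definition J (X : 'M[R]_n) (Y : 'M[R]_(n, k)) (Z : 'M[R]_n) : \bar R :=
  if `[< [/\ psd X, ran_sub Y^T L1 & ran_sub (row_mx Y Z) X] >] then
    (2^-1 * dotm (Y *m mpinv L1) (mpinv X *m Y *m mpinv L1)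
     + 2^-1 * dotm (Z *m invmx L2) (mpinv X *m Z *m invmx L2))%:E
  else +oo%E.

End Weights.

Notation borel X := (g_sigma_algebraType (@open X)).

(* On a compact metric space every finite Borel measure is Radon, so a finite
   vector-valued Radon measure is a vector of finite signed Borel measures
   (charges).  A measure on a compact subset D of the ambient space is a
   measure on the ambient space concentrated on D. *)
Section MatrixMeasures.
Context {R : realType} {disp : measure_display} {T : measurableType disp}.
Implicit Types (D A : set T) (lam : {finite_measure set T -> \bar R}).

Definition concentrated (nu : set T -> \bar R) D : Prop :=
  forall A, measurable A -> A `&` D = set0 -> nu A = 0%E.

Definition cintegral (nu : {charge set T -> \bar R}) D (f : T -> R) : R :=
  let: exist P exN := cid (Hahn_decomposition nu) in
  let: exist N PN := cid exN in
  \int[jordan_pos PN]_(x in D) f x - \int[jordan_neg PN]_(x in D) f x.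

Definition mxmeas m p : Type := 'M[{charge set T -> \bar R}]_(m, p).

Definition mxval m p (M : mxmeas m p) A : 'M[R]_(m, p) :=
  map_mx (fun nu : {charge set T -> \bar R} => fine (nu A)) M.

Definition mxconcentrated m p (M : mxmeas m p) D : Prop :=
  forall i j, concentrated (M i j) D.

Definition pairing m p (M : mxmeas m p) D (F : T -> 'M[R]_(m, p)) : R :=
  \sum_i \sum_j cintegral (M i j) D (fun z => F z i j).

Definition mxdensity m p (M : mxmeas m p) lam (z : T) : 'M[R]_(m, p) :=
  map_mx (fun nu : {charge set T -> \bar R} => fine (Radon_Nikodym nu lam z)) M.

Definition psd_measure n (M : mxmeas n n) D : Prop :=
  mxconcentrated M D /\ forall A, measurable A -> psd (mxval M A).

Section XMeasures.
Context {n k : nat}.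

Record Xmeas : Type := XMeas {
  measG : mxmeas n n;
  measq : mxmeas n k;
  measR : mxmeas n n }.
Implicit Type mu : Xmeas.

Definition X_measure mu D : Prop :=
  [/\ mxconcentrated (measG mu) D, mxconcentrated (measq mu) D,
      mxconcentrated (measR mu) D &
      forall A, measurable A -> (mxval (measG mu) A)^T = mxval (measG mu) A].

Definition Xnorm_at mu A : R :=
  Num.sqrt (dotm (mxval (measG mu) A) (mxval (measG mu) A)
          + dotm (mxval (measq mu) A) (mxval (measq mu) A)
          + dotm (mxval (measR mu) A) (mxval (measR mu) A)).

Definition total_variation mu A : \bar R :=
  ereal_sup [set v | exists N (E : 'I_N -> set T),
    [/\ forall i, measurable (E i), trivIset setT E,
        \bigcup_i E i = A & v = (\sum_i Xnorm_at mu (E i))%:E]].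

Definition reference mu lam D : Prop :=
  concentrated lam D /\ total_variation mu `<< lam.

Variables (L1 : 'M[R]_k) (L2 : 'M[R]_n).

Definition action_wrt mu lam D : \bar R :=
  (\int[lam]_(z in D) J L1 L2 (mxdensity (measG mu) lam z)
     (mxdensity (measq mu) lam z) (mxdensity (measR mu) lam z))%E.

(* The value [action_wrt mu lam D] is the same for all reference measures, as J
   is positively 1-homogeneous; the infimum is this common value and spares an
   arbitrary choice of the reference measure. *)
Definition action mu D : \bar R :=
  ereal_inf [set action_wrt mu lam D | lam in [set lam | reference mu lam D]].

End XMeasures.
End MatrixMeasures.

Section Smoothness.
Context {R : realType}.

Definition smooth_on (V : normedModType R) (U : set V) (f : V -> R) : Prop :=
  forall (s : seq V) x, U x -> differentiable (foldr (fun v g => 'D_v g) f s) x.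

(* Near each of its boundary points, the set is a sublevel set of a smooth
   function with nonvanishing differential. *)
Definition smooth_boundary d (Om : set 'rV[R]_d) : Prop :=
  forall p, closure Om p -> ~ Om° p ->
  exists (U : set 'rV[R]_d) (rho : 'rV[R]_d -> R),
    [/\ open U, U p, smooth_on U rho, (exists v, 'D_v rho p != 0) &
        Om `&` U = [set x | rho x <= 0] `&` U].

Section C1.
Context {V W : normedModType R}.

Definition C1 (D : set V) (f : V -> W) : Prop :=
  [/\ {within D, continuous f},
      forall v z, D° z -> derivable f z v &
      forall v, exists g : V -> W,
        {within D, continuous g} /\ forall z, D° z -> g z = 'D_v f z].

(* The continuous extension to D (contained in the closure of its interior) of
   the directional derivative on the interior of D. *)
Definition ext_derive (D : set V) (v : V) (f : V -> W) (z : V) : W :=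
  lim ('D_v f y @[y --> within D° (nbhs z)]).

End C1.
End Smoothness.

Section TransportProblem.
Context {R : realType} {n k d : nat}.
Variable Om : set 'rV[R]_d.
Local Notation ST := (R * 'rV[R]_d)%type.

Definition Q : set ST := `[0, 1]%classic `*` Om.

Definition C1sym : set (ST -> 'M[R]_n) :=
  [set Phi | C1 Q Phi /\ forall z, Q z -> (Phi z)^T = Phi z].

Definition dt (Phi : ST -> 'M[R]_n) : ST -> 'M[R]_n :=
  ext_derive Q (1, 0) Phi.

Definition dx (j : 'I_d) (Phi : ST -> 'M[R]_n) : ST -> 'M[R]_n :=
  ext_derive Q (0, delta_mx 0 j) Phi.

(* Every linear map on symmetric matrices is the restriction of a linear map on
   all matrices; only the values on symmetric matrices matter below. *)
Variables (D0 : {linear 'M[R]_n -> 'M[R]_(n, k)})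
          (D1 : 'I_d -> {linear 'M[R]_n -> 'M[R]_(n, k)}).

Definition Dstar (Phi : ST -> 'M[R]_n) (z : ST) : 'M[R]_(n, k) :=
  D0 (Phi z) + \sum_j D1 j (dx j Phi z).

Variables G0 G1 : @mxmeas R _ (borel 'rV[R]_d) n n.

Definition boundary_term (Phi : ST -> 'M[R]_n) : R :=
  pairing G1 Om (fun x => Phi (1, x))
  - pairing G0 Om (fun x => Phi (0, x)).

Definition CE : set (@Xmeas R _ (borel ST) n k) :=
  [set mu : @Xmeas R _ (borel ST) n k | X_measure mu Q /\
    forall Phi, C1sym Phi ->
      pairing (measG mu) Q (dt Phi) + pairing (measq mu) Q (Dstar Phi)
        + pairing (measR mu) Q Phi = boundary_term Phi].

Variables (L1 : 'M[R]_k) (L2 : 'M[R]_n).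

Definition WB2 : \bar R := ereal_inf [set action L1 L2 mu Q | mu in CE].

Definition C_Q_O : set (ST -> 'M[R]_n * 'M[R]_(n, k) * 'M[R]_n) :=
  [set u | {within Q, continuous u} /\ forall z, Q z -> O_set L1 L2 (u z)].

Definition dual_triple (Phi : ST -> 'M[R]_n) :
  ST -> 'M[R]_n * 'M[R]_(n, k) * 'M[R]_n :=
  fun z => (dt Phi z, Dstar Phi z, Phi z).

Definition dual_objective (Phi : ST -> 'M[R]_n) : \bar R :=
  ((boundary_term Phi)%:E - cvx_indic C_Q_O (dual_triple Phi))%E.

Definition dual_value : \bar R :=
  ereal_sup [set dual_objective Phi | Phi in C1sym].

Definition is_minimizer (mu : @Xmeas R _ (borel ST) n k) : Prop :=
  CE mu /\ action L1 L2 mu Q = WB2.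

Definition optimality (Phi : ST -> 'M[R]_n) (mu : @Xmeas R _ (borel ST) n k)
    (lam : {finite_measure set (borel ST) -> \bar R}) : Prop :=
  {ae lam, forall z, Q z ->
    let G := mxdensity (measG mu) lam z in
    [/\ psd G,
        mxdensity (measq mu) lam z = G *m Dstar Phi z *m (L1 *m L1),
        mxdensity (measR mu) lam z = G *m Phi z *m (L2 *m L2) &
        dotm G (dt Phi z
                + 2^-1 *: (Dstar Phi z *m (L1 *m L1) *m (Dstar Phi z)^T)
                + 2^-1 *: (Phi z *m (L2 *m L2) *m Phi z)) = 0]}.

End TransportProblem.

(* Main.v *)
(* The dual problem maximises the boundary functional of Phi over those Phi whose
   triple (d_t Phi, D* Phi, Phi) lies in a convex set K of continuous functions on
   Q; let S be the supremum.  A Riccati comparison in time gives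
   Phi_1, - Phi_0 <= 2 L2^-2 for such Phi, so S is finite.  The function
   Phi = - e t I is a Slater point because D*(I) = 0, hence by Hahn-Banach the
   boundary functional, defined on the triples, extends to a linear functional f on
   all continuous X-valued functions with f <= S on K.  The Slater point also makes f
   bounded, so by Riesz representation f is the pairing with a vector measure mu,
   and mu satisfies the continuity equation since f extends the boundary functional.
   Pointwise, J is the supremum of countably many of the linear forms given by the
   elements of the constraint set; selecting a nearly optimal one in a Borel way and
   approximating the selection by continuous functions, convex combination by convex
   combination, gives J(mu) <= S.  Weak duality and the optimality conditions both
   come from completing the square in J(X, Y, Z) - <(X, Y, Z), u>. *)
Require Import Defs.
From HB Require Import structures.
From mathcomp Require Import all_boot all_order all_algebra.
From mathcomp Require Import all_classical all_reals all_analysis.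
From mathcomp Require Import measurable_realfun.
From mathcomp Require Import ring lra zify.
Set Implicit Arguments.
Unset Strict Implicit.
Unset Printing Implicit Defensive.
Import Order.TTheory GRing.Theory Num.Theory.
Import numFieldNormedType.Exports.
Local Open Scope classical_set_scope.
Local Open Scope ring_scope.

(** * Extension of dominated functionals *)

(** Since [action] is an infimum over reference measures, weak duality is proved for each of them,
    strong duality for one. Densities are controlled only almost everywhere and are integrable, not
    bounded; this shapes the rest. The constraint set is enlarged to [K_set], free of the symmetry
    of its first component, so that [J] is the supremum of the pairings over it at every matrix
    argument. The extended functional is precomposed with the symmetrisation [symX], which leaves
    the triples of test functions unchanged and makes the first component of the representing
    measure symmetric. The Borel selection is approximated in L^1 with the density as weight.
    Functions are total while only their values on [Q] count, so the boundary functional on triples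
    enters as a relation; domination makes it single-valued. *)

Section HahnBanach.
Context {R : realType} {V : lmodType R}.
Variables (D : set V) (p : V -> R).
Hypothesis D_lin : forall a u v, D u -> D v -> D (a *: u + v).
Hypothesis p_hom : forall a u, 0 <= a -> D u -> p (a *: u) = a * p u.
Hypothesis p_sub : forall u v, D u -> D v -> p (u + v) <= p u + p v.

(** Partial linear functionals are kept as graphs, so that the union of a chain is a plain union of
    sets. *)
Definition dominated_graph (A : set (V * R)) : Prop :=
  [/\ forall x, A x -> D x.1, forall x, A x -> x.2 <= p x.1 &
      forall a x y, A x -> A y -> A (a *: x.1 + y.1, a * x.2 + y.2)].

(** Two values at one point differ by a value at 0, which is at most [p 0 = 0]; exchanging them
    gives equality. *)
Lemma dominated_graph_fun A u a b :
  dominated_graph A -> A (u, a) -> A (u, b) -> a = b.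
Proof.
move=> [AD Ap Al] Aa Ab.
have D0 : D (0 : V) by rewrite -(subrr u) -scaleN1r addrC; apply: D_lin; exact: (AD _ Aa).
have p0 : p 0 = 0 by rewrite -(scale0r (0 : V)) p_hom// mul0r.
have le a' b' : A (u, a') -> A (u, b') -> a' <= b'.
  move=> Aa' Ab'; have := Ap _ (Al (-1) _ _ Ab' Aa') => /=.
  by rewrite scaleN1r addNr p0; lra.
by apply/eqP; rewrite eq_le !le.
Qed.

(** The value at [v] has to lie between all [x.2 - p (x.1 - v)] and all [p (y.1 + v) - y.2].
    Subadditivity puts every lower bound below every upper one, so the supremum of the lower bounds
    serves. *)
Lemma dominated_graph_extend A v : A !=set0 -> dominated_graph A -> D v ->
  exists B, [/\ dominated_graph B, A `<=` B & exists a, B (v, a)].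
Proof.
move=> [[u0 a0] Au0] gA Dv; have [AD Ap Al] := gA.
have D0 : D (0 : V).
  by rewrite -(subrr u0) -scaleN1r addrC; apply: D_lin; exact: (AD _ Au0).
have DN u : D u -> D (- u) by move=> Du; rewrite -scaleN1r -(addr0 (_ *: _)); exact: D_lin.
have DD u w : D u -> D w -> D (u + w) by move=> Du Dw; rewrite -(scale1r u); exact: D_lin.
have DZ t u : D u -> D (t *: u) by move=> Du; rewrite -(addr0 (_ *: _)); exact: D_lin.
pose E := [set x.2 - p (x.1 - v) | x in A].
have ubE y : A y -> ubound E (p (y.1 + v) - y.2).
  move=> Ay _ [x Ax <-].
  have := Ap _ (Al 1 _ _ Ax Ay) => /=; rewrite scale1r mul1r => h.
  have : p (x.1 + y.1) <= p (x.1 - v) + p (y.1 + v).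
    rewrite -{1}(subrK v x.1) -addrA (addrC v); apply: p_sub.
      by apply: DD; [exact: AD|exact: DN].
    by apply: DD; [exact: AD|].
  lra.
have supE : has_sup E.
  split; first by exists (a0 - p (u0 - v)), (u0, a0).
  by exists (p (u0 + v) - a0); exact: (ubE (u0, a0)).
pose c := sup E.
have c_lo x : A x -> x.2 - p (x.1 - v) <= c.
  by move=> Ax; apply: ub_le_sup; [case: supE|exists x].
have c_hi y : A y -> c <= p (y.1 + v) - y.2.
  by move=> Ay; apply: ge_sup; [case: supE|exact: ubE].
have A00 : A (0, 0).
  by have := Al (-1) _ _ Au0 Au0 => /=; rewrite scaleN1r addNr mulN1r addNr.
have AZ t x : A x -> A (t *: x.1, t * x.2).
  by move=> Ax; have := Al t _ _ Ax A00; rewrite /= !addr0.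
exists [set x | exists y t, A y /\ x = (y.1 + t *: v, y.2 + t * c)]; split.
- split.
  + by move=> _ [y [t [Ay ->]]] /=; apply: DD; [exact: AD|exact: DZ].
  + move=> _ [y [t [Ay ->]]] /=.
    (* Homogeneity reduces t > 0 to the upper bound on [c] at y / t, and t < 0 to the lower bound at
       y / |t|. *)
    have [t0|t0|->] := ltrgtP t 0; last first.
    * by rewrite scale0r mul0r !addr0; exact: Ap.
    * have := c_hi _ (AZ t^-1 _ Ay) => /= h.
      have -> : y.1 + t *: v = t *: (t^-1 *: y.1 + v).
        by rewrite scalerDr scalerA divff ?gt_eqF// scale1r.
      rewrite (p_hom (ltW _))//; last by apply: DD => //; apply/DZ/AD.
      have : t * c <= t * (p (t^-1 *: y.1 + v) - t^-1 * y.2) by rewrite ler_pM2l.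
      by rewrite mulrBr mulrA divff ?gt_eqF// mul1r; lra.
    * have [s s0 ->] : exists2 s, 0 < s & t = - s by exists (- t); lra.
      have := c_lo _ (AZ s^-1 _ Ay) => /= h.
      have -> : y.1 + - s *: v = s *: (s^-1 *: y.1 - v).
        by rewrite scalerBr scalerA divff ?gt_eqF// scale1r scaleNr.
      rewrite (p_hom (ltW _))//; last by apply: DD; [apply/DZ/AD|exact: DN].
      have : s * (s^-1 * y.2 - p (s^-1 *: y.1 - v)) <= s * c by rewrite ler_pM2l.
      by rewrite mulrBr mulrA divff ?gt_eqF// mul1r; lra.
  + move=> a _ _ [y [t [Ay ->]]] [z [s [Az ->]]] /=.
    exists (a *: y.1 + z.1, a * y.2 + z.2), (a * t + s); split; first exact: Al.
    by rewrite /= scalerDl !scalerDr scalerA addrACA; congr (_, _); ring.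
- by move=> x Ax; exists x, 0; split=> //; rewrite scale0r mul0r !addr0; case: x {Ax}.
- by exists c, (0, 0), 1; split=> //=; rewrite scale1r mul1r !add0r.
Qed.

Theorem hahn_banach A0 : A0 !=set0 -> dominated_graph A0 ->
  exists f : V -> R,
    [/\ forall a u v, D u -> D v -> f (a *: u + v) = a * f u + f v,
        forall u, D u -> f u <= p u & forall x, A0 x -> f x.1 = x.2].
Proof.
move=> A0n gA0.
(* Adjoining [A0] to every member takes care of the empty chain: its union is empty, and [A0] itself
   is a dominated graph. *)
have [|A [gA Amax]] := @Zorn_bigcup _ [set A | dominated_graph (A0 `|` A)].
  move=> F FP tot /=; split.
  - by move=> x [A0x|[A FA Ax]]; [case: gA0 => + _ _; exact|
      case: (FP _ FA) => + _ _; apply; right].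
  - by move=> x [A0x|[A FA Ax]]; [case: gA0 => _ + _; exact|
      case: (FP _ FA) => _ + _; apply; right].
  - move=> a x y.
    have sub A : F A -> (A0 `|` A) `<=` (A0 `|` \bigcup_(X in F) X).
      by move=> FA z [|Az]; [left|right; exists A].
    move=> [A0x|[A FA Ax]] [A0y|[B FB By]].
    + by left; case: gA0 => _ _; apply.
    + by apply: (sub _ FB); case: (FP _ FB) => _ _; apply; [left|right].
    + by apply: (sub _ FA); case: (FP _ FA) => _ _; apply; [right|left].
    + have [AB|BA] := tot _ _ FA FB.
        by apply: (sub _ FB); case: (FP _ FB) => _ _; apply; right => //; exact: AB.
      by apply: (sub _ FA); case: (FP _ FA) => _ _; apply; right => //; exact: BA.
set G := A0 `|` A in gA.
have Gn : G !=set0 by case: A0n => x A0x; exists x; left.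
have tot u : D u -> exists a, G (u, a).
  move=> Du; have [B [gB GB [a Ba]]] := dominated_graph_extend Gn gA Du.
  exists a; apply: contrapT => nG; apply: (Amax B); last first.
    by rewrite /= (_ : A0 `|` B = B)//; apply/setUidPr => x ?; apply: GB; left.
  split; first by move=> x Ax; apply: GB; right.
  by move=> BA; apply: nG; right; exact: BA.
pose f u := xget 0 [set a | G (u, a)].
have fP u : D u -> G (u, f u).
  by move=> /tot [a Ga]; exact: (xgetPex 0 (ex_intro [set a | G (u, a)] a Ga)).
have [GD Gp Gl] := gA.
exists f; split.
- move=> a u v Du Dv; apply: (dominated_graph_fun gA (u := a *: u + v)).
    by apply: fP; exact: D_lin.
  exact: (Gl a _ _ (fP _ Du) (fP _ Dv)).
- by move=> u Du; exact: Gp (fP _ Du).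
- move=> [u a] A0u /=; have Gu : G (u, a) by left.
  by apply: (dominated_graph_fun gA _ Gu); apply: fP; exact: (GD _ Gu).
Qed.

End HahnBanach.

Section ConvexExtension.
Context {R : realType} {V : lmodType R}.
Variables (D K : set V) (A0 : set (V * R)) (w0 : V) (l0 S : R).
Hypothesis D_lin : forall a u v, D u -> D v -> D (a *: u + v).
Hypothesis K_conv : forall t u v, 0 <= t -> t <= 1 -> K u -> K v ->
  K ((1 - t) *: u + t *: v).
Hypothesis A0_D : forall x, A0 x -> D x.1.
Hypothesis A0_lin :
  forall a x y, A0 x -> A0 y -> A0 (a *: x.1 + y.1, a * x.2 + y.2).
Hypothesis A0_S : forall x, A0 x -> K x.1 -> x.2 <= S.
Hypothesis A0_w0 : A0 (w0, l0).
Hypothesis K_abs : forall u, D u -> exists2 r, 0 < r & K (w0 + r *: u).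

Let scales u := [set r | 0 < r /\ K (w0 + r^-1 *: u)].
Let gauge u := inf (scales u).

Let scales_inf u : D u -> has_inf (scales u).
Proof.
move=> Du; split; last by exists 0 => r [/ltW].
by have [r r0 Kr] := K_abs Du; exists r^-1; split; rewrite ?invr_gt0// invrK.
Qed.

Let gauge_le u r : scales u r -> gauge u <= r.
Proof. by move=> ur; apply: ge_inf => //; exists 0 => s [/ltW]. Qed.

(* The sublinear majorant is [S - l0] times the Minkowski gauge of [K] around
   [w0]. *)
Theorem convex_extension : exists f : V -> R,
  [/\ forall a u v, D u -> D v -> f (a *: u + v) = a * f u + f v,
      forall u, D u -> K u -> f u <= S & forall x, A0 x -> f x.1 = x.2].
Proof.
have Dw0 : D w0 := A0_D A0_w0.
have D0 : D (0 : V) by rewrite -(subrr w0) -scaleN1r addrC; exact: D_lin.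
have DD u w : D u -> D w -> D (u + w) by move=> Du Dw; rewrite -(scale1r u); exact: D_lin.
have DZ t u : D u -> D (t *: u) by move=> Du; rewrite -(addr0 (_ *: _)); exact: D_lin.
have Kw0 : K w0 by have [r _] := K_abs D0; rewrite scaler0 addr0.
have m0 : 0 <= S - l0 by have := A0_S A0_w0 Kw0; rewrite /=; lra.
have scaleP a u r : 0 < a -> scales u r -> scales (a *: u) (a * r).
  move=> a0 [r0 Kr]; split; first exact: mulr_gt0.
  by rewrite scalerA invfM mulrAC mulVf ?gt_eqF// mul1r.
have g0 : gauge 0 = 0.
  apply/eqP; rewrite eq_le; apply/andP; split; last first.
    by apply: lb_le_inf; [case: (scales_inf D0)|move=> r [/ltW]].
  apply/ler_addgt0Pl => e e0; rewrite addr0; apply: gauge_le; split => //.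
  by rewrite scaler0 addr0.
have gauge_homle a u : 0 < a -> D u -> gauge (a *: u) <= a * gauge u.
  move=> a0 Du; rewrite mulrC -ler_pdivrMr//; apply: lb_le_inf.
    by case: (scales_inf Du).
  by move=> r ur; rewrite ler_pdivrMr// mulrC; apply: gauge_le; exact: scaleP.
have gauge_hom a u : 0 <= a -> D u -> gauge (a *: u) = a * gauge u.
  rewrite le_eqVlt => /predU1P[<-|a0] Du; first by rewrite scale0r mul0r.
  apply/eqP; rewrite eq_le gauge_homle//= -ler_pdivlMl//.
  have := @gauge_homle a^-1 (a *: u).
  by rewrite scalerA mulVf ?gt_eqF// scale1r; apply; rewrite ?invr_gt0//; exact: DZ.
have gauge_sub u v : D u -> D v -> gauge (u + v) <= gauge u + gauge v.
  move=> Du Dv; have uv r s : scales u r -> scales v s -> scales (u + v) (r + s).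
    move=> [r0 Kr] [s0 Ks]; split; first exact: addr_gt0.
    have rs0 : r + s != 0 by rewrite gt_eqF// addr_gt0.
    have := K_conv (t := s / (r + s)) _ _ Kr Ks.
    (* With weights r / (r + s) and s / (r + s), the two points of [K] combine to the point of scale
       r + s in the direction u + v. *)
    have -> : (1 - s / (r + s)) *: (w0 + r^-1 *: u) + (s / (r + s)) *: (w0 + s^-1 *: v)
            = w0 + (r + s)^-1 *: (u + v).
      have -> : 1 - s / (r + s) = r / (r + s) by field.
      rewrite !scalerDr !scalerA addrACA -scalerDl -mulrDl divff// scale1r.
      by rewrite mulrAC divff ?gt_eqF// mulrAC divff ?gt_eqF// mul1r.
    apply; first by rewrite divr_ge0 ?ltW// addr_gt0.
    by rewrite ler_pdivrMr ?addr_gt0// mul1r lerDr ltW.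
  rewrite -lerBlDr; apply: lb_le_inf; first by case: (scales_inf Du).
  move=> r ur; rewrite lerBlDr -lerBlDl; apply: lb_le_inf.
    by case: (scales_inf Dv).
  by move=> s vs; rewrite lerBlDl; apply: gauge_le; exact: uv.
have := @hahn_banach R V D (fun u => (S - l0) * gauge u) D_lin _ _ A0 _ _.
case.
- by move=> a u a0 Du; rewrite gauge_hom// mulrCA.
- by move=> u v Du Dv; rewrite -mulrDr ler_wpM2l// gauge_sub.
- by exists (w0, l0).
- split=> // -[u a] Aa /=.
  have Du : D u := A0_D Aa.
  (* The pair (w0 + u / r, l0 + a / r) belongs to [A0] and its first component to [K], so l0 + a / r
     <= S. *)
  have le r : scales u r -> a <= (S - l0) * r.
    move=> [r0 Kr]; have := A0_S (A0_lin r^-1 Aa A0_w0); rewrite /= addrC => /(_ Kr).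
    by rewrite -lerBrDr ler_pdivrMl// mulrC.
  have [m_gt0|m_le0] := ltP 0 (S - l0).
    rewrite -ler_pdivrMl//; apply: lb_le_inf; first by case: (scales_inf Du).
    by move=> r ur; rewrite ler_pdivrMl//; exact: le.
  have mE : S - l0 = 0 by apply/eqP; rewrite eq_le m0 m_le0.
  have [[r ur] _] := scales_inf Du.
  by have := le _ ur; rewrite mE !mul0r.
move=> f [f_lin f_le fA0]; exists f; split=> // u Du Ku.
have DB : D (u - w0) by rewrite addrC -scaleN1r; exact: D_lin.
have f0 : f w0 = l0 := fA0 _ A0_w0.
have : f (u - w0) = f u - f w0.
  by rewrite addrC -scaleN1r f_lin// mulN1r addrC.
(* For u in [K] the number 1 is a scale of u - w0. *)
have : (S - l0) * gauge (u - w0) <= S - l0.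
  rewrite -[leRHS]mulr1 ler_wpM2l//; apply: gauge_le; split => //.
  by rewrite invr1 scale1r addrC subrK.
have := f_le _ DB; lra.
Qed.

End ConvexExtension.

(** * Riesz representation on a compact set *)

(** The distance to [F] is 1-Lipschitz and vanishes exactly on a closed [F]; for empty [F] the
    constant 1 takes its place. *)
Lemma closed_zero_set {R : realType} {T : normedModType R} (F : set T) :
  closed F ->
  exists h : T -> R, [/\ continuous h, forall x, 0 <= h x & forall x, F x <-> h x = 0].
Proof.
move=> cF; have [->|/set0P[y0 Fy0]] := eqVneq F set0.
  exists (fun=> 1); split=> [x| |x]; first exact: cvg_cst.
    by move=> _; exact: ler01.
  by split => // /eqP; rewrite oner_eq0.
pose E x := [set `|x - y| | y in F]; pose h x := inf (E x).
have E0 x : has_inf (E x).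
  by split; [exists `|x - y0|, y0|exists 0 => _ [y _ <-]].
have h0 x : 0 <= h x.
  by apply: lb_le_inf; [case: (E0 x)|move=> _ [y _ <-]].
have hle x y : F y -> h x <= `|x - y|.
  by move=> Fy; apply: ge_inf; [case: (E0 x)|exists y].
have lip x x' : h x <= `|x - x'| + h x'.
  rewrite -lerBlDl; apply: lb_le_inf; first by case: (E0 x').
  move=> _ [y Fy <-]; rewrite lerBlDl (le_trans (hle x y Fy))//.
  by rewrite (le_trans _ (ler_normD _ _))// addrA subrK.
exists h; split => // x.
- apply/cvgrPdist_le => e e0; near=> x'.
  have : `|x - x'| <= e by near: x'; exact: cvgr_dist_le.
  rewrite ler_norml; have := lip x x'; have := lip x' x; rewrite (distrC x' x).
  by move=> h1 h2 xe; apply/andP; split; lra.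
- split=> [Fx|hx].
    apply/eqP; rewrite eq_le h0 andbT; have := hle x x Fx.
    by rewrite subrr normr0.
  apply: cF => B /nbhs_ballP[e /= e0 Be].
  have [_ [y Fy <-] ye] := inf_adherent e0 (E0 x).
  by exists y; split => //; apply: Be; rewrite -ball_normE /=; move: ye; rewrite -/(h x) hx add0r.
Unshelve. all: by end_near. Qed.

Section WithinContinuous.
Context {R : realType} {T : topologicalType} (Q : set T).
Implicit Types f g : T -> R.

Lemma within_cst {U : topologicalType} (c : U) : {within Q, continuous (fun=> c)}.
Proof. by apply: continuous_subspaceT => x; exact: cvg_cst. Qed.

Lemma withinD {V : normedModType R} (f g : T -> V) :
  {within Q, continuous f} -> {within Q, continuous g} ->
  {within Q, continuous (fun x => f x + g x)}.
Proof. by move=> cf cg x; apply: (@continuousD _ _ (subspace Q) f g); [exact: cf|exact: cg]. Qed.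

Lemma withinN {V : normedModType R} (f : T -> V) :
  {within Q, continuous f} -> {within Q, continuous (fun x => - f x)}.
Proof. by move=> cf x; apply: (@continuousN _ _ (subspace Q) f); exact: cf. Qed.

Lemma withinB {V : normedModType R} (f g : T -> V) :
  {within Q, continuous f} -> {within Q, continuous g} ->
  {within Q, continuous (fun x => f x - g x)}.
Proof. by move=> cf cg; apply: withinD => //; exact: withinN. Qed.

Lemma withinM f g :
  {within Q, continuous f} -> {within Q, continuous g} ->
  {within Q, continuous (fun x => f x * g x)}.
Proof. by move=> cf cg x; apply: (@continuousM _ (subspace Q) f g); [exact: cf|exact: cg]. Qed.

Lemma withinZ {V : normedModType R} f (g : T -> V) :
  {within Q, continuous f} -> {within Q, continuous g} ->
  {within Q, continuous (fun x => f x *: g x)}.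
Proof. by move=> cf cg x; apply: cvgZ; [exact: cf|exact: cg]. Qed.

Lemma within_min f g :
  {within Q, continuous f} -> {within Q, continuous g} ->
  {within Q, continuous (fun x => Num.min (f x) (g x))}.
Proof. by move=> cf cg x; apply: (@continuous_min _ (subspace Q) f g); [exact: cf|exact: cg]. Qed.

Lemma within_max f g :
  {within Q, continuous f} -> {within Q, continuous g} ->
  {within Q, continuous (fun x => Num.max (f x) (g x))}.
Proof. by move=> cf cg x; apply: (@continuous_max _ (subspace Q) f g); [exact: cf|exact: cg]. Qed.

Lemma within_sum {V : normedModType R} (I : Type) (s : seq I) (F : I -> T -> V) :
  (forall i, {within Q, continuous (F i)}) ->
  {within Q, continuous (fun x => \sum_(i <- s) F i x)}.
Proof.
move=> cF; elim: s => [|i s IH].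
  under eq_fun do rewrite big_nil; exact: within_cst.
by under eq_fun do rewrite big_cons; apply: withinD => //; exact: cF.
Qed.

Lemma within_comp {U W : topologicalType} (g : U -> W) (f : T -> U) :
  continuous g -> {within Q, continuous f} -> {within Q, continuous (fun x => g (f x))}.
Proof.
by move=> cg cf x; apply: (@continuous_comp (subspace Q) _ _ f g); [exact: cf|exact: cg].
Qed.

Lemma within_bounded f : compact Q -> {within Q, continuous f} ->
  exists2 M, 0 <= M & forall x, Q x -> `|f x| <= M.
Proof.
move=> cQ cf; have /pinfty_ex_gt0[M M0 MP] : bounded_set (f @` Q).
  by apply: compact_bounded; exact: continuous_compact.
by exists M; [exact: ltW|move=> x Qx; apply: MP; exists x].
Qed.

End WithinContinuous.

Lemma within_measurable {R : realType} {T : ptopologicalType} (Q : set (borel T))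
    (f : T -> R) :
  measurable Q -> {within (Q : set T), continuous f} ->
  measurable_fun Q (f : borel T -> R).
Proof.
move=> mQ /continuousP cf; apply: (measurability _ (RGenOpens.measurableE R)).
move=> _ [_ [a [b ->] <-]].
have /open_subspaceP[V oV] : open (f @^-1` `]a, b[ : set (subspace (Q : set T))).
  exact/cf/interval_open.
rewrite setIC => VQ; rewrite setIC -[_ `&` Q]VQ setIC; apply: measurableI => //.
exact: sub_sigma_algebra.
Qed.

Section RieszOuter.
Context {R : realType} {T : normedModType R} (Q : set T).
Hypothesis cQ : compact Q.

Definition nonneg_cont (f : T -> R) : Prop :=
  {within Q, continuous f} /\ forall x, Q x -> 0 <= f x.

(** The total variation of a signed functional is additive only on nonnegative functions, so the
    axioms concern these alone. *)
Record positive_functional (L : (T -> R) -> R) : Prop := PositiveFunctional {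
  pf_add : forall f g, nonneg_cont f -> nonneg_cont g ->
    L (fun x => f x + g x) = L f + L g;
  pf_scale : forall c f, 0 <= c -> nonneg_cont f -> L (fun x => c * f x) = c * L f;
  pf_mono : forall f g, nonneg_cont f -> nonneg_cont g ->
    (forall x, Q x -> f x <= g x) -> L f <= L g }.

Variable L : (T -> R) -> R.
Hypothesis LP : positive_functional L.

Lemma nonneg_cst c : 0 <= c -> nonneg_cont (fun=> c).
Proof. by move=> c0; split => //; exact: within_cst. Qed.
Hint Resolve nonneg_cst : core.

Lemma nonnegD f g : nonneg_cont f -> nonneg_cont g -> nonneg_cont (fun x => f x + g x).
Proof.
by move=> [cf f0] [cg g0]; split=> [|x Qx]; [exact: withinD|rewrite addr_ge0 ?f0 ?g0].
Qed.

Lemma nonnegM f g : nonneg_cont f -> nonneg_cont g -> nonneg_cont (fun x => f x * g x).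
Proof.
by move=> [cf f0] [cg g0]; split=> [|x Qx]; [exact: withinM|rewrite mulr_ge0 ?f0 ?g0].
Qed.

Lemma nonneg_sum (I : Type) (s : seq I) (F : I -> T -> R) :
  (forall i, nonneg_cont (F i)) -> nonneg_cont (fun x => \sum_(i <- s) F i x).
Proof.
move=> F0; split=> [|x Qx]; first by apply: within_sum => i; case: (F0 i).
by apply: sumr_ge0 => i _; exact: (F0 i).2.
Qed.

Lemma pf0 : L (fun=> 0) = 0.
Proof. by have := pf_scale LP (lexx 0) (nonneg_cst ler01); rewrite !mul0r. Qed.

Lemma pf_ge0 f : nonneg_cont f -> 0 <= L f.
Proof.
by move=> f0; rewrite -pf0; apply: pf_mono LP _ _ _ _ _; [exact: nonneg_cst|exact: f0|exact: f0.2].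
Qed.

Lemma pf_ext f g : nonneg_cont f -> nonneg_cont g -> (forall x, Q x -> f x = g x) -> L f = L g.
Proof.
move=> f0 g0 fg; apply/eqP; rewrite eq_le; apply/andP; split;
by apply: pf_mono => // x /fg->.
Qed.

Lemma pf_sum (I : Type) (s : seq I) (F : I -> T -> R) : (forall i, nonneg_cont (F i)) ->
  L (fun x => \sum_(i <- s) F i x) = \sum_(i <- s) L (F i).
Proof.
move=> F0; elim: s => [|i s IH].
  by under eq_fun do rewrite big_nil; rewrite big_nil pf0.
under eq_fun do rewrite big_cons; rewrite big_cons -IH; apply: pf_add => //.
exact: nonneg_sum.
Qed.

(* As in the Daniell construction, [c] bounds the integral of the lower
   semicontinuous function [sup g n], which dominates the indicator of [E] on [Q]. *)
Definition fun_cover (E : set T) (g : nat -> T -> R) (c : R) : Prop :=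
  [/\ forall n, nonneg_cont (g n),
      forall m n x, Q x -> (m <= n)%N -> g m x <= g n x,
      forall n, L (g n) <= c &
      forall x a, E x -> Q x -> a < 1 -> exists n, a < g n x].

Definition outer_real (E : set T) : R := inf [set c | exists g, fun_cover E g c].

Lemma fun_cover1 E : fun_cover E (fun _ _ => 1) (L (fun=> 1)).
Proof. by split => // [_|x a _ _ a1]; [exact: nonneg_cst|exists 0%N]. Qed.

Lemma fun_cover_ge0 E g c : fun_cover E g c -> 0 <= c.
Proof. by move=> [g0 _ gc _]; apply: le_trans (gc 0%N); exact: pf_ge0. Qed.

Lemma outer_has_inf E : has_inf [set c | exists g, fun_cover E g c].
Proof.
split; first by exists (L (fun=> 1)), (fun _ _ => 1); exact: fun_cover1.
by exists 0 => c [g] /fun_cover_ge0.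
Qed.

Lemma outer_le E g c : fun_cover E g c -> outer_real E <= c.
Proof. by move=> gc; apply: ge_inf; [case: (outer_has_inf E)|exists g]. Qed.

Lemma outer_real_ge0 E : 0 <= outer_real E.
Proof. by apply: lb_le_inf; [case: (outer_has_inf E)|move=> c [g] /fun_cover_ge0]. Qed.

Lemma outer_lt E e : 0 < e -> exists g c, fun_cover E g c /\ c < outer_real E + e.
Proof.
by move=> e0; have [c [g gc] ce] := inf_adherent e0 (outer_has_inf E); exists g, c.
Qed.

Lemma le_outer_real A B : A `<=` B -> outer_real A <= outer_real B.
Proof.
move=> AB; apply: lb_le_inf; first by case: (outer_has_inf B).
move=> c [g [g0 gm gc gB]]; apply: (@outer_le _ g); split => // x a /AB; exact: gB.
Qed.

Lemma outer_disjoint E : E `&` Q = set0 -> outer_real E = 0.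
Proof.
move=> EQ; apply/eqP; rewrite eq_le outer_real_ge0 andbT.
apply: (@outer_le _ (fun _ _ => 0)); split => //; first by move=> _; exact: nonneg_cst.
  by rewrite pf0.
by move=> x a Ex Qx; have : (E `&` Q) x by []; rewrite EQ.
Qed.

(** Near-optimal covers of the [F i], the i-th overshooting by at most e / 2^(i+1), are added along
    the diagonal: the n-th function sums the first n covers at stage n. These sums increase with n
    and their values under [L] stay below c + e. *)
Lemma outer_bigcup (F : nat -> set T) (e : R) :
  0 < e -> (forall c, (forall n, \sum_(i < n) outer_real (F i) <= c) ->
  outer_real (\bigcup_i F i) <= c + e).
Proof.
move=> e0 c Fc; pose eps i := e / (2 ^ i.+1)%:R.
have eps0 i : 0 < eps i by rewrite divr_gt0// ltr0n expn_gt0.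
have sum_eps n : \sum_(i < n) eps i = e - e / (2 ^ n)%:R.
  elim: n => [|n IH]; first by rewrite big_ord0 expn0 divr1 subrr.
  rewrite big_ord_recr/= IH /eps expnS natrM invfM.
  have : (2 ^ n)%:R != 0 :> R by rewrite pnatr_eq0 -lt0n expn_gt0.
  by move=> ?; field.
have /choice[gc gcP] i : exists gc : (nat -> T -> R) * R,
    fun_cover (F i) gc.1 gc.2 /\ gc.2 < outer_real (F i) + eps i.
  by have [g [d [? ?]]] := outer_lt (F i) (eps0 i); exists (g, d).
pose G n x := \sum_(i < n) (gc i).1 n x.
have g0 i n : nonneg_cont ((gc i).1 n) by have [[]] := gcP i.
have gm i := let: conj (And4 _ m _ _) _ := gcP i in m.
apply: (@outer_le _ G); split.
- by move=> n; apply: nonneg_sum => i; exact: g0.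
- move=> m n x Qx mn; rewrite /G -[in leRHS](subnKC mn) big_split_ord/=.
  rewrite -[leLHS]addr0; apply: lerD.
    by apply: ler_sum => i _; rewrite subnKC//; apply: gm.
  by apply: sumr_ge0 => i _; exact: (g0 _ _).2.
- move=> n; rewrite pf_sum; last by move=> i; exact: g0.
  apply: (@le_trans _ _ (\sum_(i < n) (outer_real (F i) + eps i))).
    apply: ler_sum => i _; have [[_ _ gle _] le] := gcP i.
    by rewrite (le_trans (gle n))// ltW.
  rewrite big_split/= sum_eps; apply: lerD; first exact: Fc.
  by rewrite lerBlDr lerDl divr_ge0// ltW.
- move=> x a [i _ Fix] Qx a1; have [[_ _ _ gcov] _] := gcP i.
  have [n an] := gcov x a Fix Qx a1.
  pose N := maxn i.+1 n; have iN : (i < N)%N by rewrite /N leq_maxl.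
  exists N; apply: (lt_le_trans an); rewrite /G (bigD1 (Ordinal iN))//=.
  rewrite -[leLHS]addr0; apply: lerD; first by apply: gm; rewrite // leq_maxr.
  by apply: sumr_ge0 => j _; exact: (g0 _ _).2.
Qed.

End RieszOuter.

Section RieszMeasure.
Context {R : realType} {T : normedModType R}.
Local Open Scope ereal_scope.

Definition riesz_outer (Q : set T) (L : (T -> R) -> R)
  (LP : positive_functional Q L) (E : set T) : \bar R := (outer_real Q L E)%:E.

Variables (Q : set T) (L : (T -> R) -> R).
Hypothesis LP : positive_functional Q L.

Let riesz_outer0 : riesz_outer LP set0 = 0.
Proof. by rewrite /riesz_outer (outer_disjoint LP)// set0I. Qed.

Let riesz_outer_ge0 E : 0 <= riesz_outer LP E.
Proof. by rewrite lee_fin (outer_real_ge0 LP). Qed.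

Let le_riesz_outer : {homo riesz_outer LP : A B / A `<=` B >-> A <= B}.
Proof. by move=> A B AB; rewrite lee_fin (le_outer_real LP). Qed.

Let riesz_outer_sigma_subadditive : sigma_subadditive (riesz_outer LP).
Proof.
move=> F; set S := (X in _ <= X).
have S0 : 0 <= S by apply: nneseries_ge0 => i _ _; exact: riesz_outer_ge0.
have [->|Sy] := eqVneq S +oo; first by rewrite leey.
have Sfin : S \is a fin_num by rewrite ge0_fin_numE// lt_neqAle Sy leey.
apply/lee_addgt0Pr => e e0; rewrite -(fineK Sfin) -EFinD lee_fin.
apply: (outer_bigcup LP e0) => n; rewrite -lee_fin (fineK Sfin) -sumEFin.
rewrite -(big_mkord xpredT (fun i => riesz_outer LP (F i))).
by apply: nneseries_lim_ge => i _ _; exact: riesz_outer_ge0.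
Qed.

HB.instance Definition _ := isOuterMeasure.Build R T (riesz_outer LP)
  riesz_outer0 riesz_outer_ge0 le_riesz_outer riesz_outer_sigma_subadditive.

(* The cutoffs [u m] decrease to the indicator of [F]; a cover of [X] times
   [1 - u n] along the diagonal covers [X] off [F], and times a fixed [u M] it
   covers [X] on [F]. *)
Lemma closed_caratheodory (F : set T) : closed F ->
  caratheodory_measurable (riesz_outer LP) F.
Proof.
move=> /closed_zero_set[h [ch h0 hF]]; apply: le_caratheodory_measurable => X.
rewrite -EFinD lee_fin; apply/ler_addgt0Pl => e e0.
have e20 : (0 < e / 2)%R by rewrite divr_gt0.
have [g [c [[g0 gm gc gX] cX]]] := outer_lt LP X e20.
pose u m x := Num.max 0%R (1 - m%:R * h x)%R.
have u0 m x : (0 <= u m x)%R by rewrite le_max lexx.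
have u1 m x : (u m x <= 1)%R.
  by rewrite ge_max ler01 lerBlDr lerDl mulr_ge0.
have u_anti m n x : (m <= n)%N -> (u n x <= u m x)%R.
  move=> mn; rewrite ge_max le_max lexx/= le_max; apply/orP; right.
  by rewrite lerB// ler_wpM2r// ler_nat.
have cu m : {within Q, continuous (u m)}.
  apply: within_max; first exact: within_cst.
  apply: withinB; first exact: within_cst.
  by apply: withinM; [exact: within_cst|exact: continuous_subspaceT].
have uC m : nonneg_cont Q (u m) by split.
have vC m : nonneg_cont Q (fun x => 1 - u m x)%R.
  by split=> [|x _]; [apply: withinB => //; exact: within_cst|rewrite subr_ge0].
have LE m n : (L (fun x => g n x * u m x) + L (fun x => g n x * (1 - u m x)) = L (g n))%R.
  rewrite -(pf_add LP); try exact: nonnegM.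
  by congr L; apply/funext => x; ring.
pose b n := L (fun x => g n x * (1 - u n x))%R.
have b_c n : (b n <= c)%R.
  apply: le_trans (gc n); rewrite -(LE n n) lerDr; apply: (pf_ge0 LP); exact: nonnegM.
have b_sup : has_sup (range b).
  by split; [exists (b 0%N), 0%N|exists c => _ [n _ <-]].
(* The part of [X] off [F] will cost at most the supremum of [b], the part on [F] at most c - b M.
   With b M within e / 2 of the supremum, the sum is below c + e / 2. *)
have [_ [M _ <-] bM] := sup_adherent e20 b_sup.
have b_le n : (b n <= sup (range b))%R by apply: ub_le_sup; [case: b_sup|exists n].
have XcF : (outer_real Q L (X `&` ~` F) <= sup (range b))%R.
  apply: (outer_le LP (g := fun n x => g n x * (1 - u n x))%R); split => //.
  - by move=> n; exact: nonnegM.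
  - move=> m n x Qx mn; rewrite ler_pM// ?subr_ge0//; first exact: (g0 m).2.
      exact: gm.
    by rewrite lerB// u_anti.
  - move=> x a [Xx nFx] Qx a1; have [n an] := gX x a Xx Qx a1.
    have hx : (0 < h x)%R.
      by rewrite lt_neqAle h0 andbT eq_sym; apply/eqP => /hF.
    have [m hm] : exists m, (1 <= m%:R * h x)%R.
      exists (Num.bound (h x)^-1); rewrite -ler_pdivrMr// mul1r.
      by apply/ltW/archi_boundP; rewrite invr_ge0.
    exists (maxn m n); have -> : u (maxn m n) x = 0%R.
      apply/eqP; rewrite eq_le u0 andbT ge_max lexx/= subr_le0 (le_trans hm)//.
      by rewrite ler_wpM2r// ler_nat leq_maxl.
    by rewrite subr0 mulr1 (lt_le_trans an)//; apply: gm; rewrite // leq_maxr.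
have XF : (outer_real Q L (X `&` F) <= c - b M)%R.
  have gM n : (M <= n)%N -> (L (fun x => g n x * u M x) <= c - b M)%R.
    move=> Mn; rewrite lerBrDr; apply: le_trans (gc n); rewrite -(LE M n) lerD2l.
    apply: (pf_mono LP); try exact: nonnegM.
    by move=> x Qx; rewrite ler_wpM2r ?subr_ge0//; apply: gm.
  apply: (outer_le LP (g := fun n x => g n x * u M x)%R); split.
  - by move=> n; exact: nonnegM.
  - by move=> m n x Qx mn; rewrite ler_wpM2r//; exact: gm.
  - move=> n; apply: le_trans (gM (maxn M n) (leq_maxl _ _)).
    apply: (pf_mono LP); try exact: nonnegM.
    by move=> x Qx; rewrite ler_wpM2r//; apply: gm; rewrite // leq_maxr.
  - move=> x a [Xx /hF hx] Qx a1; have [n an] := gX x a Xx Qx a1; exists n.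
    by rewrite /u hx mulr0 subr0 max_r// mulr1.
lra.
Qed.

Lemma measurable_caratheodory (A : set (borel T)) : measurable A ->
  caratheodory_measurable (riesz_outer LP) A.
Proof.
apply: smallest_sub; last first.
  move=> U oU; rewrite -(setCK U); apply: caratheodory_measurable_setC.
  by apply: closed_caratheodory; exact: open_closedC.
split.
- exact: caratheodory_measurable_set0.
- by move=> B mB; rewrite setTD; exact: caratheodory_measurable_setC.
- by move=> B mB; exact: caratheodory_measurable_bigcup.
Qed.

Definition riesz_measure (LQ : positive_functional Q L) (A : set (borel T)) : \bar R :=
  riesz_outer LQ A.

Let riesz_measure_sigma_additive : semi_sigma_additive (riesz_measure LP).
Proof.
move=> F mF tF mUF; rewrite /riesz_measure.
apply: caratheodory_measure_sigma_additive => //; last exact: measurable_caratheodory.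
by move=> i; exact: measurable_caratheodory.
Qed.

HB.instance Definition _ := isMeasure.Build _ (borel T) R (riesz_measure LP)
  riesz_outer0 riesz_outer_ge0 riesz_measure_sigma_additive.

Let riesz_measure_finite : fin_num_fun (riesz_measure LP).
Proof. by []. Qed.

HB.instance Definition _ :=
  @Measure_isFinite.Build _ (borel T) R (riesz_measure LP) riesz_measure_finite.

End RieszMeasure.

Section BoundedMeasurable.
Context {R : realType} {d : measure_display} {T : measurableType d}.
Implicit Types (D A : set T) (f g : T -> R).

Definition bounded_mfun D f : Prop :=
  measurable_fun D f /\ exists M, forall x, D x -> `|f x| <= M.

Lemma bmf_cst D c : bounded_mfun D (fun=> c).
Proof. by split; [exact: measurable_cst|exists `|c|]. Qed.

Lemma bmfD D f g : bounded_mfun D f -> bounded_mfun D g ->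
  bounded_mfun D (fun x => f x + g x).
Proof.
move=> [mf [M fM]] [mg [N gN]]; split; first exact: measurable_funD.
by exists (M + N) => x Dx; rewrite (le_trans (ler_normD _ _))// lerD ?fM ?gN.
Qed.

Lemma bmfM D f g : bounded_mfun D f -> bounded_mfun D g ->
  bounded_mfun D (fun x => f x * g x).
Proof.
move=> [mf [M fM]] [mg [N gN]]; split; first exact: measurable_funM.
by exists (M * N) => x Dx; rewrite normrM ler_pM ?fM ?gN.
Qed.

Lemma bmfB D f g : bounded_mfun D f -> bounded_mfun D g ->
  bounded_mfun D (fun x => f x - g x).
Proof.
move=> Hf Hg; apply: bmfD => //; under eq_fun do rewrite -mulN1r.
by apply: bmfM => //; exact: bmf_cst.
Qed.

Lemma bmf_indic D A : measurable A -> bounded_mfun D (\1_A : T -> R).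
Proof.
move=> mA; split; first exact: measurable_indic.
by exists 1 => x _; rewrite indicE; case: (_ \in _); rewrite ?normr1 ?normr0.
Qed.

Lemma bmf_integrable (m : {finite_measure set T -> \bar R}) D f :
  measurable D -> bounded_mfun D f -> m.-integrable D (EFin \o f).
Proof.
move=> mD [mf [M fM]]; apply: measurable_bounded_integrable => //.
  by rewrite ltey_eq fin_num_measure.
exists M; split; first exact: num_real.
by move=> N MN x Dx; apply: le_trans (fM x Dx) _; exact: ltW.
Qed.

Lemma Rintegral_indic (m : {finite_measure set T -> \bar R}) D A :
  measurable D -> measurable A -> \int[m]_(x in D) \1_A x = fine (m (A `&` D)).
Proof. by move=> mD mA; rewrite /Rintegral integral_indic. Qed.

Lemma integral_EFin_bmf (m : {finite_measure set T -> \bar R}) D f :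
  measurable D -> bounded_mfun D f ->
  (\int[m]_(x in D) (f x)%:E)%E = (\int[m]_(x in D) f x)%:E.
Proof.
by move=> mD Hf; rewrite /Rintegral fineK//; apply: integrable_fin_num => //; exact: bmf_integrable.
Qed.

End BoundedMeasurable.

Lemma closed_borel {R : realType} {T : normedModType R} (Q : set T) :
  closed Q -> measurable (Q : set (borel T)).
Proof.
move=> cQ; rewrite -[X in measurable X]setCK; apply: measurableC.
by apply: sub_sigma_algebra; exact: closed_openC.
Qed.

Lemma compact_borel {R : realType} {T : normedModType R} (Q : set T) :
  compact Q -> measurable (Q : set (borel T)).
Proof. by move=> cQ; apply: closed_borel; apply: compact_closed cQ; exact: norm_hausdorff. Qed.

Lemma within_bmf {R : realType} {T : normedModType R} (Q : set T) (f : T -> R) :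
  compact Q -> {within Q, continuous f} -> bounded_mfun (Q : set (borel T)) f.
Proof.
move=> cQ cf; split; last by have [M _ fM] := within_bounded cQ cf; exists M.
by apply: within_measurable => //; exact: compact_borel.
Qed.

Section RieszRepresentation.
Context {R : realType} {T : normedModType R} (Q : set T) (L : (T -> R) -> R).
Hypothesis cQ : compact Q.
Hypothesis LP : positive_functional Q L.

Local Notation m := (riesz_measure LP : {finite_measure set (borel T) -> \bar R}).

Let mQ : measurable (Q : set (borel T)) := compact_borel cQ.

Lemma riesz_measure_concentrated : concentrated m (Q : set (borel T)).
Proof. by move=> A mA AQ; exact: (congr1 EFin (outer_disjoint LP AQ)). Qed.

(** Dini's argument: by compactness an increasing cover of [Q] is uniformly at least any given a < 1
    from some index on, so a L(1) is at most the cost of the cover. The number a is so close to 1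
    that (1 - a) L(1) <= e. *)
Lemma riesz_mass : fine (m Q) = L (fun=> 1).
Proof.
rewrite /riesz_measure /riesz_outer /=; apply/eqP; rewrite eq_le.
apply/andP; split; first exact: (outer_le LP (fun_cover1 Q L Q)).
apply: lb_le_inf; first by case: (outer_has_inf LP Q).
move=> c [g [g0 gm gc gQ]]; apply/ler_addgt0Pl => e e0.
have L1 : 0 <= L (fun=> 1) by apply: (pf_ge0 LP); exact: nonneg_cst.
have [a a1 La] : exists2 a, 0 <= a < 1 & L (fun=> 1) <= e + a * L (fun=> 1).
  exists (1 - e / (e + L (fun=> 1))).
    rewrite ltrBlDr ltrDl divr_gt0 ?ltr_pwDl// andbT subr_ge0.
    by rewrite ler_pdivrMr ?ltr_pwDl// mul1r lerDl.
  rewrite mulrBl mul1r addrCA lerDl subr_ge0 mulrAC ler_pdivrMr ?ltr_pwDl//.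
  by rewrite ler_pM2l// lerDr ltW.
(* Otherwise points [x_ n] with g n (x_ n) < a cluster at some x of [Q]. Some g N exceeds a at x,
   hence near x, whereas monotonicity gives g N (x_ n) < a for n >= N. *)
have [n an] : exists n, forall x, Q x -> a <= g n x.
  apply: contrapT => /forallNP nn.
  have /choice[x_ x_P] n : exists x, Q x /\ g n x < a.
    by have /existsNP[x /not_implyP[Qx /negP]] := nn n; rewrite -ltNge; exists x.
  have PF : ProperFilter (x_ @ \oo) by exact: fmap_proper_filter.
  have [|x [Qx clx]] := cQ PF; first by exists 0%N => // n _; exact: (x_P n).1.
  have [N aN] := gQ x a Qx Qx (andP a1).2.
  have U : within Q (nbhs x) [set y | a < g N y].
    rewrite nbhs_subspace_in//; apply: ((g0 N).1 x [set r | a < r]).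
    by apply: open_nbhs_nbhs; split; [exact: open_gt|exact: aN].
  have V : \forall n \near \oo, Q (x_ n) /\ g N (x_ n) < a.
    near=> n; split; first exact: (x_P n).1.
    apply: le_lt_trans (x_P n).2; apply: gm; first exact: (x_P n).1.
    by near: n; exact: nbhs_infty_ge.
  have [y [[Qy ya] /= /(_ Qy)]] := clx [set y | Q y /\ g N y < a] _ V U.
  by move=> /lt_trans/(_ ya); rewrite ltxx.
apply: (le_trans La); rewrite lerD2l; apply: le_trans (gc n).
rewrite -(pf_scale LP)//; [|by case/andP: a1|exact: nonneg_cst].
apply: (pf_mono LP) => //.
  by split=> [|x _]; [exact: within_cst|rewrite mulr1; case/andP: a1].
by move=> x Qx; rewrite mulr1; exact: an.
Unshelve. all: by end_near. Qed.

(* Layer cake: the increment of [min(f, c)] from [c = k dl] to [c = (k+1) dl],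
   divided by [dl], covers the set where [f >= (k+1) dl]. *)
Lemma riesz_integral_le f : nonneg_cont Q f -> \int[m]_(x in Q) f x <= L f.
Proof.
move=> f0; have [cf fge0] := f0.
have bm g : {within Q, continuous g} -> m.-integrable Q (EFin \o (g : borel T -> R)).
  by move=> cg; apply: bmf_integrable => //; exact: within_bmf.
pose t c x := Num.min (f x) c.
have ct c : {within Q, continuous (t c)} by apply: within_min => //; exact: within_cst.
have t0 c : 0 <= c -> nonneg_cont Q (t c).
  by move=> c0; split => // x Qx; rewrite le_min fge0.
(* The comparison lags by one layer: the truncation at (k+1) dl on the left faces the truncation at
   k dl under [L], and the extra layer costs dl times the mass. *)
have layers dl k : 0 < dl -> \int[m]_(x in Q) t (k.+1%:R * dl) x
    <= dl * fine (m Q) + L (t (k%:R * dl)).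
  move=> dl0; elim: k => [|k IH].
    apply: (@le_trans _ _ (\int[m]_(x in Q) dl)).
      apply: le_Rintegral => //; [exact: bm|exact/bm/within_cst|].
      by move=> x Qx; rewrite mul1r ge_min lexx orbT.
    by rewrite Rintegral_cst// lerDl (pf_ge0 LP)//; apply: t0; rewrite mul0r.
  pose A := Q `&` [set x | k.+1%:R * dl <= f x].
  have mA : measurable (A : set (borel T)).
    have [mf _] := within_bmf cQ cf.
    by rewrite /A; have := mf mQ `[k.+1%:R * dl, +oo[%classic (measurable_itv _);
      rewrite preimage_itvcy.
  have bA : m.-integrable Q (EFin \o (fun x => dl * \1_A x)).
    apply: bmf_integrable => //; apply: bmfM; [exact: bmf_cst|exact: bmf_indic].
  have k0 j : 0 <= j%:R * dl by rewrite mulr_ge0// ltW.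
  have kS j : j.+1%:R * dl = j%:R * dl + dl by rewrite -natr1 mulrDl mul1r.
  apply: (@le_trans _ _ (\int[m]_(x in Q) (t (k.+1%:R * dl) x + dl * \1_A x))).
    apply: le_Rintegral => //; first exact: bm.
      rewrite (_ : _ \o _ = (EFin \o t (k.+1%:R * dl)) \+ (EFin \o (fun x => dl * \1_A x)))//.
      by apply: integrableD => //; exact: bm.
    move=> x Qx; rewrite indicE /t [k.+2%:R * _]kS.
    have [fx|fx] := leP (k.+1%:R * dl) (f x).
      by rewrite mem_set//= mulr1 ge_min lexx orbT.
    by rewrite ge_min lerDl mulr_ge0// ltW.
  have IA : m.-integrable Q (EFin \o (\1_A : borel T -> R)).
    by apply: bmf_integrable => //; exact: bmf_indic.
  rewrite RintegralD//; last exact: bm.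
  rewrite RintegralZl// Rintegral_indic//.
  apply: (le_trans (lerD IH (lexx _))); rewrite -addrA lerD2l.
  pose phi x := t (k.+1%:R * dl) x - t (k%:R * dl) x.
  have phi0 : nonneg_cont Q phi.
    split=> [|x Qx]; first exact: withinB.
    by rewrite subr_ge0 le_min ge_min lexx/= ge_min kS lerDl (ltW dl0) orbT.
  have -> : L (t (k.+1%:R * dl)) = L (t (k%:R * dl)) + L phi.
    rewrite -(pf_add LP)//; last exact: t0.
    by congr L; apply/funext => x; rewrite /phi addrC subrK.
  rewrite lerD2l -ler_pdivlMl// -(pf_scale LP)//; last by rewrite invr_ge0 ltW.
  rewrite /riesz_measure /riesz_outer /=.
  apply: (outer_le LP (g := fun _ x => dl^-1 * phi x)); split => //.
    move=> _; split; first by apply: withinM; [exact: within_cst|exact: phi0.1].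
    by move=> x Qx; rewrite mulr_ge0 ?invr_ge0 ?(ltW dl0)//; exact: phi0.2.
  move=> x a [[Qx kfx] _] _ a1; exists 0%N.
  rewrite /phi /t min_r// min_r; last by rewrite (le_trans _ kfx)// kS lerDl ltW.
  by rewrite kS addrAC subrr add0r mulVf// gt_eqF.
have [M M0 fM] := within_bounded cQ cf.
apply/ler_addgt0Pl => e e0.
(* This makes dl times the mass at most e; [k] below is such that k dl exceeds the bound [M], so
   that both truncations are [f] on [Q]. *)
pose dl := e / (fine (m Q) + 1).
have mQ0 : 0 <= fine (m Q) by rewrite fine_ge0.
have dl0 : 0 < dl by rewrite divr_gt0// ltr_wpDl.
pose k := Num.bound (M / dl).
have fk x j : Q x -> (k <= j)%N -> t (j%:R * dl) x = f x.
  move=> Qx kj; rewrite /t min_l// (le_trans (ler_norm _))// (le_trans (fM x Qx))//.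
  rewrite -ler_pdivrMr//; apply: (@le_trans _ _ k%:R); last by rewrite ler_nat.
  by apply/ltW/archi_boundP; rewrite divr_ge0// ltW.
have := layers dl k dl0.
have -> : \int[m]_(x in Q) t (k.+1%:R * dl) x = \int[m]_(x in Q) f x.
  by apply: eq_Rintegral => x; rewrite inE => Qx; apply: fk.
rewrite (@pf_ext _ _ _ _ LP _ f) => [|||x Qx]; rewrite ?fk//; last first.
  by apply: t0; rewrite mulr_ge0// ltW.
move=> /le_trans; apply; rewrite lerD2r /dl mulrAC ler_pdivrMr ?ltr_wpDl//.
by rewrite ler_pM2l// lerDl.
Qed.

(** The missing inequality is [riesz_integral_le] for M - f, with M a bound of f. The constant M is
    integrated exactly because the mass is L(1). *)
Theorem riesz_integral f : nonneg_cont Q f -> \int[m]_(x in Q) f x = L f.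
Proof.
move=> f0; apply/eqP; rewrite eq_le riesz_integral_le//=.
have [M M0 fM] := within_bounded cQ f0.1.
have g0 : nonneg_cont Q (fun x => M - f x).
  split=> [|x Qx]; first by apply: withinB; [exact: within_cst|exact: f0.1].
  by rewrite subr_ge0 (le_trans (ler_norm _)) ?fM.
have bm g : {within Q, continuous g} -> m.-integrable Q (EFin \o (g : borel T -> R)).
  by move=> cg; apply: bmf_integrable => //; exact: within_bmf.
have := riesz_integral_le g0.
rewrite RintegralB//; [|exact/bm/within_cst|exact/bm/f0.1].
rewrite Rintegral_cst// riesz_mass.
have : L (fun=> M) = L f + L (fun x => M - f x).
  rewrite -(pf_add LP)//; congr L; apply/funext => x; ring.
have -> : L (fun=> M) = M * L (fun=> 1).
  rewrite -(pf_scale LP)//; last exact: nonneg_cst.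
  by congr L; apply/funext => x; rewrite mulr1.
lra.
Qed.

End RieszRepresentation.

Section SignedRiesz.
Context {R : realType} {T : normedModType R} (Q : set T) (l : (T -> R) -> R) (M : R).
Hypothesis cQ : compact Q.
Hypothesis l_lin : forall a (f g : T -> R), {within Q, continuous f} -> {within Q, continuous g} ->
  l (fun x => a * f x + g x) = a * l f + l g.
Hypothesis l_bnd : forall f : T -> R, {within Q, continuous f} ->
  (forall x, Q x -> `|f x| <= 1) -> l f <= M.

Let sub (f : T -> R) := [set l u | u in [set u : T -> R | {within Q, continuous u} /\
  forall x, Q x -> `|u x| <= f x]].
Let Lam f := sup (sub f).

Let cst0 : {within Q, continuous (fun=> 0 : R)}.
Proof. exact: within_cst. Qed.

Let l0 : l (fun=> 0) = 0.
Proof.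
have := l_lin (-1) cst0 cst0.
by rewrite mulr0 addr0 mulN1r addNr.
Qed.

Let lZ (a : R) (f : T -> R) : {within Q, continuous f} -> l (fun x => a * f x) = a * l f.
Proof.
move=> cf; have := l_lin a cf cst0.
by rewrite l0 addr0 => <-; congr l; apply/funext => x; rewrite addr0.
Qed.

Let lD (f g : T -> R) : {within Q, continuous f} -> {within Q, continuous g} ->
  l (fun x => f x + g x) = l f + l g.
Proof.
move=> cf cg; have := l_lin 1 cf cg.
by rewrite mul1r => <-; congr l; apply/funext => x; rewrite mul1r.
Qed.

Let sub_sup f : nonneg_cont Q f -> has_sup (sub f).
Proof.
move=> [cf f0]; split.
  exists (l (fun=> 0)), (fun=> 0) => //; split=> [|x Qx]; first exact: within_cst.
  by rewrite normr0 f0.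
have [B B0 fB] := within_bounded cQ cf.
exists ((B + 1) * M) => _ [u [cu uf] <-].
have B1 : 0 < B + 1 by rewrite ltr_wpDl.
rewrite -ler_pdivrMl// -lZ//; apply: l_bnd.
  by apply: withinM => //; exact: within_cst.
move=> x Qx; rewrite normrM gtr0_norm ?invr_gt0// ler_pdivrMl// mulr1.
by rewrite (le_trans (uf x Qx))// (le_trans (ler_norm _))// (le_trans (fB x Qx))// lerDl.
Qed.

Let le_Lam (f u : T -> R) : nonneg_cont Q f -> {within Q, continuous u} ->
  (forall x, Q x -> `|u x| <= f x) -> l u <= Lam f.
Proof. by move=> f0 cu uf; apply: ub_le_sup; [case: (sub_sup f0)|exists u]. Qed.

Let Lam_le (f : T -> R) (c : R) : nonneg_cont Q f -> (forall u : T -> R, {within Q, continuous u} ->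
  (forall x, Q x -> `|u x| <= f x) -> l u <= c) -> Lam f <= c.
Proof.
by move=> f0 H; apply: ge_sup; [case: (sub_sup f0)|move=> _ [u [cu uf] <-]; exact: H].
Qed.

Let LamD f g : nonneg_cont Q f -> nonneg_cont Q g ->
  Lam (fun x => f x + g x) = Lam f + Lam g.
Proof.
move=> f0 g0; have [cf fge0] := f0; have [cg gge0] := g0.
have fg0 : nonneg_cont Q (fun x => f x + g x) by exact: nonnegD.
apply/eqP; rewrite eq_le; apply/andP; split.
  apply: Lam_le => // w cw wfg.
  (* Riesz decomposition: truncating [w] to [-f, f] leaves a remainder bounded by [g]. *)
  pose u x := Num.max (- f x) (Num.min (f x) (w x)).
  have cu : {within Q, continuous u}.
    by apply: within_max; [exact: withinN|exact: within_min].
  have -> : w = fun x => u x + (w x - u x) by apply/funext => x; rewrite addrC subrK.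
  have cwu : {within Q, continuous (fun x => w x - u x)} by exact: withinB.
  rewrite lD//; apply: lerD; apply: le_Lam => // x Qx;
    have := wfg x Qx; have := fge0 x Qx; have := gge0 x Qx; rewrite /u !ler_norml;
    (case: (lerP (f x) (w x)) => h;
    [case: (lerP (- f x) (f x))|case: (lerP (- f x) (w x))]) => h' g1 f1 /andP[w1 w2];
    apply/andP; split; lra.
rewrite -lerBrDr; apply: Lam_le => // u cu uf; rewrite lerBrDr -lerBrDl.
apply: Lam_le => // v cv vg; rewrite lerBrDl -lD//; apply: le_Lam => //.
  exact: withinD.
by move=> x Qx; rewrite (le_trans (ler_normD _ _))// lerD ?uf ?vg.
Qed.

Let Lam0 : Lam (fun=> 0) = 0.
Proof.
have H : nonneg_cont Q (fun=> 0 : R) by exact: nonneg_cst.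
by have := LamD H H; rewrite addr0 -{1}[Lam _]addr0 => /addrI.
Qed.

Let LamZ (c : R) (f : T -> R) : 0 <= c -> nonneg_cont Q f -> Lam (fun x => c * f x) = c * Lam f.
Proof.
rewrite le_eqVlt => /predU1P[<- _|c0 f0].
  by rewrite mul0r -[RHS]Lam0; congr Lam; apply/funext => x; rewrite mul0r.
have le a g : 0 < a -> nonneg_cont Q g -> Lam (fun x => a * g x) <= a * Lam g.
  move=> a0 [cg g0]; apply: Lam_le.
    by split=> [|x Qx]; [apply: withinM => //; exact: within_cst|rewrite mulr_ge0 ?g0// ltW].
  move=> u cu ug; rewrite -ler_pdivrMl// -lZ//; apply: le_Lam => //.
    by apply: withinM => //; exact: within_cst.
  by move=> x Qx; rewrite normrM gtr0_norm ?invr_gt0// ler_pdivrMl// ug.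
apply/eqP; rewrite eq_le le//= -ler_pdivlMl//.
have cf0 : nonneg_cont Q (fun x => c * f x).
  by apply: nonnegM => //; apply: nonneg_cst; exact: ltW.
have := le c^-1 _ _ cf0; rewrite invr_gt0 => /(_ c0).
by under eq_fun do rewrite mulrA mulVf ?gt_eqF// mul1r.
Qed.

Let Lam_ge0 f : nonneg_cont Q f -> 0 <= Lam f.
Proof.
move=> f0; rewrite -l0; apply: le_Lam => //.
by move=> x Qx; rewrite normr0 f0.2.
Qed.

Let shift f g : nonneg_cont Q f -> nonneg_cont Q g -> (forall x, Q x -> f x <= g x) ->
  exists2 h, nonneg_cont Q h & g = fun x => f x + h x.
Proof.
move=> [cf _] [cg _] fg; exists (fun x => g x - f x).
  by split=> [|x Qx]; [exact: withinB|rewrite subr_ge0 fg].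
by apply/funext => x; rewrite addrC subrK.
Qed.

Let Lam_pos : positive_functional Q Lam.
Proof.
split => // f g f0 g0 fg; have [h h0 ->] := shift f0 g0 fg.
by rewrite LamD// lerDl Lam_ge0.
Qed.

(** For h >= 0 the competitor - h in the supremum gives - l h <= Lam h, which is the positivity of l
    + Lam. *)
Let lLam_pos : positive_functional Q (fun f => l f + Lam f).
Proof.
split.
- by move=> f g f0 g0; rewrite LamD// (lD f0.1 g0.1) addrACA.
- by move=> c f c0 f0; rewrite LamZ// (lZ _ f0.1) mulrDr.
- move=> f g f0 g0 fg; have [h h0 ->] := shift f0 g0 fg.
  rewrite LamD// (lD f0.1 h0.1) addrACA lerDl.
  have := @le_Lam h (fun x => - h x) h0 (withinN h0.1).
  have -> : l (fun x => - h x) = - l h.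
    by rewrite -mulN1r -(lZ _ h0.1); congr l; apply/funext => x; rewrite mulN1r.
  rewrite addrC -lerBlDr sub0r; apply => x Qx.
  by rewrite normrN ger0_norm// h0.2.
Qed.

(* [Lam] is the total variation of [l], so that [l + Lam] and [Lam] are positive. *)
Theorem signed_riesz : exists m1 m2 : {finite_measure set (borel T) -> \bar R},
  [/\ concentrated m1 (Q : set (borel T)), concentrated m2 (Q : set (borel T)) &
      forall f : T -> R, {within Q, continuous f} ->
        l f = \int[m1]_(x in Q) f x - \int[m2]_(x in Q) f x].
Proof.
exists (riesz_measure lLam_pos), (riesz_measure Lam_pos); split.
- exact: riesz_measure_concentrated.
- exact: riesz_measure_concentrated.
have pos f : nonneg_cont Q f -> l f =
    \int[riesz_measure lLam_pos]_(x in Q) f x - \int[riesz_measure Lam_pos]_(x in Q) f x.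
  by move=> f0; rewrite !riesz_integral// addrK.
move=> f cf; have [B B0 fB] := within_bounded cQ cf.
(* Both f + B and the constant B are nonnegative on [Q], and f is their difference. *)
have f0 : nonneg_cont Q (fun x => f x + B).
  split=> [|x Qx]; first by apply: withinD => //; exact: within_cst.
  by have := fB x Qx; rewrite ler_norml => /andP[? _]; rewrite -lerBlDr sub0r.
have B0' := nonneg_cst Q B0.
have mQ := compact_borel cQ.
have bm (m : {finite_measure set (borel T) -> \bar R}) (g : T -> R) : {within Q, continuous g} ->
    m.-integrable Q (EFin \o (g : borel T -> R)).
  by move=> cg; apply: bmf_integrable => //; exact: within_bmf.
have := pos _ f0; have := pos _ B0'.
rewrite lD//; last exact: within_cst.
by rewrite !RintegralD//; try (exact: bm); try (apply: bm; exact: within_cst); lra.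
Qed.

End SignedRiesz.

(** * Integrals against charges and their densities *)

Section ChargeIntegral.
Context {R : realType} {d : measure_display} {T : measurableType d}.
Implicit Types (nu : {charge set T -> \bar R}) (D : set T) (f : T -> R).

(** If nu = p - q is the Jordan decomposition and also nu = m1 - m2, the measures p + m2 and m1 + q
    coincide; integrating f against both shows that any representation as a difference gives the
    same integral. *)
Lemma cintegral_diff nu (m1 m2 : {finite_measure set T -> \bar R}) D f :
  (forall A, measurable A -> nu A = m1 A - m2 A)%E ->
  measurable D -> bounded_mfun D f ->
  cintegral nu D f = \int[m1]_(x in D) f x - \int[m2]_(x in D) f x.
Proof.
move=> nuE mD bf; rewrite /cintegral; case: (cid _) => P exN; case: (cid exN) => N PN.
have : (\int[measure_add (jordan_pos PN) m2]_(x in D) (f x)%:E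
      = \int[measure_add m1 (jordan_neg PN)]_(x in D) (f x)%:E)%E.
  apply: eq_measure_integral => A mA _.
  transitivity (jordan_pos PN A + m2 A)%E; first exact: measure_addE.
  transitivity (m1 A + jordan_neg PN A)%E; last exact/esym/measure_addE.
  have : (nu A = jordan_pos PN A - jordan_neg PN A)%E.
    by rewrite (jordan_decomp PN mA) /cadd/= cscaleN1.
  rewrite nuE// => e.
  have Ff (m : {finite_measure set T -> \bar R}) : exists r : R, m A = r%:E.
    by exists (fine (m A)); rewrite fineK// fin_num_measure.
  have [a aE] := Ff m1; have [b bE] := Ff m2.
  have [a' a'E] := Ff (jordan_pos PN); have [b' b'E] := Ff (jordan_neg PN).
  move: e; rewrite aE bE a'E b'E -!EFinB => -[e]; rewrite -!EFinD; congr _%:E; lra.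
rewrite !integral_measure_add//; try exact: (bmf_integrable _ mD bf).
by rewrite !integral_EFin_bmf// -!EFinD => -[]; lra.
Qed.

Lemma rn_integrable nu (lam : {finite_measure set T -> \bar R}) D f :
  nu `<< lam -> measurable D -> bounded_mfun D f ->
  lam.-integrable D (fun x => (f x * fine (Radon_Nikodym nu lam x))%:E).
Proof.
move=> nulam mD [mf [M fM]].
apply: (eq_integrable mD (fun x => (f x)%:E * Radon_Nikodym nu lam x)%E).
  by move=> x _; rewrite EFinM fineK// Radon_Nikodym_fin_num.
apply: integrableMr => //.
  exists M; split; first exact: num_real.
  by move=> N MN x Dx; apply: le_trans (fM x Dx) _; exact: ltW.
by apply: (integrableS measurableT) => //; exact: Radon_Nikodym_integrable.
Qed.

(** The density of nu is almost everywhere the difference of the densities of its Jordan parts,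
    since both have the same integral over every measurable subset of [D]; the change of variables
    is then made for each part. *)
Lemma cintegral_density nu (lam : {finite_measure set T -> \bar R}) D f :
  nu `<< lam -> measurable D -> bounded_mfun D f ->
  cintegral nu D f = \int[lam]_(x in D) (f x * fine (Radon_Nikodym nu lam x)).
Proof.
move=> nulam mD bf; rewrite /cintegral; case: (cid _) => P exN; case: (cid exN) => N PN.
set jp := jordan_pos PN; set jn := jordan_neg PN.
have jpl : jp `<< lam := jordan_pos_dominates PN nulam.
have jnl : jn `<< lam := jordan_neg_dominates PN nulam.
pose rp := Radon_Nikodym (charge_of_finite_measure jp) lam.
pose rn := Radon_Nikodym (charge_of_finite_measure jn) lam.
have ae : ae_eq lam D (Radon_Nikodym nu lam) (rp \- rn)%E.
  apply: integral_ae_eq => //.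
  - by apply: (integrableS measurableT) => //; exact: Radon_Nikodym_integrable.
  - by apply: measurable_funTS; apply: emeasurable_funB;
      apply: measurable_int; exact: Radon_Nikodym_integrable.
  - move=> A AD mA; rewrite integralB//;
      [|exact: (integrableS measurableT _ _ (Radon_Nikodym_integrable _))..].
    rewrite -!Radon_Nikodym_integral//.
    by rewrite (jordan_decomp PN mA) /cadd/= cscaleN1.
have If (c : {charge set T -> \bar R}) : c `<< lam ->
    lam.-integrable D (fun x => (f x)%:E * Radon_Nikodym c lam x)%E.
  move=> cl; apply: eq_integrable (rn_integrable cl mD bf) => // x _.
  by rewrite EFinM fineK// Radon_Nikodym_fin_num.
suff : (\int[lam]_(x in D) ((f x)%:E * Radon_Nikodym nu lam x)
    = \int[jp]_(x in D) (f x)%:E - \int[jn]_(x in D) (f x)%:E)%E.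
  rewrite !integral_EFin_bmf// -EFinB => e.
  rewrite [RHS]/Rintegral; under [in RHS]eq_integral => x _.
    rewrite EFinM fineK ?Radon_Nikodym_fin_num//; over.
  by rewrite e.
have bi (m : {finite_measure set T -> \bar R}) : m.-integrable D (EFin \o f).
  exact: bmf_integrable.
rewrite -(Radon_Nikodym_change_of_variables jpl mD (bi jp)).
rewrite -(Radon_Nikodym_change_of_variables jnl mD (bi jn)).
rewrite -integralB//; [|exact: If..].
apply: ae_eq_integral => //.
- by apply: measurable_int; exact: If.
- by apply: measurable_int; apply: integrableB => //; exact: If.
apply: filterS ae => x + Dx => /(_ Dx) ->.
rewrite muleBr// fin_num_adde_defr// Radon_Nikodym_fin_num//.
Qed.

End ChargeIntegral.

(** * The integrand and its conjugate *)

Section Trace.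
Context {R : realType}.

Lemma dotmE m p (A B : 'M[R]_(m, p)) : dotm A B = \sum_i \sum_j A i j * B i j.
Proof.
rewrite /dotm /mxtrace exchange_big/=; apply: eq_bigr => j _.
by rewrite mxE; apply: eq_bigr => i _; rewrite mxE.
Qed.

Lemma dotmC m p (A B : 'M[R]_(m, p)) : dotm A B = dotm B A.
Proof. by rewrite !dotmE; apply: eq_bigr => i _; apply: eq_bigr => j _; rewrite mulrC. Qed.

Lemma dotmDr m p (A B C : 'M[R]_(m, p)) : dotm A (B + C) = dotm A B + dotm A C.
Proof. by rewrite /dotm mulmxDr linearD. Qed.

Lemma dotmZr m p a (A B : 'M[R]_(m, p)) : dotm A (a *: B) = a * dotm A B.
Proof. by rewrite /dotm -scalemxAr linearZ. Qed.

Lemma dotmNr m p (A B : 'M[R]_(m, p)) : dotm A (- B) = - dotm A B.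
Proof. by rewrite /dotm mulmxN linearN. Qed.

Lemma dotmBr m p (A B C : 'M[R]_(m, p)) : dotm A (B - C) = dotm A B - dotm A C.
Proof. by rewrite dotmDr dotmNr. Qed.

Lemma dotmDl m p (A B C : 'M[R]_(m, p)) : dotm (A + B) C = dotm A C + dotm B C.
Proof. by rewrite ![dotm _ C]dotmC dotmDr. Qed.

Lemma dotmZl m p a (A B : 'M[R]_(m, p)) : dotm (a *: A) B = a * dotm A B.
Proof. by rewrite dotmC dotmZr dotmC. Qed.

Lemma dotmNl m p (A B : 'M[R]_(m, p)) : dotm (- A) B = - dotm A B.
Proof. by rewrite ![dotm _ B]dotmC dotmNr. Qed.

Lemma dotmBl m p (A B C : 'M[R]_(m, p)) : dotm (A - B) C = dotm A C - dotm B C.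
Proof. by rewrite dotmDl dotmNl. Qed.

Lemma dotm0r m p (A : 'M[R]_(m, p)) : dotm A 0 = 0.
Proof. by rewrite /dotm mulmx0 linear0. Qed.

Lemma dotm_sumr m p (I : Type) (s : seq I) (A : 'M[R]_(m, p)) F :
  dotm A (\sum_(i <- s) F i) = \sum_(i <- s) dotm A (F i).
Proof. by rewrite /dotm mulmx_sumr linear_sum. Qed.

Lemma dotm_mulmxl m p q (X : 'M[R]_(m, p)) (A : 'M[R]_(p, q)) (B : 'M[R]_(m, q)) :
  dotm (X *m A) B = dotm A (X^T *m B).
Proof. by rewrite /dotm trmx_mul mulmxA. Qed.

Lemma dotm_mulmxr m p q (X : 'M[R]_(m, p)) (A : 'M[R]_(p, q)) (B : 'M[R]_(m, q)) :
  dotm (X *m A) B = dotm X (B *m A^T).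
Proof. by rewrite /dotm trmx_mul -mulmxA mxtrace_mulC mulmxA. Qed.

Lemma dotm_eq0 m p (A : 'M[R]_(m, p)) : dotm A A = 0 -> A = 0.
Proof.
rewrite dotmE => /eqP; rewrite psumr_eq0 => [/allP H|i _]; last first.
  by apply: sumr_ge0 => j _; rewrite -expr2 sqr_ge0.
apply/matrixP => i j; have := H i; rewrite mem_index_enum => /(_ isT).
rewrite psumr_eq0 => [/allP/(_ j)|j' _]; last by rewrite -expr2 sqr_ge0.
by rewrite mem_index_enum -expr2 sqrf_eq0 mxE => /(_ isT) /eqP.
Qed.

Lemma dotm_ge0 m p (A : 'M[R]_(m, p)) : 0 <= dotm A A.
Proof.
by rewrite dotmE; apply: sumr_ge0 => i _; apply: sumr_ge0 => j _; rewrite -expr2 sqr_ge0.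
Qed.

Lemma mx11_dotm n (v : 'cV[R]_n) (w : 'cV[R]_n) : (v^T *m w) 0 0 = dotm v w.
Proof. by rewrite /dotm /mxtrace big_ord1. Qed.

Lemma quad_dotm n (A : 'M[R]_n) (v : 'cV[R]_n) : (v^T *m A *m v) 0 0 = dotm A (v *m v^T).
Proof. by rewrite -mulmxA mx11_dotm dotmC -dotm_mulmxr. Qed.

Lemma dotm_tr m p (A B : 'M[R]_(m, p)) : dotm A^T B^T = dotm A B.
Proof.
rewrite !dotmE exchange_big/=; apply: eq_bigr => i _; apply: eq_bigr => j _.
by rewrite !mxE.
Qed.

End Trace.

Section Psd.
Context {R : realType} {n : nat}.
Implicit Types (A B X : 'M[R]_n) (v w x : 'cV[R]_n).

Lemma psd_mulTr m (P : 'M[R]_(n, m)) : psd (P *m P^T).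
Proof.
split; first by rewrite trmx_mul trmxK.
move=> x; have -> : x^T *m (P *m P^T) *m x = (P^T *m x)^T *m (P^T *m x).
  by rewrite trmx_mul trmxK !mulmxA.
by rewrite mx11_dotm dotm_ge0.
Qed.

Lemma psd_ge0 A v : psd A -> 0 <= dotm A (v *m v^T).
Proof. by move=> [_ /(_ v)]; rewrite quad_dotm. Qed.

Lemma sym_dotm_mulmx A v w : A^T = A -> dotm v (A *m w) = dotm w (A *m v).
Proof. by move=> As; rewrite dotmC dotm_mulmxl As. Qed.

(* Cauchy-Schwarz for the form of A: both sides of the discriminant come from
   evaluating A at [v + t w]. *)
Lemma psd_cauchy A v w : psd A ->
  dotm v (A *m w) ^+ 2 <= dotm v (A *m v) * dotm w (A *m w).
Proof.
move=> [As Ap]; have q t : 0 <= dotm v (A *m v) + 2 * t * dotm v (A *m w)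
    + t ^+ 2 * dotm w (A *m w).
  have := Ap (v + t *: w); rewrite -mulmxA mx11_dotm.
  rewrite mulmxDr -scalemxAr dotmDl !dotmDr !dotmZr.
  rewrite -[dotm (t *: w) (A *m v)]dotmC dotmZr -[dotm (t *: w) (A *m w)]dotmC dotmZr.
  rewrite [dotm (A *m v) w]dotmC [dotm w (A *m v)]sym_dotm_mulmx//.
  by rewrite [dotm (A *m w) w]dotmC; set x := dotm v _; set y := dotm v _;
    set z := dotm w _ => h; apply: le_trans h _; rewrite le_eqVlt; apply/orP; left;
    apply/eqP; ring.
set a := dotm v _ in q *; set b := dotm v _ in q *; set c := dotm w _ in q *.
have c0 : 0 <= c by rewrite /c -mx11_dotm mulmxA.
(* If c = 0 the form is affine in t, and for b != 0 the choice t = - (a + 1) / (2 b) would give it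
   the value -1. Otherwise its minimum, at t = - b / c, yields the claim. *)
have [c_gt0|] := ltP 0 c; last first.
  move=> c_le0; have cE : c = 0 by apply/eqP; rewrite eq_le c0 c_le0.
  rewrite cE mulr0; have [->|b0] := eqVneq b 0; first by rewrite expr0n.
  have := q (- (a + 1) / (2 * b)); rewrite cE mulr0 addr0.
  have -> : 2 * (- (a + 1) / (2 * b)) * b = - (a + 1) by field.
  by lra.
have := q (- b / c).
have -> : a + 2 * (- b / c) * b + (- b / c) ^+ 2 * c = a - b ^+ 2 / c.
  by field; rewrite gt_eqF.
by rewrite subr_ge0 ler_pdivrMr.
Qed.

(** Cauchy-Schwarz for the vectors [A *m v] and [v] bounds the fourth power of the norm of [A *m v]
    by 0. *)
Lemma psd_ker A v : psd A -> dotm v (A *m v) = 0 -> A *m v = 0.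
Proof.
move=> pA v0; apply: dotm_eq0; apply/eqP.
have := psd_cauchy (A *m v) v pA; rewrite v0 mulr0.
rewrite sym_dotm_mulmx ?(pA.1)// => h.
have : dotm v (A *m (A *m v)) ^+ 2 = 0 by apply/eqP; rewrite eq_le h sqr_ge0.
by move=> /eqP; rewrite sqrf_eq0 dotmC dotm_mulmxl (pA.1).
Qed.

(** Induction on the rank, in place of a spectral decomposition. If c = v^T A v > 0, then A - c^-1
    (A v)(A v)^T is still positive semidefinite by Cauchy-Schwarz, and its kernel contains that of A
    and also v, so the rank drops. *)
Lemma psd_sum_sq A : psd A -> exists s : seq 'cV[R]_n, A = \sum_(v <- s) v *m v^T.
Proof.
have [r] := ubnP (\rank A); elim: r A => // r IH A; rewrite ltnS => rA pA.
have [v0|/existsNP[v vA]] := pselect (forall v, dotm v (A *m v) = 0).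
  exists [::]; rewrite big_nil; apply/matrixP => i j.
  have := psd_ker pA (v0 (delta_mx j 0)) => /colP /(_ i).
  by rewrite -colE !mxE.
have c0 : 0 < dotm v (A *m v).
  by rewrite lt_neqAle eq_sym; apply/andP; split;
    [apply/eqP|rewrite -mx11_dotm mulmxA; exact: pA.2].
set c := dotm v _ in c0.
pose w := A *m v; pose B := A - c^-1 *: (w *m w^T).
have BE x : dotm x (B *m x) = dotm x (A *m x) - c^-1 * dotm x w ^+ 2.
  rewrite mulmxBl dotmBr -scalemxAl dotmZr; congr (_ - _ * _).
  rewrite -mulmxA; have -> : w^T *m x = (dotm x w)%:M.
    by rewrite [LHS]mx11_scalar mx11_dotm dotmC.
  by rewrite mul_mx_scalar dotmZr expr2.
have pB : psd B.
  split; first by rewrite linearB linearZ/= trmx_mul trmxK (pA.1).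
  move=> x; rewrite -mulmxA mx11_dotm BE subr_ge0 ler_pdivrMl//.
  by have := psd_cauchy x v pA; rewrite -/w -/c mulrC.
have Bv : B *m v = 0.
  rewrite mulmxBl -scalemxAl -mulmxA; have -> : w^T *m v = c%:M.
    by rewrite [LHS]mx11_scalar mx11_dotm dotmC.
  by rewrite mul_mx_scalar scalerA mulVf ?gt_eqF// scale1r subrr.
have rB : (\rank B < r)%N.
  apply: leq_trans rA; rewrite -(mxrank_tr B) -(mxrank_tr A) (pA.1) (pB.1).
  have : (kermx A < kermx B)%MS.
    rewrite ltmxE; apply/andP; split.
      apply/sub_kermxP; rewrite mulmxBr mulmx_ker sub0r.
      rewrite -scalemxAr mulmxA.
      have -> : kermx A *m w = 0 by rewrite mulmxA mulmx_ker mul0mx.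
      by rewrite mul0mx scaler0 oppr0.
    apply/negP => kk; have : (v^T <= kermx A)%MS.
      apply: submx_trans kk; apply/sub_kermxP.
      by rewrite -[B](pB.1) -trmx_mul Bv trmx0.
    move/sub_kermxP => /(congr1 trmx); rewrite trmx_mul trmxK (pA.1) trmx0 => Av.
    by move: c0; rewrite /c Av dotm0r ltxx.
  move=> /rank_ltmx; rewrite !mxrank_ker => /[dup] rr.
  have := leq_subr (\rank A) n; have := rank_leq_row A; lia.
have [s Bs] := IH B rB pB; exists ((Num.sqrt c)^-1 *: w :: s).
rewrite big_cons -Bs linearZ/= -scalemxAl -scalemxAr scalerA -expr2 exprVn sqr_sqrtr ?ltW//.
by rewrite addrC subrK.
Qed.

Lemma psd_dotm_ge0 m A (P : 'M[R]_(n, m)) : psd A -> 0 <= dotm P (A *m P).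
Proof.
move=> /psd_sum_sq[s ->]; rewrite mulmx_suml dotm_sumr; apply: sumr_ge0 => v _.
by rewrite -mulmxA dotmC dotm_mulmxl dotm_ge0.
Qed.

Lemma psd_dotm_eq0 m A (P : 'M[R]_(n, m)) : psd A -> dotm P (A *m P) = 0 -> A *m P = 0.
Proof.
move=> pA; have [s As] := psd_sum_sq pA.
rewrite As mulmx_suml dotm_sumr => /eqP; rewrite psumr_eq0 => [/allP h|v _]; last first.
  by rewrite -mulmxA dotmC dotm_mulmxl dotm_ge0.
rewrite big_seq; apply: big1 => v /h /=.
by rewrite -mulmxA dotmC dotm_mulmxl => /eqP/dotm_eq0 ->; rewrite mulmx0.
Qed.

Lemma psd_dotm2_ge0 A B : psd A -> psd B -> 0 <= dotm A B.
Proof.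
move=> pA /psd_sum_sq[s ->]; rewrite dotm_sumr; apply: sumr_ge0 => v _.
exact: psd_ge0.
Qed.

Lemma pd_unit A : pd A -> A \in unitmx.
Proof.
move=> [As Ap]; rewrite -row_free_unit; apply/inj_row_free => v vA.
apply/eqP/contraT => v0; have vT0 : v^T != 0.
  by apply: contra v0 => /eqP/(congr1 trmx); rewrite trmxK trmx0 => ->.
by have := Ap _ vT0; rewrite trmxK vA mul0mx mxE ltxx.
Qed.

End Psd.

Section Fenchel.
Context {R : realType} {n k : nat}.
Implicit Types (X A : 'M[R]_n).

(* Completion of the square: [W] stands for [Y *m L^dagger] and [Xd] for the
   pseudoinverse of [X]. *)
Lemma fenchel_square q X Xd (W Bm : 'M[R]_(n, q)) (L : 'M[R]_q) :
  X^T = X -> L^T = L -> X *m Xd *m W = W ->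
  2^-1 * dotm W (Xd *m W) - dotm Bm (W *m L)
    + 2^-1 * dotm X (Bm *m (L *m L) *m Bm^T)
  = 2^-1 * dotm (Xd *m W - Bm *m L) (X *m (Xd *m W - Bm *m L)).
Proof.
move=> Xs Ls XW; rewrite mulmxBr (mulmxA X Xd W) XW dotmBl !dotmBr.
have -> : dotm (Bm *m L) W = dotm Bm (W *m L) by rewrite dotm_mulmxr Ls.
have -> : dotm (Xd *m W) (X *m (Bm *m L)) = dotm Bm (W *m L).
  rewrite dotmC dotm_mulmxl Xs (mulmxA X Xd W) XW.
  by rewrite dotm_mulmxr Ls.
have -> : dotm (Bm *m L) (X *m (Bm *m L)) = dotm X (Bm *m (L *m L) *m Bm^T).
  by rewrite dotmC dotm_mulmxr trmx_mul Ls !mulmxA.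
rewrite [dotm (Xd *m W) W]dotmC; set a := dotm _ _; set b := dotm _ _; set c := dotm _ _.
by field.
Qed.

Section Conjugate.
Variables (L1 : 'M[R]_k) (L2 : 'M[R]_n).
Hypotheses (L1_psd : psd L1) (L2_pd : pd L2).

Definition Nmx (B : 'M[R]_(n, k)) (C : 'M[R]_n) : 'M[R]_n :=
  2^-1 *: (B *m (L1 *m L1) *m B^T) + 2^-1 *: (C *m (L2 *m L2) *m C^T).

Definition Jpair (X : 'M[R]_n) (Y : 'M[R]_(n, k)) (Z : 'M[R]_n)
    (u : 'M[R]_n * 'M[R]_(n, k) * 'M[R]_n) : R :=
  dotm X u.1.1 + dotm Y u.1.2 + dotm Z u.2.

Definition Jdom (X : 'M[R]_n) (Y : 'M[R]_(n, k)) (Z : 'M[R]_n) : Prop :=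
  [/\ psd X, ran_sub Y^T L1 & ran_sub (row_mx Y Z) X].

Let L1s : L1^T = L1 := L1_psd.1.
Let L2s : L2^T = L2 := L2_pd.1.

Let mpinv1 : L1 *m mpinv L1 *m L1 = L1.
Proof. by have [] := mpinvP L1. Qed.

Let mpinv2 : L1 *m L1 *m mpinv L1 = L1.
Proof.
have [E _ F _] := mpinvP L1.
by rewrite -mulmxA -[LHS]trmxK trmx_mul F L1s E L1s.
Qed.

Lemma ran_subP (Y : 'M[R]_(n, k)) : ran_sub Y^T L1 <-> Y *m mpinv L1 *m L1 = Y.
Proof.
rewrite /ran_sub trmxK L1s; split=> [/submxP[E ->]|<-]; last exact: submxMl.
by rewrite -!mulmxA (mulmxA L1) mpinv1.
Qed.

Lemma ran_sub_row X (Y : 'M[R]_(n, k)) (Z : 'M[R]_n) :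
  ran_sub (row_mx Y Z) X <->
  X *m mpinv X *m Y = Y /\ X *m mpinv X *m Z = Z.
Proof.
have E : X *m mpinv X *m X = X by have [] := mpinvP X.
rewrite /ran_sub; split=> [/submxP[D /(congr1 trmx)]|[<- <-]]; last first.
  by rewrite -!mulmxA -mul_mx_row trmx_mul submxMl.
rewrite trmxK trmx_mul trmxK => DE.
have : X *m mpinv X *m row_mx Y Z = row_mx Y Z by rewrite DE mulmxA E.
by rewrite mul_mx_row => /eq_row_mx.
Qed.

Lemma J_fin X (Y : 'M[R]_(n, k)) Z : Jdom X Y Z -> J L1 L2 X Y Z =
  (2^-1 * dotm (Y *m mpinv L1) (mpinv X *m Y *m mpinv L1)
   + 2^-1 * dotm (Z *m invmx L2) (mpinv X *m Z *m invmx L2))%:E.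
Proof. by move=> H; rewrite /J asboolT. Qed.

(** The exact Fenchel gap: [J] exceeds the pairing with [u] by three terms, each nonnegative when
    [u] satisfies the constraint. The inequality, its equality case and the attainment of the
    supremum are all read off it. *)
Lemma J_gap X (Y : 'M[R]_(n, k)) Z (u : 'M[R]_n * 'M[R]_(n, k) * 'M[R]_n) :
  Jdom X Y Z -> exists P1 P2,
  [/\ P1 = mpinv X *m (Y *m mpinv L1) - u.1.2 *m L1,
      P2 = mpinv X *m (Z *m invmx L2) - u.2 *m L2 &
  J L1 L2 X Y Z = (Jpair X Y Z u + dotm X (- (u.1.1 + Nmx u.1.2 u.2))
    + 2^-1 * dotm P1 (X *m P1) + 2^-1 * dotm P2 (X *m P2))%:E].
Proof.
move=> H; rewrite J_fin//; have [pX /ran_subP YL /ran_sub_row[XY XZ]] := H.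
exists (mpinv X *m (Y *m mpinv L1) - u.1.2 *m L1),
  (mpinv X *m (Z *m invmx L2) - u.2 *m L2); split => //.
have ZL : Z *m invmx L2 *m L2 = Z by rewrite mulmxKV// pd_unit.
rewrite -(fenchel_square _ pX.1 L1s); last by rewrite mulmxA XY.
rewrite -(fenchel_square _ pX.1 L2s); last by rewrite mulmxA XZ.
rewrite YL ZL /Jpair dotmNr /Nmx !dotmDr !dotmZr !mulmxA.
by rewrite [dotm u.1.2 Y]dotmC [dotm u.2 Z]dotmC; congr _%:E; ring.
Qed.

Lemma O_setE u : O_set L1 L2 u <-> psd (- (u.1.1 + Nmx u.1.2 u.2)).
Proof. by rewrite /O_set /= /loewner_le /Nmx sub0r addrA. Qed.

Lemma fenchel_ineq X (Y : 'M[R]_(n, k)) Z u : O_set L1 L2 u ->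
  ((Jpair X Y Z u)%:E <= J L1 L2 X Y Z)%E.
Proof.
move=> /O_setE Ou; have [H|nH] := pselect (Jdom X Y Z); last first.
  by rewrite /J asboolF// leey.
have [P1 [P2 [_ _ ->]]] := J_gap u H; have pX : psd X by case: H.
have h0 := psd_dotm2_ge0 pX Ou; have h1 := psd_dotm_ge0 P1 pX.
have h2 := psd_dotm_ge0 P2 pX; rewrite lee_fin; lra.
Qed.

Definition optimal_at X (Y : 'M[R]_(n, k)) Z (u : 'M[R]_n * 'M[R]_(n, k) * 'M[R]_n) :=
  [/\ psd X, Y = X *m u.1.2 *m (L1 *m L1), Z = X *m u.2 *m (L2 *m L2) &
      dotm X (u.1.1 + Nmx u.1.2 u.2) = 0].

(** All three terms of the gap vanish. From X P1 = 0 one gets Y L1^dagger = X B L1, and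
    multiplication by [L1] on the right restores Y by the range condition; likewise for Z. *)
Lemma fenchel_eq X (Y : 'M[R]_(n, k)) Z u : O_set L1 L2 u ->
  J L1 L2 X Y Z = (Jpair X Y Z u)%:E -> optimal_at X Y Z u.
Proof.
move=> /O_setE Ou; have [H|nH] := pselect (Jdom X Y Z); last by rewrite /J asboolF.
have [P1 [P2 [P1E P2E ->]]] := J_gap u H.
have [pX /ran_subP YL /ran_sub_row[XY XZ]] := H.
have ZL : Z *m invmx L2 *m L2 = Z by rewrite mulmxKV// pd_unit.
have h0 := psd_dotm2_ge0 pX Ou; have h1 := psd_dotm_ge0 P1 pX.
have h2 := psd_dotm_ge0 P2 pX => -[e].
have d0 : dotm X (- (u.1.1 + Nmx u.1.2 u.2)) = 0 by lra.
have d1 : dotm P1 (X *m P1) = 0 by lra.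
have d2 : dotm P2 (X *m P2) = 0 by lra.
have := psd_dotm_eq0 pX d1; rewrite P1E mulmxBr !mulmxA XY => /eqP.
rewrite subr_eq0 => /eqP e1.
have := psd_dotm_eq0 pX d2; rewrite P2E mulmxBr !mulmxA XZ => /eqP.
rewrite subr_eq0 => /eqP e2.
split => //; last by apply/eqP; rewrite -oppr_eq0 -dotmNr d0.
  by rewrite -{1}YL e1 !mulmxA.
by rewrite -{1}ZL e2 !mulmxA.
Qed.

(** The formulas for Y and Z imply the range conditions, and X P1 = X P2 = 0 makes both squares of
    the gap vanish. *)
Lemma optimal_J X (Y : 'M[R]_(n, k)) Z u : optimal_at X Y Z u ->
  J L1 L2 X Y Z = (Jpair X Y Z u)%:E.
Proof.
move=> [pX YE ZE d0].
have E : X *m mpinv X *m X = X by have [] := mpinvP X.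
have H : Jdom X Y Z.
  split => //.
    by apply/ran_subP; rewrite YE -!mulmxA (mulmxA L1 (mpinv L1)) mpinv1.
  by apply/ran_sub_row; rewrite YE ZE !mulmxA E.
have [P1 [P2 [P1E P2E ->]]] := J_gap u H.
have e1 : X *m P1 = 0.
  rewrite P1E mulmxBr YE -!mulmxA (mulmxA L1) mpinv2.
  by rewrite (mulmxA (mpinv X)) (mulmxA X) (mulmxA X) E subrr.
have e2 : X *m P2 = 0.
  rewrite P2E mulmxBr ZE -!mulmxA mulmxV ?pd_unit// mulmx1.
  by rewrite (mulmxA (mpinv X)) (mulmxA X) (mulmxA X) E subrr.
by rewrite e1 e2 !dotm0r !mulr0 !addr0 dotmNr d0 oppr0 addr0.
Qed.

(** Points of the constraint set with a rank-one slack, which are enough to reach the supremum. *)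
Definition O_point (v : 'cV[R]_n) (B : 'M[R]_(n, k)) (C : 'M[R]_n) :=
  (- Nmx B C - v *m v^T, B, C).

Lemma Nmx00 : Nmx 0 0 = 0.
Proof. by rewrite /Nmx !mul0mx !scaler0 addr0. Qed.

(* Off its domain J is reached along one-parameter families: [v v^T] detects that
   [X] is not positive, and vectors of the cokernels of [L1] and [X] detect the two
   range conditions.  On its domain the supremum is attained. *)
Lemma J_sup X (Y : 'M[R]_(n, k)) Z (r : R) : X^T = X -> (r%:E < J L1 L2 X Y Z)%E ->
  exists v B C, r < Jpair X Y Z (O_point v B C).
Proof.
move=> Xs rJ.
have big (a b : R) : 0 < b -> exists s, r < a + s * b.
  move=> b0; exists ((r - a + 1) / b); rewrite mulfVK ?gt_eqF//; lra.
have [pX|] := pselect (psd X); last first.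
  move=> /not_andP[|/existsNP[v /negP]]; first by [].
  rewrite -ltNge quad_dotm => vX; pose b := - dotm X (v *m v^T).
  (* The multiplier acts through sqrt s, so s <= 0 is treated apart: then r < s b <= 0, and 0 is the
     value at the zero triple. *)
  have [s rs] := big 0 b ltac:(by rewrite oppr_gt0).
  have [s0|s0] := leP s 0.
    exists 0, 0, 0; rewrite /Jpair/= Nmx00 mul0mx oppr0 addr0.
    rewrite !dotm0r !addr0 (lt_le_trans rs)// add0r.
    by rewrite mulr_le0_ge0// ltW// oppr_gt0.
  exists (Num.sqrt s *: v), 0, 0; rewrite /Jpair/= Nmx00 oppr0 sub0r.
  rewrite !dotm0r !addr0 linearZ/= -scalemxAl -scalemxAr scalerA -expr2 sqr_sqrtr ?ltW//.
  by rewrite dotmNr dotmZr -mulrN -[ltRHS]add0r.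
have [rY|] := pselect (ran_sub Y^T L1); last first.
  rewrite /ran_sub trmxK L1s submxE => /negP/matrix0Pn[i [j ij]].
  (* Here Y w != 0 and L1 w = 0, so multiples of Y w w^T raise the pairing without any quadratic
     cost. *)
  pose w : 'cV_k := cokermx L1 *m delta_mx j 0.
  have Lw : w^T *m L1 = 0.
    have -> : w^T *m L1 = (L1 *m w)^T by rewrite [RHS]trmx_mul L1s.
    by rewrite /w mulmxA mulmx_coker mul0mx trmx0.
  pose b := dotm (Y *m w) (Y *m w).
  have b0 : 0 < b.
    rewrite lt_neqAle dotm_ge0 andbT eq_sym; apply/eqP => /dotm_eq0 /colP /(_ i).
    by rewrite /w mulmxA -colE [in LHS]mxE [in RHS]mxE => e; rewrite e eqxx in ij.
  have [s rs] := big 0 b b0.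
  have BL : (s *: (Y *m w *m w^T)) *m (L1 *m L1) = 0.
    by rewrite -scalemxAl mulmxA -(mulmxA (Y *m w)) Lw mulmx0 mul0mx scaler0.
  exists 0, (s *: (Y *m w *m w^T)), 0; rewrite /Jpair/= /Nmx BL !mul0mx !scaler0.
  rewrite !addr0 oppr0 addr0 !dotm0r add0r addr0 dotmZr.
  by rewrite dotmC dotm_mulmxr trmxK -[ltRHS]add0r.
have [rX|] := pselect (ran_sub (row_mx Y Z) X); last first.
  rewrite /ran_sub Xs submxE => /negP/matrix0Pn[i [j ij]].
  pose w : 'cV_n := cokermx X *m delta_mx j 0.
  have Xw : X *m w = 0 by rewrite /w mulmxA mulmx_coker mul0mx.
  have wYZ : w^T *m row_mx Y Z != 0.
    apply: contra ij => /eqP /(congr1 trmx); rewrite trmx_mul trmxK trmx0 /w mulmxA -colE.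
    by move/colP/(_ i); rewrite [in LHS]mxE [in RHS]mxE => ->.
  pose b := dotm (w^T *m Y) (w^T *m Y) + dotm (w^T *m Z) (w^T *m Z).
  have b0 : 0 < b.
    rewrite lt_neqAle addr_ge0 ?dotm_ge0// andbT eq_sym; apply/eqP => e.
    have h1 := dotm_ge0 (w^T *m Y); have h2 := dotm_ge0 (w^T *m Z).
    have /dotm_eq0 y0 : dotm (w^T *m Y) (w^T *m Y) = 0 by rewrite /b in e; lra.
    have /dotm_eq0 z0 : dotm (w^T *m Z) (w^T *m Z) = 0 by rewrite /b in e; lra.
    by move: wYZ; rewrite mul_mx_row y0 z0 row_mx0 eqxx.
  have [s rs] := big 0 b b0.
  exists 0, (s *: (w *m (w^T *m Y))), (s *: (w *m (w^T *m Z))); rewrite /Jpair/=.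
  (* The quadratic cost need not vanish here, but its terms start with w, and X w = 0 hides them
     from X. *)
  have wN : dotm X (Nmx (s *: (w *m (w^T *m Y))) (s *: (w *m (w^T *m Z)))) = 0.
    have wX m (D : 'M[R]_(1, m)) E : dotm X (w *m D *m E) = 0.
      have wX0 : w^T *m X = 0 by rewrite -[w^T *m X]trmxK [in X in X^T]trmx_mul trmxK Xs Xw trmx0.
      by rewrite -mulmxA dotmC dotm_mulmxl wX0 dotm0r.
    rewrite /Nmx dotmDr !dotmZr -!scalemxAl !dotmZr.
    by rewrite -(mulmxA w) wX -(mulmxA w) wX !mulr0 addr0.
  rewrite mul0mx subr0 dotmNr wN oppr0 add0r !dotmZr.
  have E m (D : 'M[R]_(n, m)) : dotm D (w *m (w^T *m D)) = dotm (w^T *m D) (w^T *m D).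
    by rewrite [RHS]dotm_mulmxl trmxK.
  by rewrite !E -mulrDr -[ltRHS]add0r.
have H : Jdom X Y Z by [].
(* The stationary point: B L1 = X^dagger Y L1^dagger and C L2 = X^dagger Z L2^-1, so that both
   squares of [J_gap] vanish. *)
pose B := mpinv X *m (Y *m mpinv L1) *m (mpinv L1)^T.
pose C := mpinv X *m (Z *m invmx L2) *m invmx L2.
exists 0, B, C; move: rJ; have [P1 [P2 [P1E P2E ->]]] := J_gap (O_point 0 B C) H.
move/ran_subP : rY => YL.
have e1 : P1 = 0.
  have [_ E2 E3 _] := mpinvP L1.
  have key : (mpinv L1)^T *m L1 = L1 *m mpinv L1 by rewrite -[X in _ *m X]L1s -trmx_mul E3.
  rewrite P1E /= /B -(mulmxA _ _ L1) key.
  by rewrite -!mulmxA (mulmxA (mpinv L1)) E2 subrr.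
have e2 : P2 = 0.
  by rewrite P2E /= /C mulmxKV ?pd_unit// subrr.
rewrite e1 e2 !mulmx0 !dotm0r !mulr0 !addr0 /= mul0mx subr0 addNr oppr0 dotm0r addr0.
by rewrite lte_fin.
Qed.

End Conjugate.

End Fenchel.

(** * Continuity of matrix expressions and rational density *)

Section MatrixContinuity.
Context {R : realType}.

Lemma cvg_mx {T : Type} (F : set_system T) (FF : Filter F) m p
    (f : T -> 'M[R]_(m, p)) (l : 'M[R]_(m, p)) :
  (forall i j, f x i j @[x --> F] --> l i j) -> f @ F --> l.
Proof.
move=> fl; apply/cvgrPdist_lt => e e0.
have H : \forall x \near F, forall i : 'I_m, forall j : 'I_p, `|l i j - f x i j| < e.
  apply: filter_forall => i; apply: filter_forall => j.
  by have /cvgrPdist_lt := fl i j; apply.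
apply: filterS H => x H; rewrite [ltLHS]mx_normrE; apply/bigmax_ltP; split => // -[i j] _.
by rewrite !mxE /=; exact: H.
Qed.

Section Topological.
Context {T : topologicalType}.

Lemma mx_continuous m p (f : T -> 'M[R]_(m, p)) :
  (forall i j, continuous (fun x => f x i j)) -> continuous f.
Proof. by move=> cf x; apply: cvg_mx => i j; exact: cf. Qed.

Lemma entry_continuous m p (f : T -> 'M[R]_(m, p)) i j :
  continuous f -> continuous (fun x => f x i j).
Proof.
move=> cf x; apply: (@continuous_comp _ _ _ f (fun M : 'M[R]_(m, p) => M i j)).
  exact: cf.
exact: coord_continuous.
Qed.

Lemma sum_continuous {V : normedModType R} (I : Type) (s : seq I) (F : I -> T -> V) :
  (forall i, continuous (F i)) -> continuous (fun x => \sum_(i <- s) F i x).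
Proof.
move=> cF; elim: s => [|i s IH] x.
  by under eq_fun do rewrite big_nil; exact: cvg_cst.
by under eq_fun do rewrite big_cons; apply: cvgD; [exact: cF|exact: IH].
Qed.

Lemma fct_continuousD {V : normedModType R} (f g : T -> V) :
  continuous f -> continuous g -> continuous (fun x => f x + g x).
Proof. by move=> cf cg x; apply: cvgD; [exact: cf|exact: cg]. Qed.

Lemma fct_continuousB {V : normedModType R} (f g : T -> V) :
  continuous f -> continuous g -> continuous (fun x => f x - g x).
Proof. by move=> cf cg x; apply: cvgB; [exact: cf|exact: cg]. Qed.

Lemma fct_continuousN {V : normedModType R} (f : T -> V) :
  continuous f -> continuous (fun x => - f x).
Proof. by move=> cf x; apply: cvgN; exact: cf. Qed.

Lemma fct_continuousZ {V : normedModType R} (a : R) (f : T -> V) :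
  continuous f -> continuous (fun x => a *: f x).
Proof. by move=> cf x; apply: cvgZr; exact: cf. Qed.

Lemma mulmx_continuous m p q (f : T -> 'M[R]_(m, p)) (g : T -> 'M[R]_(p, q)) :
  continuous f -> continuous g -> continuous (fun x => f x *m g x).
Proof.
move=> cf cg; apply: mx_continuous => i j; under eq_fun do rewrite mxE.
by apply: sum_continuous => l x; apply: cvgM; apply: entry_continuous.
Qed.

Lemma trmx_continuous m p (f : T -> 'M[R]_(m, p)) :
  continuous f -> continuous (fun x => (f x)^T).
Proof.
move=> cf; apply: mx_continuous => i j; under eq_fun do rewrite mxE.
exact: entry_continuous.
Qed.

Lemma dotm_continuous m p (f g : T -> 'M[R]_(m, p)) :
  continuous f -> continuous g -> continuous (fun x => dotm (f x) (g x)).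
Proof.
move=> cf cg; under eq_fun do rewrite dotmE.
apply: sum_continuous => i; apply: sum_continuous => j x.
by apply: cvgM; apply: entry_continuous.
Qed.

Lemma linear_mx_continuous m p m' p' (D : {linear 'M[R]_(m, p) -> 'M[R]_(m', p')})
    (f : T -> 'M[R]_(m, p)) :
  continuous f -> continuous (fun x => D (f x)).
Proof.
move=> cf; under eq_fun do rewrite [X in D X]matrix_sum_delta !linear_sum.
apply: sum_continuous => i; under eq_fun do rewrite linear_sum.
apply: sum_continuous => j; under eq_fun do rewrite linearZ.
by move=> x; apply: cvgZ; [exact: entry_continuous|exact: cvg_cst].
Qed.

End Topological.

Lemma rat_dense_mx m p (M : 'M[R]_(m, p)) (A : set 'M[R]_(m, p)) :
  nbhs M A -> exists q : 'M[rat]_(m, p), A (map_mx ratr q).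
Proof.
move=> /nbhs_ballP[e /= e0 eA].
have /choice[q qP] (ij : 'I_m * 'I_p) : exists q : rat, `|M ij.1 ij.2 - ratr q| < e.
  have lt : M ij.1 ij.2 - e < M ij.1 ij.2 + e by lra.
  have [q qi] := rat_in_itvoo lt.
  by exists q; move: qi; rewrite in_itv/= -ltr_distlC.
exists (\matrix_(i, j) q (i, j)); apply: eA; split => // i j.
by rewrite !mxE; apply: (qP (i, j)).
Qed.

Lemma rat_dense_lt m p (f : 'M[R]_(m, p) -> R) r M : continuous f -> r < f M ->
  exists q : 'M[rat]_(m, p), r < f (map_mx ratr q).
Proof.
move=> cf rM; apply: (@rat_dense_mx _ _ M [set M | r < f M]).
by apply: (cf M [set x | r < x]); apply: open_nbhs_nbhs; split=> //; exact: open_gt.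
Qed.

End MatrixContinuity.

(** * The integrand as a countable supremum *)

Section KSet.
Context {R : realType} {n k : nat}.
Variables (L1 : 'M[R]_k) (L2 : 'M[R]_n).
Hypotheses (L1_psd : psd L1) (L2_pd : pd L2).
Local Notation N := (Nmx L1 L2).

(* The constraint set without the symmetry of its first component.  On all of
   'M_n, rather than on the symmetric matrices, this is what makes the supremum
   infinite when [X] is not symmetric, as J requires. *)
Definition K_set (u : 'M[R]_n * 'M[R]_(n, k) * 'M[R]_n) : Prop :=
  forall x : 'cV[R]_n, dotm (u.1.1 + N u.1.2 u.2) (x *m x^T) <= 0.

Lemma Nmx_sym B C : (N B C)^T = N B C.
Proof.
by rewrite /Nmx linearD !linearZ/= !trmx_mul !trmxK (L1_psd.1) (L2_pd.1) !mulmxA.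
Qed.

Lemma O_setP u : O_set L1 L2 u <-> K_set u /\ u.1.1^T = u.1.1.
Proof.
rewrite O_setE; split=> [[us up]|[Ku us]].
  split=> [x|].
    by have := up x; rewrite quad_dotm dotmNl oppr_ge0.
  by move/eqP: us; rewrite linearN eqr_opp linearD/= Nmx_sym => /eqP/addIr.
split; first by rewrite linearN linearD/= Nmx_sym us.
by move=> x; rewrite quad_dotm dotmNl oppr_ge0.
Qed.

Lemma trmx_outer (x : 'cV[R]_n) : (x *m x^T)^T = x *m x^T.
Proof. by rewrite trmx_mul trmxK. Qed.

(** The antisymmetric part W - W^T is invisible to quadratic forms, hence to the constraint, but it
    detects a non-symmetric X. *)
Definition K_point (v : 'cV[R]_n) (W : 'M[R]_n) (B : 'M[R]_(n, k)) (C : 'M[R]_n) :=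
  (- N B C - v *m v^T + (W - W^T), B, C).

Lemma K_pointP v W B C : K_set (K_point v W B C).
Proof.
move=> x; rewrite /= addrAC [- N B C - _]addrC subrK dotmDl dotmNl.
have -> : dotm (W - W^T) (x *m x^T) = 0.
  by rewrite dotmBl -[X in _ - dotm _ X]trmx_outer dotm_tr subrr.
by rewrite addr0 oppr_le0; apply: psd_ge0; exact: psd_mulTr.
Qed.

Definition symX (u : 'M[R]_n * 'M[R]_(n, k) * 'M[R]_n) : 'M[R]_n * 'M[R]_(n, k) * 'M[R]_n :=
  (2^-1 *: (u.1.1 + u.1.1^T), u.1.2, u.2).

Lemma symX_id u : u.1.1^T = u.1.1 -> symX u = u.
Proof.
move=> us; rewrite /symX us; case: u us => -[A B] C /= _; congr (_, _, _).
by apply/matrixP => i j; rewrite !mxE; field.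
Qed.

Lemma K_set_sym u : K_set u -> K_set (symX u).
Proof.
move=> Ku x; have := Ku x; rewrite /= !dotmDl; set S := x *m x^T.
have E : dotm S u.1.1^T = dotm S u.1.1 by rewrite -{1}[S]trmx_outer dotm_tr.
have -> : dotm (2^-1 *: (u.1.1 + u.1.1^T)) S = dotm u.1.1 S.
  by rewrite dotmC dotmZr dotmDr E [dotm _ S]dotmC; set a := dotm _ _; field.
by [].
Qed.

(** Where [J] is finite X is symmetric, so the pairing does not change when [u] is replaced by
    [symX u], which lies in [O_set]. *)
Lemma K_fenchel X (Y : 'M[R]_(n, k)) Z u : K_set u ->
  ((Jpair X Y Z u)%:E <= J L1 L2 X Y Z)%E.
Proof.
move=> Ku; have [H|nH] := pselect (Jdom L1 X Y Z); last by rewrite /J asboolF// leey.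
have Xs : X^T = X by case: H => -[].
have -> : Jpair X Y Z u = Jpair X Y Z (symX u).
  rewrite /Jpair /= dotmZr dotmDr -{3}Xs dotm_tr; congr (_ + _ + _); by field.
apply: fenchel_ineq => //; apply/O_setP; split; first exact: K_set_sym.
by rewrite /= linearZ linearD/= trmxK addrC.
Qed.

Lemma J_sup_K X (Y : 'M[R]_(n, k)) Z (r : R) : (r%:E < J L1 L2 X Y Z)%E ->
  exists v W B C, r < Jpair X Y Z (K_point v W B C).
Proof.
move=> rJ; have [Xs|Xs] := eqVneq X^T X.
  have [v [B [C h]]] := J_sup L1_psd L2_pd Xs rJ; exists v, 0, B, C.
  by rewrite /K_point trmx0 subr0 addr0.
pose b := dotm (X - X^T) (X - X^T).
have b0 : 0 < b.
  rewrite lt_neqAle dotm_ge0 andbT eq_sym; apply/eqP => /dotm_eq0/eqP.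
  by rewrite subr_eq0 eq_sym; exact/negP.
(* The pairing of X with X - X^T is b / 2, so this multiple has pairing |r| + 1. *)
pose s := 2 * ((`|r| + 1) / b).
exists 0, (s *: X), 0, 0; rewrite /Jpair/= Nmx00 mul0mx oppr0 !add0r !dotm0r !addr0.
rewrite linearZ/= -scalerBr dotmZr.
have -> : dotm X (X - X^T) = 2^-1 * b.
  rewrite /b dotmBl !dotmBr [dotm X^T X^T]dotm_tr [dotm X^T X]dotmC.
  by set c := dotm _ _; set d := dotm _ _; field.
rewrite /s mulrACA mulrV ?unitfE// mul1r divfK ?gt_eqF//.
by have := ler_norm r; lra.
Qed.

(** An enumeration of the [K_point]s with rational parameters; integers that encode no parameters
    give the point with all parameters 0, again in [K_set]. *)
Definition K_rat (i : nat) : 'M[R]_n * 'M[R]_(n, k) * 'M[R]_n :=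
  let: (v, W, B, C) := odflt (0, 0, 0, 0)
    (unpickle i : option ('cV[rat]_n * 'M[rat]_n * 'M[rat]_(n, k) * 'M[rat]_n)%type) in
  K_point (map_mx ratr v) (map_mx ratr W) (map_mx ratr B) (map_mx ratr C).

Lemma K_ratP i : K_set (K_rat i).
Proof. by rewrite /K_rat; case: (odflt _ _) => -[[v W] B] C; exact: K_pointP. Qed.

(** The four parameters are replaced by rational ones in turn, the strict inequality surviving
    because the pairing is continuous in each. *)
Lemma J_sup_rat X (Y : 'M[R]_(n, k)) Z (r : R) : (r%:E < J L1 L2 X Y Z)%E ->
  exists i, r < Jpair X Y Z (K_rat i).
Proof.
move=> /J_sup_K[v [W [B [C h]]]].
have cst (T : topologicalType) (V : normedModType R) (c : V) : continuous (fun _ : T => c).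
  by move=> x; exact: cvg_cst.
have ida m p : continuous (fun x : 'M[R]_(m, p) => x) by move=> x; exact: cvg_id.
have trc m p : continuous (fun x : 'M[R]_(m, p) => x^T).
  by apply: trmx_continuous; exact: ida.
have quad m p (M : 'M[R]_(p, p)) :
    continuous (fun B : 'M[R]_(m, p) => 2^-1 *: (B *m M *m B^T)).
  apply: fct_continuousZ; apply: mulmx_continuous; last exact: trc.
  by apply: mulmx_continuous; [exact: ida|exact: cst].
have [v' h1] : exists q, r < Jpair X Y Z (K_point (map_mx ratr q) W B C).
  apply: (@rat_dense_lt R _ _ (fun v => Jpair X Y Z (K_point v W B C)) _ v) => //.
  rewrite /Jpair/=; do 2![apply: fct_continuousD; try exact: cst].
  apply: dotm_continuous; try exact: cst.
  apply: fct_continuousD; try exact: cst; apply: fct_continuousB; try exact: cst.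
  by apply: mulmx_continuous; [exact: ida|exact: trc].
have [W' h2] : exists q, r < Jpair X Y Z (K_point (map_mx ratr v') (map_mx ratr q) B C).
  apply: (@rat_dense_lt R _ _ (fun W => Jpair X Y Z (K_point _ W B C)) _ W) => //.
  rewrite /Jpair/=; do 2![apply: fct_continuousD; try exact: cst].
  apply: dotm_continuous; try exact: cst.
  by apply: fct_continuousD; try exact: cst; apply: fct_continuousB; [exact: ida|exact: trc].
have [B' h3] : exists q,
    r < Jpair X Y Z (K_point (map_mx ratr v') (map_mx ratr W') (map_mx ratr q) C).
  apply: (@rat_dense_lt R _ _ (fun B => Jpair X Y Z (K_point _ _ B C)) _ B) => //.
  rewrite /Jpair/=; apply: fct_continuousD; try exact: cst.
  apply: fct_continuousD; last by apply: dotm_continuous; [exact: cst|exact: ida].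
  apply: dotm_continuous; try exact: cst.
  apply: fct_continuousD; try exact: cst; apply: fct_continuousB; try exact: cst.
  by apply: fct_continuousN; apply: fct_continuousD; try exact: cst; exact: quad.
have [C' h4] : exists q, r < Jpair X Y Z
    (K_point (map_mx ratr v') (map_mx ratr W') (map_mx ratr B') (map_mx ratr q)).
  apply: (@rat_dense_lt R _ _ (fun C => Jpair X Y Z (K_point _ _ _ C)) _ C) => //.
  rewrite /Jpair/=; apply: fct_continuousD; last by apply: dotm_continuous; [exact: cst|exact: ida].
  apply: fct_continuousD; try exact: cst.
  apply: dotm_continuous; try exact: cst.
  apply: fct_continuousD; try exact: cst; apply: fct_continuousB; try exact: cst.
  by apply: fct_continuousN; apply: fct_continuousD; try exact: cst; exact: quad.
by exists (pickle (v', W', B', C')); rewrite /K_rat pickleK.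
Qed.

End KSet.

Section KConvex.
Context {R : realType} {n k : nat}.
Implicit Types (u w : 'M[R]_n * 'M[R]_(n, k) * 'M[R]_n).

Lemma JpairD X (Y : 'M[R]_(n, k)) Z u w :
  Jpair X Y Z (u + w) = Jpair X Y Z u + Jpair X Y Z w.
Proof. by rewrite /Jpair /= !dotmDr; ring. Qed.

Lemma JpairZ X (Y : 'M[R]_(n, k)) Z a u : Jpair X Y Z (a *: u) = a * Jpair X Y Z u.
Proof. by rewrite /Jpair /= !dotmZr; ring. Qed.

Lemma Jpair_conv X (Y : 'M[R]_(n, k)) Z t u w : Jpair X Y Z (u + t *: (w - u)) =
  Jpair X Y Z u + t * (Jpair X Y Z w - Jpair X Y Z u).
Proof. by rewrite JpairD JpairZ JpairD -scaleN1r JpairZ mulN1r. Qed.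

Variables (L1 : 'M[R]_k) (L2 : 'M[R]_n).
Hypotheses (L1_psd : psd L1) (L2_pd : pd L2).

Lemma quad_form q (B : 'M[R]_(n, q)) (L : 'M[R]_q) (x : 'cV[R]_n) : L^T = L ->
  dotm (B *m (L *m L) *m B^T) (x *m x^T) = dotm (L *m B^T *m x) (L *m B^T *m x).
Proof.
move=> Ls; rewrite -quad_dotm -[RHS]mx11_dotm; congr (fun_of_matrix _ 0 0).
by rewrite !trmx_mul trmxK Ls !mulmxA.
Qed.

Lemma dotm_sq_conv m (a b : 'cV[R]_m) t : 0 <= t <= 1 ->
  dotm (a + t *: (b - a)) (a + t *: (b - a)) <= dotm a a + t * (dotm b b - dotm a a).
Proof.
move=> /andP[t0 t1]; set p := dotm a a; set r := dotm b b; pose q := dotm a b.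
have E : dotm (b - a) (b - a) = r - 2 * q + p.
  by rewrite dotmBl !dotmBr [dotm b a]dotmC -/p -/q -/r; ring.
have F : dotm a (b - a) = q - p by rewrite dotmBr.
have -> : dotm (a + t *: (b - a)) (a + t *: (b - a)) =
    p + 2 * t * (q - p) + t ^+ 2 * (r - 2 * q + p).
  have G : dotm (t *: (b - a)) a = t * (q - p) by rewrite dotmC dotmZr F.
  have H : dotm (t *: (b - a)) (t *: (b - a)) = t ^+ 2 * (r - 2 * q + p).
    by rewrite dotmZr dotmC dotmZr E; ring.
  by rewrite dotmDl !dotmDr G H dotmZr F -/p; ring.
have : 0 <= t * (1 - t) * (r - 2 * q + p).
  by rewrite mulr_ge0 ?mulr_ge0 ?subr_ge0// -E dotm_ge0.
nra.
Qed.

Lemma quad_form_conv q (B B' : 'M[R]_(n, q)) (L : 'M[R]_q) (x : 'cV[R]_n) t : L^T = L ->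
  0 <= t <= 1 ->
  dotm ((B + t *: (B' - B)) *m (L *m L) *m (B + t *: (B' - B))^T) (x *m x^T) <=
  dotm (B *m (L *m L) *m B^T) (x *m x^T) +
  t * (dotm (B' *m (L *m L) *m B'^T) (x *m x^T) - dotm (B *m (L *m L) *m B^T) (x *m x^T)).
Proof.
move=> Ls t01; rewrite !quad_form//.
have -> : L *m (B + t *: (B' - B))^T *m x =
    L *m B^T *m x + t *: (L *m B'^T *m x - L *m B^T *m x).
  rewrite linearD linearZ/= linearB/= mulmxDr mulmxDl -scalemxAr -scalemxAl.
  by rewrite mulmxBr mulmxBl.
exact: dotm_sq_conv.
Qed.

(** At a fixed x the constraint is linear in the first component plus half the squared norms of L1
    B^T x and L2 C^T x, hence convex. *)
Lemma K_conv t u w : 0 <= t <= 1 -> K_set L1 L2 u -> K_set L1 L2 w ->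
  K_set L1 L2 (u + t *: (w - u)).
Proof.
move=> t01 Ku Kw x; case/andP: (t01) => t0 t1; set S := x *m x^T.
have E v : dotm (v.1.1 + Nmx L1 L2 v.1.2 v.2) S = dotm v.1.1 S
    + 2^-1 * dotm (v.1.2 *m (L1 *m L1) *m v.1.2^T) S
    + 2^-1 * dotm (v.2 *m (L2 *m L2) *m v.2^T) S.
  by rewrite /Nmx !dotmDl !dotmZl addrA.
have := Ku x; have := Kw x; rewrite -/S !E /=.
have := quad_form_conv u.1.2 w.1.2 x (L1_psd.1) t01; rewrite -/S.
have := quad_form_conv u.2 w.2 x (L2_pd.1) t01; rewrite -/S.
rewrite [dotm (u.1.1 + _) S]dotmDl dotmZl dotmBl.
move: (dotm (u.2 *m _ *m _) S) (dotm (w.2 *m _ *m _) S) => c c'.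
move: (dotm (u.1.2 *m _ *m _) S) (dotm (w.1.2 *m _ *m _) S) => b b'.
move: (dotm _ S) (dotm (u.1.1) S) (dotm w.1.1 S) (dotm _ S) => p a a' q.
move=> hc hb hw hu.
have : (1 - t) * (a + 2^-1 * b + 2^-1 * c) <= 0 by rewrite mulr_ge0_le0 ?subr_ge0.
have : t * (a' + 2^-1 * b' + 2^-1 * c') <= 0 by rewrite mulr_ge0_le0.
nra.
Qed.

End KConvex.

(** * The action as a supremum over continuous functions *)

Section RintegralSum.
Context {R : realType} {d : measure_display} {T : measurableType d}.
Variables (m : {measure set T -> \bar R}) (D : set T).
Hypothesis mD : measurable D.

Lemma integrable_EFinD (f g : T -> R) :
  m.-integrable D (EFin \o f) -> m.-integrable D (EFin \o g) ->
  m.-integrable D (EFin \o (fun x => f x + g x)).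
Proof. by move=> If Ig; apply: eq_integrable (integrableD mD If Ig). Qed.

Lemma integrable_EFinB (f g : T -> R) :
  m.-integrable D (EFin \o f) -> m.-integrable D (EFin \o g) ->
  m.-integrable D (EFin \o (fun x => f x - g x)).
Proof. by move=> If Ig; apply: eq_integrable (integrableB mD If Ig). Qed.

Lemma integrable_EFin_sum (I : Type) (s : seq I) (F : I -> T -> R) :
  (forall i, m.-integrable D (EFin \o F i)) ->
  m.-integrable D (EFin \o (fun x => \sum_(i <- s) F i x)).
Proof.
move=> IF; elim: s => [|i s IH].
  apply: eq_integrable (integrable0 m D) => // x _ /=; by rewrite big_nil.
apply: eq_integrable (integrable_EFinD (IF i) IH) => // x _ /=; by rewrite big_cons.
Qed.

Lemma Rintegral_sum (I : Type) (s : seq I) (F : I -> T -> R) :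
  (forall i, m.-integrable D (EFin \o F i)) ->
  \int[m]_(x in D) (\sum_(i <- s) F i x) = \sum_(i <- s) \int[m]_(x in D) F i x.
Proof.
move=> IF; elim: s => [|i s IH].
  under eq_Rintegral do rewrite big_nil; by rewrite big_nil Rintegral_cst// mul0r.
under eq_Rintegral do rewrite big_cons.
by rewrite RintegralD// ?IH ?big_cons//; exact: integrable_EFin_sum.
Qed.

End RintegralSum.

Section DensityPairing.
Context {R : realType} {d : measure_display} {T : measurableType d}.
Variables (lam : {finite_measure set T -> \bar R}) (D : set T).
Hypothesis mD : measurable D.

Definition bmf_mx m p (F : T -> 'M[R]_(m, p)) : Prop :=
  forall i j, bounded_mfun D (fun z => F z i j).

Definition mx_dominated m p (M : @mxmeas R _ T m p) : Prop := forall i j, M i j `<< lam.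

Lemma pairing_integrable m p (M : @mxmeas R _ T m p) (F : T -> 'M[R]_(m, p)) :
  mx_dominated M -> bmf_mx F ->
  lam.-integrable D (EFin \o (fun z => dotm (mxdensity M lam z) (F z))).
Proof.
move=> Ml bF; under eq_fun do rewrite dotmE.
apply: integrable_EFin_sum => // i; apply: integrable_EFin_sum => // j.
apply: eq_integrable (rn_integrable (Ml i j) mD (bF i j)) => // z _ /=.
by rewrite mxE mulrC.
Qed.

Lemma pairing_density m p (M : @mxmeas R _ T m p) (F : T -> 'M[R]_(m, p)) :
  mx_dominated M -> bmf_mx F ->
  pairing M D F = \int[lam]_(z in D) dotm (mxdensity M lam z) (F z).
Proof.
move=> Ml bF; have I i j : lam.-integrable D
    (EFin \o (fun z => mxdensity M lam z i j * F z i j)).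
  apply: eq_integrable (rn_integrable (Ml i j) mD (bF i j)) => // z _ /=.
  by rewrite mxE mulrC.
under [RHS]eq_Rintegral do rewrite dotmE.
rewrite Rintegral_sum => [|//|i]; last exact: integrable_EFin_sum.
apply: eq_bigr => i _; rewrite Rintegral_sum//; apply: eq_bigr => j _.
rewrite (cintegral_density (Ml i j) mD (bF i j)); apply: eq_Rintegral => z _.
by rewrite mxE mulrC.
Qed.

Context {n k : nat} (mu : @Xmeas R _ T n k).

Definition X_dominated : Prop :=
  [/\ mx_dominated (measG mu), mx_dominated (measq mu) & mx_dominated (measR mu)].

(** The partition of A into the single block A bounds the total variation below by the norm of
    mu(A), so every entry vanishes on the null sets of [lam]. *)
Lemma reference_dominated : reference mu lam D -> X_dominated.
Proof.
move=> [_ /null_content_dominatesP tv].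
have H A : measurable A -> lam A = 0%E -> Xnorm_at mu A <= 0.
  move=> mA lA; rewrite -lee_fin; apply: (@le_trans _ _ (Defs.total_variation mu A)); last first.
    by rewrite (tv A mA lA).
  apply: ereal_sup_ubound.
  exists 1%N, (fun=> A); split => //.
  - by move=> i j _ _; rewrite !ord1.
  - by apply/seteqP; split=> [x [i _]|x Ax] //; exists ord0.
  - by rewrite big_ord1.
have H0 A : measurable A -> lam A = 0%E ->
    [/\ mxval (measG mu) A = 0, mxval (measq mu) A = 0 & mxval (measR mu) A = 0].
  move=> mA lA; have := H A mA lA; rewrite /Xnorm_at.
  have h1 := dotm_ge0 (mxval (measG mu) A).
  have h2 := dotm_ge0 (mxval (measq mu) A).
  have h3 := dotm_ge0 (mxval (measR mu) A).
  move=> h; have {h} : Num.sqrt (dotm (mxval (measG mu) A) (mxval (measG mu) A)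
       + dotm (mxval (measq mu) A) (mxval (measq mu) A)
       + dotm (mxval (measR mu) A) (mxval (measR mu) A)) == 0.
    by rewrite eq_le h sqrtr_ge0.
  rewrite sqrtr_eq0 => h.
  by split; apply: dotm_eq0; lra.
have E m p (M : @mxmeas R _ T m p) :
    (forall A, measurable A -> lam A = 0%E -> mxval M A = 0) -> mx_dominated M.
  move=> M0 i j; apply/null_content_dominatesP => A mA lA.
  have /matrixP/(_ i j) := M0 A mA lA; rewrite !mxE => h.
  by rewrite -[LHS]fineK ?h// fin_num_measure.
by split; apply: E => A mA lA; have [] := H0 A mA lA.
Qed.

Hypothesis mul : X_dominated.

Definition rho_pair z (u : 'M[R]_n * 'M[R]_(n, k) * 'M[R]_n) : R :=
  Jpair (mxdensity (measG mu) lam z) (mxdensity (measq mu) lam z)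
    (mxdensity (measR mu) lam z) u.

Definition X_pairing (u : T -> 'M[R]_n * 'M[R]_(n, k) * 'M[R]_n) : R :=
  pairing (measG mu) D (fun z => (u z).1.1) + pairing (measq mu) D (fun z => (u z).1.2)
  + pairing (measR mu) D (fun z => (u z).2).

Definition bmf_X (u : T -> 'M[R]_n * 'M[R]_(n, k) * 'M[R]_n) : Prop :=
  [/\ bmf_mx (fun z => (u z).1.1), bmf_mx (fun z => (u z).1.2) & bmf_mx (fun z => (u z).2)].

Lemma rho_pair_integrable u : bmf_X u ->
  lam.-integrable D (EFin \o (fun z => rho_pair z (u z))).
Proof.
move=> [bG bq bR]; have [lG lq lR] := mul.
by apply: integrable_EFinD => //; [apply: integrable_EFinD => //|]; exact: pairing_integrable.
Qed.

Lemma X_pairing_density u : bmf_X u ->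
  X_pairing u = \int[lam]_(z in D) rho_pair z (u z).
Proof.
move=> [bG bq bR]; have [lG lq lR] := mul.
rewrite /X_pairing !pairing_density// -!RintegralD//;
  try (apply: integrable_EFinD => //); exact: pairing_integrable.
Qed.

End DensityPairing.

(** * Continuous approximation of Borel sets *)

Section WeightedApproximation.
Context {R : realType} {T : normedModType R}.
Variables (lam : {finite_measure set (borel T) -> \bar R}) (Q : set T) (g : T -> R).
Hypothesis cQ : compact Q.
Hypothesis Ig : lam.-integrable (Q : set (borel T)) (EFin \o g).

Let mQ : measurable (Q : set (borel T)) := compact_borel cQ.

(* Approximation in L^1 with weight |g|, as needed for densities which are
   integrable but not bounded. *)
Definition weighted (f : T -> R) : R := \int[lam]_(x in Q) (`|f x| * `|g x|).

Let bmf_norm (f : borel T -> R) : bounded_mfun (Q : set (borel T)) f ->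
  bounded_mfun (Q : set (borel T)) (fun x => `|f x|).
Proof.
move=> [mf [M fM]]; split; first exact: measurableT_comp.
by exists M => x Qx; rewrite normr_id fM.
Qed.

Lemma weighted_integrable (f : borel T -> R) : bounded_mfun (Q : set (borel T)) f ->
  lam.-integrable (Q : set (borel T)) (EFin \o (fun x => `|f x| * `|g x|)).
Proof.
move=> bf; have [mf [M fM]] := bmf_norm bf.
have bd : [bounded `|f x| | x in (Q : set (borel T))].
  exists M; split; first exact: num_real.
  by move=> N MN x Dx; apply: le_trans (fM x Dx) _; exact: ltW.
by apply: eq_integrable (integrableMr mQ mf bd (integrable_abse Ig)).
Qed.

Lemma weighted_le2 (f f1 f2 : borel T -> R) : bounded_mfun (Q : set (borel T)) f ->
  bounded_mfun (Q : set (borel T)) f1 -> bounded_mfun (Q : set (borel T)) f2 ->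
  (forall x, Q x -> `|f x| <= `|f1 x| + `|f2 x|) ->
  weighted f <= weighted f1 + weighted f2.
Proof.
move=> bf bf1 bf2 H; rewrite /weighted -RintegralD//; try exact: weighted_integrable.
apply: le_Rintegral => //; first exact: weighted_integrable.
  by apply: integrable_EFinD => //; exact: weighted_integrable.
by move=> x Qx; rewrite -mulrDl ler_wpM2r// H.
Qed.

Lemma weighted_small (phi : nat -> borel T -> R) (e : R) : 0 < e ->
  (forall m, bounded_mfun (Q : set (borel T)) (phi m)) ->
  (forall m x, Q x -> `|phi m x| <= 1) ->
  (forall x, Q x -> phi m x @[m --> \oo] --> 0) ->
  exists m, weighted (phi m) <= e.
Proof.
move=> e0 bphi phi1 phi0.
have mphi m := measurable_int lam (weighted_integrable (bphi m)).
have [|||_ _] := @dominated_convergence _ (borel T) R lam (Q : set (borel T)) mQ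
  _ (cst 0%E) (fun x => (`|g x|)%:E) mphi (measurable_cst _).
- apply: aeW => x Qx; apply: cvg_EFin; first exact: nearW.
  rewrite -(mul0r `|g x|); apply: cvgM; last exact: cvg_cst.
  by rewrite -(normr0 R); apply: cvg_norm; exact: phi0.
- exact: integrable_abse Ig.
- apply: aeW => x m Qx; rewrite /= lee_fin ger0_norm ?mulr_ge0//.
  by rewrite ler_piMl// phi1.
rewrite integral0 => /fine_cvg H.
have {}H : weighted (phi m) @[m --> \oo] --> 0 by exact: H.
have /cvgrPdist_le /(_ e e0) [m _ /(_ m (leqnn m))] := H.
by rewrite /= sub0r normrN => h; exists m; apply: le_trans h; exact: ler_norm.
Qed.

(** The bounds on [h] hold everywhere, because [h] later serves as the weight of a convex
    combination. *)
Definition approximable (E : set (borel T)) : Prop := forall e, 0 < e ->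
  exists h : T -> R, [/\ {within Q, continuous h}, forall x, 0 <= h x <= 1 &
    weighted (fun x => h x - \1_E x) <= e].

(** The cutoffs max(0, 1 - m f), with f vanishing exactly on [F], decrease to the indicator of [F],
    and dominated convergence applies. *)
Lemma approximable_closed (F : set T) : closed F -> approximable F.
Proof.
move=> cF e e0; have [f [cf f0 Ff]] := closed_zero_set cF.
pose h m x := Num.max 0 (1 - m%:R * f x).
have h01 m x : 0 <= h m x <= 1.
  by rewrite le_max lexx /= ge_max ler01/= lerBlDr lerDl mulr_ge0.
have ch m : {within Q, continuous (h m)}.
  apply: within_max; first exact: within_cst.
  apply: withinB; first exact: within_cst.
  by apply: withinM; [exact: within_cst|exact: continuous_subspaceT].
have mF : measurable (F : set (borel T)) by exact: closed_borel.
have [|||m mP] := @weighted_small (fun m x => h m x - \1_F x) e e0.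
- by move=> m; apply: bmfB; [exact: within_bmf|exact: bmf_indic].
- move=> m x _; have /andP[h0 h1] := h01 m x; rewrite indicE ler_norml.
  by case: (_ \in _) => /=; apply/andP; split; lra.
- move=> x _; have [Fx|nFx] := pselect (F x).
    rewrite (_ : (fun m => _) = (fun=> 0)); first exact: cvg_cst.
    apply/funext => m; rewrite indicE mem_set// /h (Ff x).1// mulr0 subr0 max_r//.
    by rewrite subrr.
  have fx : 0 < f x.
    by rewrite lt_neqAle f0 andbT eq_sym; apply/eqP => /Ff.
  apply: cvg_near_cst; exists (Num.bound (f x)^-1) => // m /= hm.
  rewrite indicE memNset// subr0 /h max_l// subr_le0 -ler_pdivrMr// mul1r.
  apply: (@le_trans _ _ (Num.bound (f x)^-1)%:R); last by rewrite ler_nat.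
  by apply/ltW/archi_boundP; rewrite invr_ge0.
by exists (h m).
Qed.

Lemma approximableC E : approximable E -> approximable (~` E).
Proof.
move=> aE e e0; have [h [ch h01 hE]] := aE e e0.
exists (fun x => 1 - h x); split.
- by apply: withinB => //; exact: within_cst.
- by move=> x; have /andP[h0 h1] := h01 x; apply/andP; split; lra.
- rewrite (_ : weighted _ = weighted (fun x => h x - \1_E x))//.
  apply: eq_Rintegral => x _; congr (_ * _).
  have -> : 1 - h x - \1_(~` E) x = - (h x - \1_E x).
    by rewrite !indicE in_setC; case: (_ \in _) => /=; ring.
  by rewrite normrN.
Qed.

Lemma approximableU A B : measurable A -> measurable B ->
  approximable A -> approximable B -> approximable (A `|` B).
Proof.
move=> mA mB aA aB e e0; have e20 : 0 < e / 2 by rewrite divr_gt0.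
have [h [ch h01 hA]] := aA _ e20; have [h' [ch' h'01 hB]] := aB _ e20.
exists (fun x => Num.max (h x) (h' x)); split.
- exact: within_max.
- move=> x; have /andP[a b] := h01 x; have /andP[c d] := h'01 x.
  by rewrite le_max a/= ge_max b d.
- apply: (@le_trans _ _ (weighted (fun x => h x - \1_A x)
      + weighted (fun x => h' x - \1_B x))); last by lra.
  have bh (f : T -> R) : {within Q, continuous f} -> forall E : set (borel T), measurable E ->
      bounded_mfun (Q : set (borel T)) (fun x => f x - \1_E x).
    by move=> cf E mE; apply: bmfB; [exact: within_bmf|exact: bmf_indic].
  apply: weighted_le2; [|exact: bh|exact: bh|].
    by apply: bh; [exact: within_max|exact: measurableU].
  move=> x _; rewrite !indicE in_setU.
  have /andP[a b] := h01 x; have /andP[c d] := h'01 x.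
  have abs (r : R) : - `|r| <= r <= `|r| by rewrite -ler_norml.
  rewrite ler_norml; case: (x \in A); case: (x \in B) => /=;
    match goal with |- context [ `|h x - ?u| + `|h' x - ?v| ] =>
      case/andP: (abs (h x - u)) => ? ?; case/andP: (abs (h' x - v)) => ? ? end;
    case: (lerP (h x) (h' x)) => hh; apply/andP; split; lra.
Qed.

Lemma approximable_bigcup (F : nat -> set (borel T)) :
  (forall i, measurable (F i)) -> (forall i, approximable (F i)) ->
  approximable (\bigcup_i F i).
Proof.
move=> mF aF e e0; have e20 : 0 < e / 2 by rewrite divr_gt0.
pose G N := \big[setU/set0]_(i < N) F i.
have mG N : measurable (G N) by apply: bigsetU_measurable.
have mU : measurable (\bigcup_i F i) by exact: bigcupT_measurable.
have aG N : approximable (G N).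
  rewrite /G; elim: N => [|N IH].
    by rewrite big_ord0; apply: approximable_closed; exact: closed0.
  by rewrite big_ord_recr; apply: approximableU => //; exact: bigsetU_measurable.
have [|||N NP] := @weighted_small (fun N x => \1_(G N) x - \1_(\bigcup_i F i) x) (e / 2) e20.
- by move=> N; apply: bmfB; exact: bmf_indic.
- by move=> N x _; rewrite !indicE; case: (_ \in _); case: (_ \in _);
    rewrite /= ?subrr ?subr0 ?sub0r ?normrN ?normr0 ?normr1.
- move=> x _; apply: cvg_near_cst.
  have [[i _ Fix]|nF] := pselect ((\bigcup_i F i) x).
    exists i.+1 => // N /= iN; rewrite !indicE !mem_set ?subrr//; first by exists i.
    by rewrite /G -bigcup_mkord; exists i.
  exists 0%N => // N _; rewrite !indicE !memNset ?subrr//.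
  by rewrite /G -bigcup_mkord => -[i _ Fix]; apply: nF; exists i.
have [h [ch h01 hG]] := aG N _ e20.
exists h; split => //; apply: (@le_trans _ _ (weighted (fun x => h x - \1_(G N) x)
  + weighted (fun x => \1_(G N) x - \1_(\bigcup_i F i) x))); last by lra.
apply: weighted_le2.
- by apply: bmfB; [exact: within_bmf|exact: bmf_indic].
- by apply: bmfB; [exact: within_bmf|exact: bmf_indic].
- by apply: bmfB; exact: bmf_indic.
- move=> x _; apply: le_trans (ler_normD _ _).
  by rewrite addrA subrK.
Qed.

(** The measurable approximable sets form a sigma-algebra containing the open sets. Measurability is
    carried along because the union steps integrate indicators. *)
Lemma borel_approximable (E : set (borel T)) : measurable E -> approximable E.
Proof.
move=> mE; suff : measurable E /\ approximable E by case.
move: E mE; apply: smallest_sub; last first.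
  move=> U oU; have cU : closed (~` U) by exact: open_closedC.
  split; first exact: sub_sigma_algebra.
  by rewrite -(setCK U); apply: approximableC; exact: approximable_closed.
split.
- by split => //; apply: approximable_closed; exact: closed0.
- by move=> A [mA aA]; rewrite setTD; split; [exact: measurableC|exact: approximableC].
- move=> F H; split; first by apply: bigcupT_measurable => i; case: (H i).
  by apply: approximable_bigcup => i; case: (H i).
Qed.

End WeightedApproximation.

Section Components.
Context {R : realType}.

Lemma fst_cont {U V : topologicalType} : continuous (@fst U V).
Proof. by move=> [u v]; exact: cvg_fst. Qed.

Lemma snd_cont {U V : topologicalType} : continuous (@snd U V).
Proof. by move=> [u v]; exact: cvg_snd. Qed.

Lemma within_pair {T U V : topologicalType} (Q : set T) (f : T -> U) (g : T -> V) :
  {within Q, continuous f} -> {within Q, continuous g} ->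
  {within Q, continuous (fun x => (f x, g x))}.
Proof. by move=> cf cg x; apply: cvg_pair; [exact: cf|exact: cg]. Qed.

Lemma within_bmf_mx {T : normedModType R} (Q : set T) m p (f : T -> 'M[R]_(m, p)) :
  compact Q -> {within Q, continuous f} -> bmf_mx (Q : set (borel T)) f.
Proof.
move=> cQ cf i j; apply: within_bmf => //.
exact: (@entry_continuous _ (subspace Q) _ _ f i j).
Qed.

Lemma within_components {T : topologicalType} (Q : set T) {U V W : topologicalType}
    (u : T -> U * V * W) : {within Q, continuous u} ->
  [/\ {within Q, continuous (fun z => (u z).1.1)},
      {within Q, continuous (fun z => (u z).1.2)} & {within Q, continuous (fun z => (u z).2)}].
Proof.
move=> cu; have c1 : {within Q, continuous (fun z => (u z).1)}.
  by move=> z; apply: continuous_comp (cu z) _; exact: fst_cont.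
split=> z.
- by apply: continuous_comp (c1 z) _; exact: fst_cont.
- by apply: continuous_comp (c1 z) _; exact: snd_cont.
- by apply: continuous_comp (cu z) _; exact: snd_cont.
Qed.

Lemma within_bmf_X {T : normedModType R} (Q : set T) n k
    (u : T -> 'M[R]_n * 'M[R]_(n, k) * 'M[R]_n) :
  compact Q -> {within Q, continuous u} -> bmf_X (Q : set (borel T)) u.
Proof. by move=> cQ /within_components[]; split; exact: within_bmf_mx. Qed.

End Components.

Section ActionDuality.
Context {R : realType} {T : normedModType R} {n k : nat}.
Variables (L1 : 'M[R]_k) (L2 : 'M[R]_n).
Hypotheses (L1_psd : psd L1) (L2_pd : pd L2).
Variables (Q : set T) (mu : @Xmeas R _ (borel T) n k).
Variable (lam : {finite_measure set (borel T) -> \bar R}).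
Hypothesis cQ : compact Q.
Hypothesis mul : X_dominated lam mu.

Local Notation X := ('M[R]_n * 'M[R]_(n, k) * 'M[R]_n)%type.
Local Notation QB := (Q : set (borel T)).
Local Notation rho := (rho_pair lam mu).
Let mQ : measurable QB := compact_borel cQ.

Definition Jrho (z : borel T) : \bar R := J L1 L2 (mxdensity (measG mu) lam z)
     (mxdensity (measq mu) lam z) (mxdensity (measR mu) lam z).

(* [sel N z] maximises the pairing with the density at [z] among 0 and
   [K_rat 0, ..., K_rat (N-1)]. *)
Fixpoint sel (N : nat) (z : borel T) : X :=
  if N is N'.+1 then sel N' z +
    (\1_(QB `&` [set y | rho y (sel N' y) < rho y (K_rat L1 L2 N')]) z : R)
      *: (K_rat L1 L2 N' - sel N' z)
  else 0.

Let E N : set (borel T) := QB `&` [set y | rho y (sel N y) < rho y (K_rat L1 L2 N)].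

Let selS N z : sel N.+1 z = sel N z + (\1_(E N) z : R) *: (K_rat L1 L2 N - sel N z).
Proof. by []. Qed.

Let bmf_X_cst (u : X) : bmf_X QB (fun=> u).
Proof. by split=> i j; exact: bmf_cst. Qed.

Lemma bmf_X_conv (u : borel T -> X) (h : borel T -> R) (w : X) : bmf_X QB u ->
  bounded_mfun QB h -> bmf_X QB (fun z => u z + h z *: (w - u z)).
Proof.
move=> [b1 b2 b3] bh.
have aux (c : R) (f g : borel T -> R) : bounded_mfun QB f ->
    (forall z, g z = f z + h z * (c - f z)) -> bounded_mfun QB g.
  move=> bf /funext ->; apply: bmfD => //; apply: bmfM => //.
  by apply: bmfB => //; exact: bmf_cst.
by split=> i j; [apply: (aux (w.1.1 i j) _ _ (b1 i j))|apply: (aux (w.1.2 i j) _ _ (b2 i j))|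
  apply: (aux (w.2 i j) _ _ (b3 i j))] => z; rewrite /= !mxE.
Qed.

Let rho_measurable u : bmf_X QB u -> measurable_fun QB (fun z => rho z (u z)).
Proof.
by move=> bu; apply/measurable_EFinP; apply: (measurable_int lam); exact: rho_pair_integrable.
Qed.

(** The induction alternates: the switching set [E N] is measurable because [sel N] is, and
    [sel N.+1] because [E N] is. *)
Let mE_of N : bmf_X QB (sel N) -> measurable (E N).
Proof.
move=> bs; have := measurable_fun_ltr (rho_measurable bs)
  (rho_measurable (bmf_X_cst (K_rat L1 L2 N))).
by move=> /(_ mQ [set true] I); rewrite /preimage/= /E.
Qed.

Lemma bmf_sel N : bmf_X QB (sel N).
Proof.
elim: N => [|N IH]; first exact: bmf_X_cst.
by apply: (@bmf_X_conv (sel N) (\1_(E N))) => //; apply: bmf_indic; exact: (mE_of IH).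
Qed.

Let mE N : measurable (E N). Proof. exact: (mE_of (bmf_sel N)). Qed.

Lemma K_set0 : K_set L1 L2 (0 : X).
Proof. by move=> x; rewrite /= Nmx00 addr0 dotmC dotm0r. Qed.

Lemma K_sel N z : K_set L1 L2 (sel N z).
Proof.
elim: N => [|N IH]; first exact: K_set0.
rewrite selS; apply: K_conv => //; last exact: K_ratP.
by rewrite indicE; case: (_ \in _); rewrite ?ler01 ?lexx.
Qed.

Let rho_selS N z : Q z -> rho z (sel N.+1 z) = Num.max (rho z (sel N z)) (rho z (K_rat L1 L2 N)).
Proof.
move=> Qz; rewrite selS {1}/rho_pair Jpair_conv -!/(rho_pair _ _ _ _) indicE.
have [lt|ge] := ltP (rho z (sel N z)) (rho z (K_rat L1 L2 N)).
  by rewrite mem_set//= mul1r addrC subrK.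
by rewrite memNset ?mul0r ?addr0// => -[_ /=]; rewrite ltNge ge.
Qed.

Let rho_sel_nd z : Q z -> nondecreasing_seq (fun N => rho z (sel N z)).
Proof. by move=> Qz; apply/nondecreasing_seqP => N; rewrite rho_selS// le_max lexx. Qed.

Let rho_sel_ge0 N z : Q z -> 0 <= rho z (sel N z).
Proof.
move=> Qz; apply: le_trans (rho_sel_nd Qz (leq0n N)).
by rewrite /rho_pair /Jpair /= !dotm0r !addr0.
Qed.

Let rho_le_J z u : K_set L1 L2 u -> ((rho z u)%:E <= Jrho z)%E.
Proof. by move=> Ku; exact: K_fenchel. Qed.

(** The values are the running maxima of 0 and the pairings with the [K_rat i]: they stay below [J]
    by [K_fenchel] and exhaust it by [J_sup_rat]. *)
Lemma rho_sel_cvg z : Q z -> (rho z (sel N z))%:E @[N --> \oo] --> Jrho z.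
Proof.
move=> Qz; rewrite (_ : Jrho z = ereal_sup (range (fun N => (rho z (sel N z))%:E))).
  by apply: ereal_nondecreasing_cvgn => i j ij; rewrite lee_fin; exact: rho_sel_nd.
apply/eqP; rewrite eq_le; apply/andP; split; last first.
  by apply: ge_ereal_sup => _ [N _ <-]; apply: rho_le_J; exact: K_sel.
rewrite leNgt; apply/negP => lt.
have s0 : (0 <= ereal_sup (range (fun N => (rho z (sel N z))%:E)))%E.
  by apply: ereal_sup_ubound; exists 0%N => //; congr _%:E;
    rewrite /rho_pair /Jpair /= !dotm0r !addr0.
have sfin : ereal_sup (range (fun N => (rho z (sel N z))%:E)) \is a fin_num.
  by rewrite ge0_fin_numE//; apply: lt_le_trans lt (leey _).
rewrite -(fineK sfin) in lt; have [i] := J_sup_rat L1_psd L2_pd lt.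
apply/negP; rewrite -leNgt -lee_fin (fineK sfin).
apply: (@le_trans _ _ (rho z (sel i.+1 z))%:E).
  by rewrite lee_fin rho_selS// le_max lexx orbT.
by apply: ereal_sup_ubound; exists i.+1.
Qed.

Lemma J_ge0 z : (0 <= Jrho z)%E.
Proof.
apply: le_trans (rho_le_J z K_set0); rewrite lee_fin.
by rewrite /rho_pair /Jpair /= !dotm0r !addr0.
Qed.

Lemma measurable_J : measurable_fun QB Jrho.
Proof.
apply: (emeasurable_fun_cvg (fun N z => (rho z (sel N z))%:E)).
  by move=> N; apply/measurable_EFinP; exact: (rho_measurable (bmf_sel N)).
by move=> z Qz; exact: rho_sel_cvg.
Qed.

Lemma action_weak u : bmf_X QB u -> (forall z, Q z -> K_set L1 L2 (u z)) ->
  ((X_pairing QB mu u)%:E <= action_wrt L1 L2 mu lam QB)%E.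
Proof.
move=> bu Ku; rewrite (X_pairing_density mQ mul bu).
have Iu := rho_pair_integrable mQ mul bu.
have [fin|] := boolP (action_wrt L1 L2 mu lam QB < +oo)%E; last first.
  by rewrite -leNgt leye_eq => /eqP ->; rewrite leey.
have IJ : lam.-integrable QB Jrho.
  apply/integrableP; split; first exact: measurable_J.
  by under eq_integral do rewrite gee0_abs ?J_ge0//.
rewrite /Rintegral fineK; last exact: integrable_fin_num.
by apply: le_integral => // z; rewrite inE => Qz; apply: rho_le_J; exact: Ku.
Qed.

(** The pointwise Fenchel gap is nonnegative, and the hypothesis makes its integral zero. *)
Lemma action_weak_eq u : bmf_X QB u -> (forall z, Q z -> K_set L1 L2 (u z)) ->
  (action_wrt L1 L2 mu lam QB <= (X_pairing QB mu u)%:E)%E ->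
  {ae lam, forall z, Q z -> Jrho z = (rho z (u z))%:E}.
Proof.
move=> bu Ku le; have Iu := rho_pair_integrable mQ mul bu.
have IJ : lam.-integrable QB Jrho.
  apply/integrableP; split; first exact: measurable_J.
  under eq_integral do rewrite gee0_abs ?J_ge0//.
  exact: le_lt_trans le (ltry _).
have eq : (\int[lam]_(z in QB) Jrho z = \int[lam]_(z in QB) (rho z (u z))%:E)%E.
  apply/eqP; rewrite eq_le; apply/andP; split.
    apply: le_trans le _; rewrite (X_pairing_density mQ mul bu) /Rintegral fineK//.
    exact: integrable_fin_num.
  by apply: le_integral => // z; rewrite inE => Qz; apply: rho_le_J; exact: Ku.
have ge0 z : Q z -> (0 <= Jrho z - (rho z (u z))%:E)%E.
  by move=> Qz; rewrite sube_ge0//; apply: rho_le_J; exact: Ku.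
have : (\int[lam]_(z in QB) `|Jrho z - (rho z (u z))%:E| = 0)%E.
  have -> : (\int[lam]_(z in QB) `|Jrho z - (rho z (u z))%:E| =
      \int[lam]_(z in QB) (Jrho z - (rho z (u z))%:E))%E.
    by apply: eq_integral => z; rewrite inE => Qz; rewrite gee0_abs// ge0.
  rewrite integralB// eq subee//; exact: integrable_fin_num.
move=> /ae_eq_integral_abs -/(_ mQ) H.
have {}H := H (emeasurable_funB measurable_J (measurable_int lam Iu)).
apply: filterS H => z + Qz => /(_ Qz); case: (Jrho z) => [r| |]//=.
by rewrite -EFinB => -[] /eqP; rewrite subr_eq0 => /eqP ->.
Qed.

Lemma action_optimal u : bmf_X QB u ->
  {ae lam, forall z, Q z -> Jrho z = (rho z (u z))%:E} ->
  action_wrt L1 L2 mu lam QB = (X_pairing QB mu u)%:E.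
Proof.
move=> bu H; have Iu := rho_pair_integrable mQ mul bu.
rewrite (X_pairing_density mQ mul bu) /Rintegral fineK; last exact: integrable_fin_num.
apply: ae_eq_integral => //; first exact: measurable_J.
exact: measurable_int Iu.
Qed.

(* Each switching set of [sel] has its indicator replaced by a continuous function
   with values in [0, 1]; convexity keeps the values in K. *)
Lemma sel_approx N e : 0 < e -> exists f : T -> X,
  [/\ {within Q, continuous f}, forall z, K_set L1 L2 (f z) &
      \int[lam]_(z in QB) `|rho z (f z) - rho z (sel N z)| <= e].
Proof.
elim: N e => [|N IH] e e0.
  exists (fun=> 0); split=> [|z|]; [exact: within_cst|exact: K_set0|].
  under eq_Rintegral do rewrite subrr normr0.
  by rewrite Rintegral_cst// mul0r ltW.
have e20 : 0 < e / 2 by rewrite divr_gt0.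
have [f [cf Kf fe]] := IH _ e20.
(* The gain from switching at step [N]. It is integrable but may be unbounded, so the switching set
   is approximated in L^1 with weight |g|. *)
pose g (z : T) := rho z (K_rat L1 L2 N) - rho z (sel N z).
have Ig : lam.-integrable QB (EFin \o g).
  by apply: integrable_EFinB => //; apply: rho_pair_integrable => //; exact: bmf_sel.
have [h [ch h01 he]] := borel_approximable cQ Ig (mE N) e20.
pose f' z := f z + h z *: (K_rat L1 L2 N - f z).
have cf' : {within Q, continuous f'}.
  by apply: withinD => //; apply: withinZ => //; apply: withinB => //; exact: within_cst.
exists f'; split => //.
  by move=> z; apply: K_conv => //; exact: K_ratP.
have Iabs (F : borel T -> R) : lam.-integrable QB (EFin \o F) ->
    lam.-integrable QB (EFin \o (fun z => `|F z|)).
  by move=> IF; apply: eq_integrable (integrable_abse IF).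
have I1 : lam.-integrable QB (EFin \o (fun z => `|rho z (f z) - rho z (sel N z)|)).
  apply/Iabs/integrable_EFinB => //; apply: rho_pair_integrable => //.
    exact: within_bmf_X.
  exact: bmf_sel.
have I2 : lam.-integrable QB (EFin \o (fun z => `|h z - \1_(E N) z| * `|g z|)).
  apply: weighted_integrable => //; apply: bmfB; first exact: within_bmf.
  exact: bmf_indic.
apply: (@le_trans _ _ (\int[lam]_(z in QB) (`|rho z (f z) - rho z (sel N z)| +
    `|h z - \1_(E N) z| * `|g z|))).
  apply: le_Rintegral => //; last 2 first.
  - exact: integrable_EFinD.
  (* The previous error is multiplied by 1 - h, which lies in [0, 1], and the error in the switching
     set by the gain. *)
  - move=> z Qz; have -> : rho z (f' z) - rho z (sel N.+1 z) =
        (1 - h z) * (rho z (f z) - rho z (sel N z)) + (h z - \1_(E N) z) * g z.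
      rewrite selS /f' /rho_pair !Jpair_conv -!/(rho_pair _ _ _ _) /g; ring.
    rewrite (le_trans (ler_normD _ _))// !normrM lerD2r ler_piMl//.
    by have /andP[? ?] := h01 z; rewrite ger0_norm; lra.
  apply/Iabs/integrable_EFinB => //; apply: rho_pair_integrable => //.
    exact: within_bmf_X.
  exact: bmf_sel.
by rewrite RintegralD//; move: he; rewrite /weighted; lra.
Qed.

(** Monotone convergence reduces the integral of [J] to those of the pairings with [sel N], and each
    of these is within any e of a pairing with a continuous function with values in [K_set]. *)
Lemma action_strong S : (forall f : T -> X, {within Q, continuous f} ->
    (forall z, K_set L1 L2 (f z)) -> X_pairing QB mu f <= S) ->
  (action_wrt L1 L2 mu lam QB <= S%:E)%E.
Proof.
move=> HS; have le N : (\int[lam]_(z in QB) (rho z (sel N z))%:E <= S%:E)%E.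
  have Is := rho_pair_integrable mQ mul (bmf_sel N).
  rewrite -[leLHS]fineK; last exact: integrable_fin_num.
  rewrite lee_fin; apply/ler_addgt0Pl => e e0.
  have [f [cf Kf fe]] := sel_approx N e0.
  have bf := within_bmf_X cQ cf.
  have If := rho_pair_integrable mQ mul bf.
  have := HS f cf Kf; rewrite (X_pairing_density mQ mul bf) => fS.
  have : \int[lam]_(z in QB) rho z (sel N z) - \int[lam]_(z in QB) rho z (f z)
     <= \int[lam]_(z in QB) `|rho z (f z) - rho z (sel N z)|.
    rewrite -RintegralB//; apply: le_Rintegral => //.
    - exact: integrable_EFinB.
    - apply: eq_integrable (integrable_abse (integrable_EFinB mQ If Is)) => //.
    - by move=> z Qz; rewrite distrC ler_norm.
  rewrite /Rintegral in fS fe *; lra.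
have cv := @cvg_monotone_convergence _ (borel T) R lam QB mQ
  (fun N z => (rho z (sel N z))%:E).
have H : (\int[lam]_(z in QB) (rho z (sel N z))%:E @[N --> \oo] -->
    \int[lam]_(z in QB) limn (fun N => (rho z (sel N z))%:E))%E.
  apply: cv.
  - by move=> N; apply/measurable_EFinP; exact: (rho_measurable (bmf_sel N)).
  - by move=> N z Qz; rewrite lee_fin; exact: rho_sel_ge0.
  - by move=> z Qz i j ij; rewrite lee_fin; exact: rho_sel_nd.
rewrite /action_wrt (_ : \int[lam]_(z in QB) _ =
  \int[lam]_(z in QB) limn (fun N => (rho z (sel N z))%:E))%E; last first.
  apply: eq_integral => z; rewrite inE => Qz; apply/esym/cvg_lim => //.
  exact: rho_sel_cvg.
rewrite -(cvg_lim _ H)//; apply: lime_le; first by apply/cvg_ex; eexists; exact: H.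
exact: nearW.
Qed.

End ActionDuality.

(** * Test functions on space-time *)

Section SmoothDomain.
Context {R : realType} {d : nat}.
Variable Om : set 'rV[R]_d.
Hypothesis Om_smooth : smooth_boundary Om.

(* A boundary point is pushed into the interior along a direction in which the
   defining function decreases. *)
Lemma smooth_sub_closure_interior : Om `<=` closure Om°.
Proof.
move=> p Omp; have [ip|nip] := pselect (Om° p); first exact: subset_closure.
have [U [rho [oU Up smo [v rhov] OmU]]] := Om_smooth (subset_closure Omp) nip.
have dif x : U x -> differentiable rho x by move=> Ux; exact: (smo [::] x Ux).
have rhop : rho p <= 0.
  by have : (Om `&` U) p by []; rewrite OmU => -[].
move=> B Bp.
have Dc : (fun h : R => h^-1 *: ((rho \o shift p) (h *: v) - rho p)) @ 0^' --> 'D_v rho p.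
  exact: (diff_derivable (v := v) (dif p Up)).
set D := 'D_v rho p in rhov Dc.
have near1 : \forall h \near (0 : R)^', 0 < D * (h^-1 * (rho (h *: v + p) - rho p)).
  have D2 : 0 < `|D| by rewrite normr_gt0.
  have /cvgrPdist_lt /(_ _ D2) := Dc; apply: filterS => h /=.
  rewrite /shift /= => hD; set q := h^-1 * _.
  have {}hD : `|D - q| < `|D| by exact: hD.
  (* This gives q^2 < 2 D q, so the difference quotient q has the sign of D. *)
  have : (D - q) ^+ 2 < D ^+ 2.
    by rewrite -[X in X < _]real_normK ?num_real// -[X in _ < X]real_normK ?num_real//
      ltr_pXn2r// nnegrE.
  by have := sqr_ge0 q; nra.
have cv : (fun h : R => h *: v + p) @ (0 : R)^' --> p.
  apply: cvg_trans (_ : (fun h : R => h *: v + p) @ (0 : R) --> p).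
    by apply: cvg_app; exact: cvg_within.
  rewrite -[X in _ --> X]add0r -(scale0r v); apply: cvgD; last exact: cvg_cst.
  by apply: cvgZ; [exact: cvg_id|exact: cvg_cst].
have near2 : \forall h \near (0 : R)^', (U `&` B) (h *: v + p).
  by apply: (cv (U `&` B)); apply: filterI => //; exact: open_nbhs_nbhs.
have near3 : \forall h \near (0 : R)^', h * D < 0 -> Om° (h *: v + p) /\ B (h *: v + p).
  near=> h => hD.
  have h0 : h != 0 by apply/eqP => h0; move: hD; rewrite h0 mul0r ltxx.
  have [Ux Bx] : (U `&` B) (h *: v + p) by near: h.
  have : 0 < D * (h^-1 * (rho (h *: v + p) - rho p)) by near: h.
  move=> q0; split => //.
  have neg : rho (h *: v + p) < 0.
    have : D * (h^-1 * (rho (h *: v + p) - rho p)) * (h ^+ 2) > 0.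
      by rewrite mulr_gt0// lt_neqAle sqr_ge0 andbT eq_sym sqrf_eq0.
    have -> : D * (h^-1 * (rho (h *: v + p) - rho p)) * h ^+ 2 =
       (h * D) * (rho (h *: v + p) - rho p) by field.
    rewrite nmulr_rgt0// => ?; lra.
  have nb : nbhs (h *: v + p) (U `&` [set x | rho x < 0]).
    apply: filterI; first exact: open_nbhs_nbhs.
    have /differentiable_continuous c := dif _ Ux.
    apply: (c [set r | r < 0]); apply: open_nbhs_nbhs; split => //; exact: open_lt.
  apply: filterS nb => x [Ux' rx].
  have [] // : (Om `&` U) x by rewrite OmU; split => //; exact: ltW.
have [e /= e0 He] : nbhs (0 : R)^' [set h | h * D < 0 ->
    Om° (h *: v + p) /\ B (h *: v + p)] by exact: near3.
(* A step of length e / 2 against the sign of D, so that h D < 0. *)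
pose h := if 0 < D then - (e / 2) else e / 2.
have e20 : 0 < e / 2 by rewrite divr_gt0.
have hh : `|h| = e / 2 by rewrite /h; case: ifP => _; rewrite ?normrN gtr0_norm.
exists (h *: v + p); apply: He.
- by rewrite /ball_ /= sub0r normrN hh; lra.
- by rewrite -normr_eq0 hh gt_eqF.
- rewrite /h; case: (ltP 0 D) => D0; first by rewrite nmulr_rlt0// oppr_lt0.
  by rewrite pmulr_rlt0// lt_neqAle rhov.
Unshelve. all: by end_near. Qed.

End SmoothDomain.

Section SpaceTime.
Context {R : realType} {d : nat}.
Variable Om : set 'rV[R]_d.
Local Notation Q := (Q Om).

Lemma Q_compact : compact Om -> compact Q.
Proof. by move=> cOm; apply: compact_setX => //; exact: segment_compact. Qed.

Lemma Q_interior (t : R) x : 0 < t < 1 -> Om° x -> Q° (t, x).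
Proof.
move=> t01 Omx; have ot : nbhs t `]0, 1[%classic.
  by apply: open_nbhs_nbhs; split; [exact: interval_open|rewrite /= in_itv].
exists (`]0, 1[%classic, Om) => //= -[s y] [/= s01 Omy]; split => //=.
by apply: subset_itv_oo_cc.
Qed.

Lemma Q_sub_closure_interior : Om `<=` closure Om° -> Q `<=` closure Q°.
Proof.
move=> OmC [t x] [/= t01 Omx] B [[B1 B2] [/= B1t B2x] B12].
have [y [Omy B2y]] := OmC x Omx B2 B2x.
have [e /= e0 eB1] := (nbhs_ballP _ _).1 B1t.
(* The time t is moved towards 1/2 by the fraction c: c < 1 and c > 0 put it strictly between 0 and
   1, and c < e keeps it within e of t. *)
pose c := Num.min 1 e / 2.
have c0 : 0 < c by rewrite divr_gt0// lt_min ltr01.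
have ce : c < e by rewrite ltr_pdivrMr// gt_min; apply/orP; right; lra.
have c1 : c < 1 by rewrite ltr_pdivrMr// gt_min; apply/orP; left; lra.
pose s := t + c * (2^-1 - t); move: t01; rewrite in_itv/= => /andP[t0 t1].
exists (s, y); split.
  by apply: Q_interior => //; rewrite /s; apply/andP; split; nra.
apply: B12; split => //=; apply: eB1.
by rewrite /ball /= /s opprD addrA subrr sub0r normrN ltr_norml; apply/andP; split; nra.
Qed.

End SpaceTime.

Section ExtDerive.
Context {R : realType} {V W : normedModType R}.
Variable D : set V.
Hypothesis Dcl : D `<=` closure D°.

Let within_proper z : D z -> ProperFilter (within D° (nbhs z)).
Proof. by move=> Dz; apply: within_nbhs_proper; exact: Dcl. Qed.

(** As the interior is dense in [D], the filter of interior points near z is proper, so the limit is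
    the value of any continuous extension of the derivative. *)
Lemma ext_derive_eq (f g : V -> W) v z : {within D, continuous g} ->
  (forall y, D° y -> g y = 'D_v f y) -> D z -> ext_derive D v f z = g z.
Proof.
move=> cg gD Dz; have PF := within_proper Dz.
apply: cvg_lim => //.
have cgz : g @ within D° (nbhs z) --> g z.
  apply: cvg_trans ((subspace_continuousP _ _).1 cg z Dz); apply: cvg_app.
  by apply: within_subset; exact: interior_subset.
by apply: cvg_trans cgz; apply: fmap_within_eq => y Dy; rewrite gD//; rewrite inE in Dy.
Qed.

Lemma ext_derive_continuous (f : V -> W) v : C1 D f ->
  {within D, continuous (ext_derive D v f)}.
Proof.
move=> [_ _ /(_ v)[g [cg gD]]].
apply: (subspace_eq_continuous (f := g)) => //.
by move=> z; rewrite inE => Dz; exact: (esym (ext_derive_eq cg gD Dz)).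
Qed.

Lemma ext_derive_interior (f : V -> W) v z : C1 D f -> D° z ->
  ext_derive D v f z = 'D_v f z.
Proof.
move=> [_ _ /(_ v)[g [cg gD]]] Dz.
by rewrite (ext_derive_eq cg gD) ?gD//; exact: interior_subset.
Qed.

Lemma C1_lin a (f g : V -> W) : C1 D f -> C1 D g -> C1 D (fun z => a *: f z + g z).
Proof.
move=> [cf df ef] [cg dg eg]; split.
- by apply: withinD => //; apply: withinZ => //; exact: within_cst.
- move=> v z Dz; apply: (@derivableD _ _ _ (a \*: f) g); last exact: dg.
  by apply: derivableZ; exact: df.
- move=> v; have [f' [cf' fD]] := ef v; have [g' [cg' gD]] := eg v.
  exists (fun z => a *: f' z + g' z); split.
    by apply: withinD => //; apply: withinZ => //; exact: within_cst.
  move=> z Dz; rewrite fD// gD//.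
  rewrite [RHS](@deriveD _ _ _ (a \*: f) g); last exact: dg.
    by rewrite deriveZ//; exact: df.
  by apply: derivableZ; exact: df.
Qed.

Lemma ext_derive_lin a (f g : V -> W) v z : C1 D f -> C1 D g -> D z ->
  ext_derive D v (fun z => a *: f z + g z) z =
  a *: ext_derive D v f z + ext_derive D v g z.
Proof.
move=> [cf df /(_ v)[f' [cf' fD]]] [cg dg /(_ v)[g' [cg' gD]]] Dz.
rewrite (ext_derive_eq cf' fD)// (ext_derive_eq cg' gD)//.
apply: (@ext_derive_eq _ (fun z => a *: f' z + g' z)) => //.
  by apply: withinD => //; apply: withinZ => //; exact: within_cst.
move=> y Dy; rewrite fD// gD// [RHS](@deriveD _ _ _ (a \*: f) g); last exact: dg.
  by rewrite deriveZ//; exact: df.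
by apply: derivableZ; exact: df.
Qed.

End ExtDerive.

(** If g extends the derivative continuously, so does its transpose; the extension is unique. *)
Lemma ext_derive_sym {R : realType} {V : normedModType R} (D : set V) n
    (f : V -> 'M[R]_n) v z : D `<=` closure D° -> C1 D f ->
  (forall y, D y -> (f y)^T = f y) -> D z ->
  (ext_derive D v f z)^T = ext_derive D v f z.
Proof.
move=> Dcl [cf df /(_ v)[g [cg gD]]] fs Dz.
have trc : continuous (fun M : 'M[R]_n => M^T) by apply: trmx_continuous => x; exact: cvg_id.
rewrite (ext_derive_eq Dcl cg gD Dz).
rewrite -(ext_derive_eq Dcl (g := fun z => (g z)^T) (f := f) (v := v) _ _ Dz).
- exact: (ext_derive_eq Dcl cg gD Dz).
- exact: within_comp.
- move=> y Dy; rewrite gD//; have dfy := df v y Dy.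
  have cl : (fun h : R => (h^-1 *: ((f \o shift y) (h *: v) - f y))^T) @ 0^' --> ('D_v f y)^T.
    exact: (cvg_comp _ _ dfy (trc _)).
  apply/esym; apply: (@cvg_lim _ _ _ _ _ _ _ _); first exact: norm_hausdorff.
  apply: cvg_trans cl; apply: near_eq_cvg.
  have nD : \forall h \near (0 : R)^', D (h *: v + y).
    have cv : (fun h : R => h *: v + y) @ (0 : R)^' --> y.
      apply: cvg_trans (_ : (fun h : R => h *: v + y) @ (0 : R) --> y).
        by apply: cvg_app; exact: cvg_within.
      rewrite -[X in _ --> X]add0r -(scale0r v); apply: cvgD; last exact: cvg_cst.
      by apply: cvgZ; [exact: cvg_id|exact: cvg_cst].
    exact: (cv D).
  apply: filterS nD => h Dh; rewrite linearZ linearB /= /shift /= !fs//.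
  exact: interior_subset.
Qed.

Lemma dotm_continuousl {R : realType} m p (S : 'M[R]_(m, p)) :
  continuous (fun M => dotm M S).
Proof.
have cI : continuous (fun M : 'M[R]_(m, p) => M) by move=> y; exact: cvg_id.
have cS := @cst_continuous 'M[R]_(m, p) _ S.
exact: dotm_continuous.
Qed.

(* Mean value theorem for [(t - a)^2 f] with a = 0, 1; the last hypothesis is a
   Riccati inequality for [f], linearised in [s]. *)
Lemma riccati_mvt {R : realType} (f f' : R -> R) (w : R) :
  (forall t : R, t \in `]0, 1[%R -> is_derive t 1 f (f' t)) ->
  {within `[0, 1], continuous f} ->
  (forall t s : R, t \in `]0, 1[%R -> 2 * s * f t + s ^+ 2 * f' t <= w) ->
  f 1 <= w /\ - f 0 <= w.
Proof.
move=> df cf bnd.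
have H (a : R) : (1 - a) ^+ 2 * f 1 - a ^+ 2 * f 0 <= w.
  pose p := ((fun t : R => t - a) ^+ 2 * f)%R : R -> R.
  pose p' (t : R) := 2 * (t - a) * f t + (t - a) ^+ 2 * f' t.
  have dp (t : R) : t \in `]0, 1[%R -> is_derive t 1 p (p' t).
    move=> t01; have ft := df t t01.
    have da : is_derive t 1 (fun t : R => t - a) 1.
      have := is_deriveB (is_derive_id t (1 : R)) (is_derive_cst a t (1 : R)).
      by rewrite subr0.
    apply: (is_derive_eq (is_deriveM (is_deriveX 2 da) ft)).
    by rewrite /p' /GRing.scale /= expr1 !exprfctE; ring.
  have cp : {within `[0, 1], continuous p}.
    rewrite (_ : p = fun t => (t - a) * (t - a) * f t); last first.
      by apply/funext => t; rewrite /p /= !fctE expr2.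
    have ca : {within `[0, 1], continuous (fun t : R => t - a)}.
      by apply: continuous_subspaceT => t; apply: cvgB; [exact: cvg_id|exact: cvg_cst].
    by apply: withinM => //; exact: withinM.
  have [c c01] := MVT ltr01 dp cp.
  rewrite /p !fctE subr0 mulr1 => e.
  have := bnd c (c - a) c01; rewrite -/(p' c) -e sub0r sqrrN; lra.
have := H 0; have := H 1; rewrite subr0 subrr; lra.
Qed.

Section DualTriple.
Context {R : realType} {n k d : nat}.
Variables (L1 : 'M[R]_k) (L2 : 'M[R]_n).
Hypotheses (L1_psd : psd L1) (L2_pd : pd L2).
Variable Om : set 'rV[R]_d.
Hypothesis Om_compact : compact Om.
Hypothesis Om_smooth : smooth_boundary Om.
Variables (D0 : {linear 'M[R]_n -> 'M[R]_(n, k)})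
          (D1 : 'I_d -> {linear 'M[R]_n -> 'M[R]_(n, k)}).
Local Notation Q := (Q Om).
Local Notation trip := (dual_triple Om D0 D1).
Implicit Types Phi Psi : R * 'rV[R]_d -> 'M[R]_n.

Let OmC : Om `<=` closure Om° := smooth_sub_closure_interior Om_smooth.
Let QC : Q `<=` closure Q° := Q_sub_closure_interior OmC.

Lemma C1sym_lin a Phi Psi : C1sym Om Phi -> C1sym Om Psi ->
  C1sym Om (fun z => a *: Phi z + Psi z).
Proof.
move=> [c1 s1] [c2 s2]; split; first exact: C1_lin.
by move=> z Qz; rewrite linearD linearZ/= s1 ?s2.
Qed.

Lemma dual_triple_within Phi : C1sym Om Phi -> {within Q, continuous (trip Phi)}.
Proof.
move=> [c1 _]; have [c _ _] := c1.
have lin (D : {linear 'M[R]_n -> 'M[R]_(n, k)}) (f : R * 'rV[R]_d -> 'M[R]_n) :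
    {within Q, continuous f} -> {within Q, continuous (fun z => D (f z))}.
  exact: (@linear_mx_continuous R (subspace Q)).
apply: within_pair => //; apply: within_pair; first exact: ext_derive_continuous.
apply: withinD; first exact: lin.
by apply: within_sum => j; apply: lin; exact: ext_derive_continuous.
Qed.

Lemma dual_triple_lin a Phi Psi z : C1sym Om Phi -> C1sym Om Psi -> Q z ->
  trip (fun z => a *: Phi z + Psi z) z = a *: trip Phi z + trip Psi z.
Proof.
move=> [c1 _] [c2 _] Qz; rewrite /dual_triple /Dstar /dt /dx.
congr (_, _, _); first exact: ext_derive_lin.
rewrite linearP /= scalerDr scaler_sumr addrACA -big_split/=; congr (_ + _).
by apply: eq_bigr => j _; rewrite ext_derive_lin// linearP.
Qed.

Lemma dual_triple_K Phi : C1sym Om Phi ->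
  C_Q_O Om L1 L2 (trip Phi) <-> forall z, Q z -> K_set L1 L2 (trip Phi z).
Proof.
move=> cPhi; have [c1 s1] := cPhi; split=> [[_ H] z Qz|H].
  by have [] := (O_setP L1_psd L2_pd _).1 (H z Qz).
split; first exact: dual_triple_within.
move=> z Qz; apply/(O_setP L1_psd L2_pd); split; first exact: H.
by apply: ext_derive_sym.
Qed.

(** For symmetric [L2] this is 2 L2^-2. The constant comes from 2 s w.b - s^2 |b|^2 / 2 <= 2 |w|^2
    with w = L2^-1 v and b = L2 Phi v. *)
Definition dual_bound : 'M[R]_n := 2 *: ((invmx L2)^T *m invmx L2).

Let slice_within Phi s : 0 <= s <= 1 -> {within Q, continuous Phi} ->
  {within Om, continuous (fun x => Phi (s, x))}.
Proof.
move=> s01 /subspace_continuousP c; apply/subspace_continuousP => x Omx.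
have Qsx : Q (s, x) by split => //=; rewrite in_itv.
apply: cvg_trans (c _ Qsx) => A /= [[B1 B2] [/= B1s B2x] BA].
apply: filterS B2x => y B2y Omy; apply: (BA (s, y)) => /=; last first.
  by split => //=; rewrite in_itv.
by split => //; exact: nbhs_singleton.
Qed.

Let time_within Phi x : Om x -> {within Q, continuous Phi} ->
  {within `[0, 1], continuous (fun s => Phi (s, x))}.
Proof.
move=> Omx /subspace_continuousP c; apply/subspace_continuousP => s s01.
have Qsx : Q (s, x) by [].
apply: cvg_trans (c _ Qsx) => A /= [[B1 B2] [/= B1s B2x] BA].
apply: filterS B1s => y B1y y01; apply: (BA (y, x)) => //=.
by split => //; exact: nbhs_singleton.
Qed.

(** On a time segment, f(t) = v^T Phi v equals w.b with w = L2^-1 v and b = L2 Phi v. The constraint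
    gives f' <= - |b|^2 / 2, the term in [L1] having the favourable sign. Expanding |s b - 2 w|^2 >=
    0 yields the hypothesis of [riccati_mvt]. *)
Let interior_bound Phi x (v : 'cV[R]_n) : C1sym Om Phi ->
  (forall z, Q z -> K_set L1 L2 (trip Phi z)) ->
  Om° x -> dotm (Phi (1, x)) (v *m v^T) <= dotm dual_bound (v *m v^T) /\
           - dotm (Phi (0, x)) (v *m v^T) <= dotm dual_bound (v *m v^T).
Proof.
move=> [c1 s1] KPhi Omx; set S := v *m v^T; have [c der _] := c1.
have Om_x : Om x by exact: interior_subset.
apply: (@riccati_mvt _ (fun t => dotm (Phi (t, x)) S) (fun t => dotm (dt Om Phi (t, x)) S)).
- move=> t; rewrite in_itv/= => t01.
  have Qi : Q° (t, x) by exact: Q_interior.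
  have dPhi := der (1, 0) _ Qi.
  have cv : (fun h : R => h^-1 *: (((fun t => dotm (Phi (t, x)) S) \o shift t) (h *: 1)
      - dotm (Phi (t, x)) S)) @ 0^' --> dotm (dt Om Phi (t, x)) S.
    rewrite /dt (ext_derive_interior QC _ c1 Qi).
    have := cvg_comp _ _ dPhi (@dotm_continuousl R n n S _); apply: cvg_trans.
    apply: near_eq_cvg; apply: nearW => h; rewrite /= dotmZl dotmBl /shift /=.
    have -> // : h *: ((1, 0) : R * 'rV[R]_d) + (t, x) = (h *: 1 + t, x).
    by apply/eqP; rewrite xpair_eqE /= scaler0 add0r !eqxx.
  by apply: DeriveDef; [apply/cvg_ex; eexists; exact: cv|exact: cvg_lim cv].
- by apply: (within_comp (@dotm_continuousl R n n S)); exact: time_within.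
- move=> t s; rewrite in_itv/= => t01.
  have Qt : Q (t, x) by split => //=; rewrite in_itv/=; apply/andP; split; lra.
  pose w := invmx L2 *m v; pose b := L2 *m Phi (t, x) *m v.
  have -> : dotm dual_bound S = 2 * dotm w w.
    by rewrite /dual_bound dotmZl /S -quad_dotm -mx11_dotm /w trmx_mul !mulmxA.
  have -> : dotm (Phi (t, x)) S = dotm w b.
    rewrite /S -quad_dotm -mulmxA mx11_dotm /w dotm_mulmxl.
    by rewrite trmx_inv (L2_pd.1) /b -!mulmxA mulKmx//; exact: pd_unit.
  have := KPhi _ Qt v; rewrite -/S /= /Nmx !dotmDl !dotmZl.
  rewrite !quad_form ?(L1_psd.1) ?(L2_pd.1)// s1// -/b.
  set b' := L1 *m (Dstar Om D0 D1 Phi (t, x))^T *m v.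
  have h1 := dotm_ge0 b'; set A := dotm (dt _ _ _) S => h2.
  have := dotm_ge0 (s *: b - 2 *: w).
  rewrite dotmBl !dotmBr !dotmZl !dotmZr [dotm b w]dotmC.
  move: (dotm w w) (dotm w b) (dotm b b) h2 => ww wb bb h2 h3.
  have : 0 <= s ^+ 2 * (2^-1 * dotm b' b') by rewrite mulr_ge0 ?sqr_ge0// mulr_ge0// invr_ge0.
  have : s ^+ 2 * (A + (2^-1 * dotm b' b' + 2^-1 * bb)) <= 0 by rewrite mulr_ge0_le0 ?sqr_ge0.
  rewrite !mulrDr; lra.
Qed.

(** The bounds hold over the interior of [Om], where Phi is differentiable in time, and pass to the
    boundary by continuity and density of the interior. *)
Lemma dual_bound_ge Phi x : C1sym Om Phi -> (forall z, Q z -> K_set L1 L2 (trip Phi z)) ->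
  Om x -> psd (dual_bound - Phi (1, x)) /\ psd (dual_bound + Phi (0, x)).
Proof.
move=> cPhi KPhi Omx; have [c1 s1] := cPhi; have [c _ _] := c1.
have cl (f : 'rV[R]_d -> R) : {within Om, continuous f} ->
    (forall x, Om° x -> 0 <= f x) -> 0 <= f x.
  move=> /subspace_continuousP /(_ _ Omx) cf f0; rewrite leNgt; apply/negP => fx.
  have nb : within Om (nbhs x) [set y | f y < 0].
    by apply: (cf [set r | r < 0]); apply: open_nbhs_nbhs; split => //; exact: open_lt.
  have [y [iy /(_ (interior_subset iy))]] := OmC Omx nb.
  by move=> /= /lt_le_trans/(_ (f0 y iy)); rewrite ltxx.
have bs : dual_bound^T = dual_bound by rewrite /dual_bound linearZ/= trmx_mul trmxK.
have Qs s : 0 <= s <= 1 -> Q (s, x) by move=> s01; split => //=; rewrite in_itv.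
have cs s (v : 'cV[R]_n) : 0 <= s <= 1 ->
    {within Om, continuous (fun x => dotm (Phi (s, x)) (v *m v^T))}.
  by move=> s01; apply: (within_comp (@dotm_continuousl R n n _)); exact: slice_within.
split; split.
- by rewrite linearB/= bs s1//; apply: Qs; rewrite ler01 lexx.
- move=> v; rewrite quad_dotm dotmBl.
  apply: (cl (fun x => dotm dual_bound (v *m v^T) - dotm (Phi (1, x)) (v *m v^T))).
    by apply: withinB; [exact: within_cst|apply: cs; rewrite ler01 lexx].
  by move=> y iy; rewrite subr_ge0; exact: (interior_bound v cPhi KPhi iy).1.
- by rewrite linearD/= bs s1//; apply: Qs; rewrite ler01 lexx.
- move=> v; rewrite quad_dotm dotmDl.
  apply: (cl (fun x => dotm dual_bound (v *m v^T) + dotm (Phi (0, x)) (v *m v^T))).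
    by apply: withinD; [exact: within_cst|apply: cs; rewrite ler01 lexx].
  by move=> y iy; have := (interior_bound v cPhi KPhi iy).2; lra.
Qed.

Lemma slice_bmf Phi s : 0 <= s <= 1 -> {within Q, continuous Phi} ->
  bmf_mx (Om : set (borel 'rV[R]_d)) (fun x => Phi (s, x)).
Proof. by move=> s01 cP; apply: within_bmf_mx => //; exact: slice_within. Qed.

End DualTriple.

(** * Vector measures *)

Section FiniteSum.
Context {R : realType} {d : measure_display} {T : measurableType d}.

(** An alias of [measure_add], on which the structure of a finite measure is declared. *)
Definition finite_add (m1 m2 : {finite_measure set T -> \bar R}) : set T -> \bar R :=
  measure_add m1 m2.

Variables m1 m2 : {finite_measure set T -> \bar R}.

HB.instance Definition _ := Measure.on (finite_add m1 m2).

Lemma finite_addE A : finite_add m1 m2 A = (m1 A + m2 A)%E.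
Proof. exact: measure_addE. Qed.

Let finite_add_fin : fin_num_fun (finite_add m1 m2).
Proof. by move=> A mA; rewrite finite_addE fin_numD !fin_num_measure. Qed.

HB.instance Definition _ :=
  @Measure_isFinite.Build _ T R (finite_add m1 m2) finite_add_fin.

End FiniteSum.

Section Reference.
Context {R : realType} {d : measure_display} {T : measurableType d}.
Variable D : set T.

(** The sum of the Jordan parts of all the charges. These parts are restrictions of the charges up
    to sign, hence concentrated on [D]; the zero charge supplies the measure for the empty list. *)
Lemma exists_dominating (I : eqType) (s : seq I) (F : I -> {charge set T -> \bar R}) :
  (forall i, concentrated (F i) D) ->
  exists lam : {finite_measure set T -> \bar R}, concentrated lam D /\
    forall i, i \in s -> F i `<< lam.
Proof.
move=> conc; elim: s => [|i0 s [lam [lamD lams]]].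
  have [P [N PN]] := Hahn_decomposition (czero : {charge set T -> \bar R}).
  have mP : measurable P by have [[]] := PN.
  exists (jordan_pos PN); split => // A mA _.
  by apply: etrans (jordan_posE PN A) _; rewrite cjordan_posE /crestr0 mem_set.
pose nu := F i0; have nuD : concentrated nu D := conc i0.
have [P [N PN]] := Hahn_decomposition nu.
have mP : measurable P by have [[]] := PN.
have mN : measurable N by have [_ []] := PN.
have jp A : measurable A -> A `&` D = set0 -> jordan_pos PN A = 0%E.
  move=> mA AD; apply: etrans (jordan_posE PN A) _.
  rewrite cjordan_posE /crestr0 mem_set// /crestr/=.
  by apply: nuD; [exact: measurableI|rewrite setIAC AD set0I].
have jn A : measurable A -> A `&` D = set0 -> jordan_neg PN A = 0%E.
  move=> mA AD; apply: etrans (jordan_negE PN A) _.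
  rewrite cjordan_negE /crestr0 mem_set// /crestr/=.
  by rewrite [nu _]nuD ?oppe0//; [exact: measurableI|rewrite setIAC AD set0I].
exists (finite_add lam (finite_add (jordan_pos PN) (jordan_neg PN))); split.
  by move=> A mA AD; do 2![rewrite /= finite_addE]; rewrite /= lamD// jp// jn// !add0e.
have null A : measurable A ->
    finite_add lam (finite_add (jordan_pos PN) (jordan_neg PN)) A = 0%E ->
    [/\ lam A = 0, jordan_pos PN A = 0 & jordan_neg PN A = 0]%E.
  move=> mA; do 2![rewrite /= finite_addE]; rewrite /= => /eqP; rewrite padde_eq0 ?adde_ge0//.
  move=> /andP[/eqP -> /eqP /eqP]; rewrite padde_eq0// => /andP[/eqP -> /eqP ->].
  by [].
move=> i; rewrite inE => /orP[/eqP ->|is_]; apply/null_content_dominatesP => A mA;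
  move=> /(null A mA)[l0 p0 n0].
  rewrite -/nu (jordan_decomp PN mA) /cadd/= cscaleN1 /=.
  by rewrite -/(jordan_pos PN) p0 n0 oppe0 adde0.
by have /null_content_dominatesP := lams i is_; apply.
Qed.

Lemma exists_dominating_mx m p (M : @mxmeas R _ T m p) : mxconcentrated M D ->
  exists lam : {finite_measure set T -> \bar R}, concentrated lam D /\ mx_dominated lam M.
Proof.
move=> MD; have [lam [lamD lamM]] :=
  @exists_dominating _ (enum {: 'I_m * 'I_p}) (fun ij => M ij.1 ij.2) (fun ij => MD _ _).
by exists lam; split => // i j; apply: (lamM (i, j)); rewrite mem_enum.
Qed.

(** Every measurable subset of a null set of [lam] is null for all entries, so all partition sums in
    the total variation are 0. *)
Lemma exists_reference n k (mu : @Xmeas R _ T n k) : X_measure mu D ->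
  exists lam : {finite_measure set T -> \bar R}, reference mu lam D.
Proof.
move=> [GD qD RD _].
have [l1 [l1D G1]] := exists_dominating_mx GD.
have [l2 [l2D q2]] := exists_dominating_mx qD.
have [l3 [l3D R3]] := exists_dominating_mx RD.
have null A : measurable A -> finite_add l1 (finite_add l2 l3) A = 0%E ->
    [/\ l1 A = 0, l2 A = 0 & l3 A = 0]%E.
  move=> mA; do 2![rewrite /= finite_addE]; rewrite /= => /eqP; rewrite padde_eq0 ?adde_ge0//.
  move=> /andP[/eqP -> /eqP /eqP]; rewrite padde_eq0// => /andP[/eqP -> /eqP ->].
  by [].
exists (finite_add l1 (finite_add l2 l3)); split.
  by move=> A mA AD; do 2![rewrite /= finite_addE]; rewrite /= l1D// l2D// l3D// !add0e.
apply/null_content_dominatesP => A mA A0.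
have mz m p (M : @mxmeas R _ T m p) (l : {finite_measure set T -> \bar R}) B :
    mx_dominated l M -> measurable B -> l B = 0%E -> mxval M B = 0.
  move=> Ml mB lB; apply/matrixP => i j; rewrite !mxE.
  by have /null_content_dominatesP/(_ B mB lB) -> := Ml i j.
have X0 B : measurable B -> B `<=` A -> Xnorm_at mu B = 0.
  move=> mB BA; have [A1 A2 A3] := null A mA A0.
  have B0 (l : {finite_measure set T -> \bar R}) : l A = 0%E -> l B = 0%E.
    by move=> lA; apply/eqP; rewrite eq_le measure_ge0 andbT -lA le_measure ?inE.
  rewrite /Xnorm_at (mz _ _ _ _ _ G1 mB (B0 _ A1)) (mz _ _ _ _ _ q2 mB (B0 _ A2)).
  by rewrite (mz _ _ _ _ _ R3 mB (B0 _ A3)) !dotm0r !addr0 sqrtr0.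
apply/eqP; rewrite eq_le; apply/andP; split.
  apply: ge_ereal_sup => _ [N [E [mE _ EA ->]]].
  by rewrite big1// => i _; apply: X0 => //; rewrite -EA; exact: bigcup_sup.
apply: ereal_sup_ubound; exists 1%N, (fun=> A); split => //.
- by move=> i j _ _; rewrite !ord1.
- by apply/seteqP; split=> [x [i _]|x Ax] //; exists ord0.
- by rewrite big_ord1 X0.
Qed.

Lemma cintegral_lin (nu : {charge set T -> \bar R}) a (f g : T -> R) : measurable D ->
  bounded_mfun D f -> bounded_mfun D g ->
  cintegral nu D (fun x => a * f x + g x) = a * cintegral nu D f + cintegral nu D g.
Proof.
move=> mD bf bg; rewrite /cintegral; case: (cid _) => P exN; case: (cid exN) => N PN.
have If (m : {finite_measure set T -> \bar R}) h : bounded_mfun D h ->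
  m.-integrable D (EFin \o h) by move=> bh; exact: bmf_integrable.
have baf : bounded_mfun D (fun x => a * f x) by apply: bmfM => //; exact: bmf_cst.
by rewrite !RintegralD ?If// !RintegralZl ?If//; ring.
Qed.

Lemma pairing_lin m p (M : @mxmeas R _ T m p) a (F G : T -> 'M[R]_(m, p)) : measurable D ->
  bmf_mx D F -> bmf_mx D G ->
  pairing M D (fun x => a *: F x + G x) = a * pairing M D F + pairing M D G.
Proof.
move=> mD bF bG; rewrite /pairing mulr_sumr -big_split/=; apply: eq_bigr => i _.
rewrite mulr_sumr -big_split/=; apply: eq_bigr => j _; rewrite -cintegral_lin//.
by congr cintegral; apply/funext => x; rewrite !mxE.
Qed.

End Reference.

Section PsdPairing.
Context {R : realType} {d : measure_display} {T : measurableType d}.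

(** On the set where f < 0 the integral of f is both nonnegative and nonpositive, so f vanishes
    there almost everywhere. *)
Lemma ae_ge0 (lam : {finite_measure set T -> \bar R}) (f : T -> R) :
  lam.-integrable setT (EFin \o f) ->
  (forall A, measurable A -> 0 <= \int[lam]_(x in A) f x) -> {ae lam, forall x, 0 <= f x}.
Proof.
move=> If f0; pose A := [set x | f x < 0].
have mf : measurable_fun setT f by apply/measurable_EFinP; exact: measurable_int If.
have mA : measurable A.
  have := measurable_fun_ltr mf (measurable_cst (0 : R)).
  by move=> /(_ measurableT [set true] I); rewrite setTI.
have IA : lam.-integrable A (EFin \o f) by exact: integrableS If.
have : (\int[lam]_(x in A) `|(f x)%:E| = 0)%E.
  have -> : (\int[lam]_(x in A) `|(f x)%:E| = - \int[lam]_(x in A) (f x)%:E)%E.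
    rewrite -integralN; last by apply: integrable_add_def.
    by apply: eq_integral => x; rewrite inE => Ax; rewrite /= ltr0_norm.
  have h1 := f0 A mA; have h2 : \int[lam]_(x in A) f x <= 0.
    rewrite -[leRHS](mul0r (fine (lam A))) -Rintegral_cst//; apply: le_Rintegral => //.
      by apply: bmf_integrable => //; exact: bmf_cst.
    by move=> x Ax; exact: ltW.
  rewrite -(fineK (integrable_fin_num mA IA)) -EFinN; congr _%:E.
  by apply/eqP; rewrite oppr_eq0 eq_le h1 h2.
move=> /(ae_eq_integral_abs _ mA (measurable_int _ IA)); apply: filterS => x H.
rewrite leNgt; apply/negP => fx; have := H fx; rewrite /= => -[] e.
by move: fx; rewrite e ltxx.
Qed.

(* The density is positive semidefinite almost everywhere because its quadratic
   form is nonnegative on the countably many rational vectors. *)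
Lemma psd_pairing_ge0 n (M : @mxmeas R _ T n n) D (F : T -> 'M[R]_n) : measurable D ->
  psd_measure M D -> bmf_mx D F -> (forall x, D x -> psd (F x)) -> 0 <= pairing M D F.
Proof.
move=> mD [MD Mpsd] bF Fpsd; have [lam [_ lamM]] := exists_dominating_mx MD.
rewrite (pairing_density mD lamM bF).
have bc A (S : 'M[R]_n) : bmf_mx A (fun _ : T => S) by move=> i j; exact: bmf_cst.
have ae1 (q : 'cV[rat]_n) : {ae lam, forall z,
    0 <= dotm (mxdensity M lam z) (map_mx ratr q *m (map_mx ratr q)^T)}.
  apply: ae_ge0; first by apply: pairing_integrable.
  move=> A mA; rewrite -(pairing_density mA lamM (bc A _)).
  have -> : pairing M A (fun=> map_mx ratr q *m (map_mx ratr q)^T) =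
      dotm (mxval M A) (map_mx ratr q *m (map_mx ratr q)^T).
    rewrite dotmE; apply: eq_bigr => i _; apply: eq_bigr => j _.
    rewrite (cintegral_density (lamM i j) mA (bmf_cst A _)) RintegralZl//; last first.
      apply: eq_integrable (rn_integrable (lamM i j) mA (bmf_cst A 1)) => // z _ /=.
      by rewrite mul1r.
    rewrite [mxval M A i j]mxE [RHS]mulrC; congr (_ * _); rewrite /Rintegral.
    rewrite (Radon_Nikodym_integral (lamM i j) mA); congr fine.
    by apply: eq_integral => z _; rewrite fineK// Radon_Nikodym_fin_num.
  by apply: psd_ge0; exact: Mpsd.
have ae2 : {ae lam, forall z, forall q : 'cV[rat]_n,
    0 <= dotm (mxdensity M lam z) (map_mx ratr q *m (map_mx ratr q)^T)}.
  have : {ae lam, forall z, forall i : nat, let q := odflt 0 (unpickle i : option 'cV[rat]_n) in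
      0 <= dotm (mxdensity M lam z) (map_mx ratr q *m (map_mx ratr q)^T)}.
    by apply: ae_foralln => i; exact: ae1.
  by apply: filterS => z H q; have := H (pickle q); rewrite pickleK.
have ae3 : {ae lam, forall z, D z -> 0 <= dotm (mxdensity M lam z) (F z)}.
  apply: filterS ae2 => z H Dz; have [s ->] := psd_sum_sq (Fpsd z Dz).
  rewrite dotm_sumr; apply: sumr_ge0 => v _; rewrite leNgt; apply/negP => lt.
  have cq : continuous (fun v : 'cV[R]_n => - dotm (mxdensity M lam z) (v *m v^T)).
    have cI : continuous (fun v : 'cV[R]_n => v) by move=> y; exact: cvg_id.
    have cS := @cst_continuous 'cV[R]_n _ (mxdensity M lam z).
    apply: fct_continuousN; apply: dotm_continuous => //.
    by apply: mulmx_continuous => //; exact: trmx_continuous.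
  have [|q] := @rat_dense_lt R _ _ _ 0 v cq; first by rewrite oppr_gt0.
  by rewrite oppr_gt0 ltNge H.
rewrite /Rintegral fine_ge0//; have If := pairing_integrable mD lamM bF.
rewrite (ae_eq_integral (fun z => (`|dotm (mxdensity M lam z) (F z)|)%:E) _ mD).
- by apply: integral_ge0 => z _; rewrite lee_fin.
- exact: measurable_int If.
- by apply: measurable_int; exact: integrable_abse If.
- by apply: filterS ae3 => z H Dz; rewrite /= ger0_norm// H.
Qed.

End PsdPairing.

Section Slater.
Context {R : realType} {n k : nat}.
Variables (L1 : 'M[R]_k) (L2 : 'M[R]_n).
Hypotheses (L1_psd : psd L1) (L2_pd : pd L2).

(** Cauchy-Schwarz row by row, obtained from [psd_cauchy] for the identity. *)
Lemma frobenius_bound m p (P : 'M[R]_(m, p)) (x : 'cV[R]_p) :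
  dotm (P *m x) (P *m x) <= dotm P P * dotm x x.
Proof.
have psd1 : psd (1%:M : 'M[R]_p).
  split; first by rewrite trmx1.
  by move=> y; rewrite mulmx1 mx11_dotm dotm_ge0.
rewrite [dotm (P *m x) _]dotmE [dotm P P]dotmE mulr_suml; apply: ler_sum => i _.
rewrite big_ord1; have := psd_cauchy (row i P)^T x psd1; rewrite !mul1mx => h.
have E : (P *m x) i 0 = dotm (row i P)^T x.
  by rewrite dotmE mxE; apply: eq_bigr => j _; rewrite big_ord1 !mxE.
have F : dotm (row i P)^T (row i P)^T = \sum_j P i j * P i j.
  by rewrite dotmE; apply: eq_bigr => j _; rewrite big_ord1 !mxE.
by rewrite E -F -expr2.
Qed.

(* The triple of [- e t I] stays in K under uniformly small perturbations, with [e]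
   so small that the quadratic term in [L2] does not compensate the time derivative. *)
Lemma slater : exists2 e : R, 0 < e & forall m : R, 0 <= m -> exists2 r, 0 < r &
  forall t (u : 'M[R]_n * 'M[R]_(n, k) * 'M[R]_n), 0 <= t <= 1 ->
    dotm u.1.1 u.1.1 <= m -> dotm u.1.2 u.1.2 <= m -> dotm u.2 u.2 <= m ->
    K_set L1 L2 ((- e *: 1%:M, 0, (- e * t) *: 1%:M) + r *: u).
Proof.
pose l1 := dotm L1 L1; pose l2 := dotm L2 L2.
have l10 : 0 <= l1 by exact: dotm_ge0.
have l20 : 0 <= l2 by exact: dotm_ge0.
(* This gives l2 e^2 <= e / 2: the square of - e t I uses up at most half of the time derivative -
   e. *)
pose e : R := (2 * (l2 + 1))^-1.
have e0 : 0 < e by rewrite invr_gt0 mulr_gt0// ltr_wpDl.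
have e1 : e * (2 * (l2 + 1)) = 1 by rewrite mulVf// gt_eqF// mulr_gt0// ltr_wpDl.
exists e => // m m0.
(* For r <= 1, r (q - 1) bounds the contribution of the perturbation relative to |x|^2, while r q =
   e / 2 is the slack left. *)
pose q := (1 + m) / 2 + l1 * m / 2 + l2 * m + 1.
have q1 : 1 <= q.
  rewrite /q lerDr addr_ge0// ?mulr_ge0// addr_ge0// ?divr_ge0 ?mulr_ge0// addr_ge0//.
have q0 : 0 < q by lra.
pose r := e / 2 / q.
have r0 : 0 < r by rewrite divr_gt0// divr_gt0.
have rq : r * q = e / 2 by rewrite mulfVK// gt_eqF.
exists r => // t [[A B] C] /andP[t0 t1] /= hA hB hC x; rewrite /= add0r.
set X2 := dotm x x; have X20 : 0 <= X2 by exact: dotm_ge0.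
rewrite /Nmx !dotmDl !dotmZl !quad_form ?(L1_psd.1) ?(L2_pd.1)//.
have I1 : dotm 1%:M (x *m x^T) = X2 by rewrite -quad_dotm mulmx1 mx11_dotm.
have I2 : dotm A (x *m x^T) <= (1 + m) / 2 * X2.
  rewrite -quad_dotm -mulmxA mx11_dotm.
  have := dotm_ge0 (x - A *m x); rewrite dotmBl !dotmBr [dotm (A *m x) x]dotmC -/X2.
  have : dotm (A *m x) (A *m x) <= m * X2.
    by apply: le_trans (frobenius_bound A x) _; rewrite ler_wpM2r.
  by lra.
have I3 : dotm (L1 *m (r *: B)^T *m x) (L1 *m (r *: B)^T *m x) <= r ^+ 2 * (l1 * m * X2).
  have -> : L1 *m (r *: B)^T *m x = r *: (L1 *m (B^T *m x)).
    by rewrite linearZ/= -scalemxAr -scalemxAl mulmxA.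
  rewrite dotmZl dotmZr mulrA -expr2 ler_wpM2l ?sqr_ge0//.
  apply: le_trans (frobenius_bound L1 _) _; rewrite -/l1 -mulrA ler_wpM2l//.
  by apply: le_trans (frobenius_bound _ x) _; rewrite dotm_tr ler_wpM2r.
have I4 : dotm (L2 *m ((- e * t) *: 1%:M + r *: C)^T *m x)
    (L2 *m ((- e * t) *: 1%:M + r *: C)^T *m x) <= l2 * (2 * e ^+ 2 + 2 * r ^+ 2 * m) * X2.
  rewrite -[L2 *m _ *m x]mulmxA; apply: le_trans (frobenius_bound L2 _) _.
  rewrite -/l2 -mulrA ler_wpM2l//.
  have -> : ((- e * t) *: 1%:M + r *: C)^T *m x = (- e * t) *: x + r *: (C^T *m x).
    by rewrite linearD !linearZ/= trmx1 mulmxDl -!scalemxAl mul1mx.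
  set y := C^T *m x.
  have hy : dotm y y <= m * X2.
    by apply: le_trans (frobenius_bound _ x) _; rewrite dotm_tr ler_wpM2r.
  have := dotm_ge0 ((- e * t) *: x - r *: y).
  have -> : dotm ((- e * t) *: x - r *: y) ((- e * t) *: x - r *: y) =
     (e * t) ^+ 2 * X2 - 2 * (- e * t * r * dotm x y) + r ^+ 2 * dotm y y.
    by rewrite dotmBl !dotmBr !dotmZl !dotmZr [dotm y x]dotmC -/X2; ring.
  have -> : dotm ((- e * t) *: x + r *: y) ((- e * t) *: x + r *: y) =
     (e * t) ^+ 2 * X2 + 2 * (- e * t * r * dotm x y) + r ^+ 2 * dotm y y.
    by rewrite dotmDl !dotmDr !dotmZl !dotmZr [dotm y x]dotmC -/X2; ring.
  have : (e * t) ^+ 2 * X2 <= e ^+ 2 * X2.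
    rewrite ler_wpM2r// exprMn ler_piMr ?sqr_ge0//.
    by rewrite expr_le1.
  have : r ^+ 2 * dotm y y <= r ^+ 2 * (m * X2) by rewrite ler_wpM2l ?sqr_ge0.
  by lra.
rewrite I1; set a := dotm A _ in I2 *.
have r1 : r <= 1.
  have : r <= r * q by rewrite ler_peMr// ltW.
  have : e * 1 <= e * (2 * (l2 + 1)) by rewrite ler_wpM2l ?ltW//; lra.
  by rewrite e1 rq; lra.
have r2 : r ^+ 2 <= r by rewrite expr2 ler_piMr// ltW.
have J1 : r * a <= r * ((1 + m) / 2 * X2) by rewrite ler_wpM2l// ltW.
have l1m : 0 <= l1 * m * X2 by rewrite !mulr_ge0.
have l2m : 0 <= l2 * m * X2 by rewrite !mulr_ge0.
have J2 : r ^+ 2 * (l1 * m * X2) <= r * (l1 * m * X2) by rewrite ler_wpM2r.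
have J3 : r ^+ 2 * (l2 * m * X2) <= r * (l2 * m * X2) by rewrite ler_wpM2r.
have J4 : l2 * e ^+ 2 * X2 <= e / 2 * X2.
  rewrite ler_wpM2r// expr2 mulrA -subr_ge0.
  have -> : e / 2 - l2 * e * e = e / 2 * (1 - 2 * (l2 * e)) by field.
  rewrite mulr_ge0 ?divr_ge0 ?(ltW e0)//; nra.
have J5 : r * q * X2 = e / 2 * X2 by rewrite rq.
have J6 : 0 <= r * X2 by rewrite mulr_ge0// ltW.
move: J5; rewrite /q !mulrDr !mulrDl; nra.
Qed.

End Slater.

Lemma derive_linear {R : realType} {V W : normedModType R} (f : V -> W) v z :
  (forall a u w, f (a *: u + w) = a *: f u + f w) ->
  derivable f z v /\ 'D_v f z = f v.
Proof.
move=> lin; have cv : (fun h : R => h^-1 *: ((f \o shift z) (h *: v) - f z)) @ 0^' --> f v.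
  apply: cvg_near_cst; near=> h; rewrite /= /shift lin addrK scalerA mulVf ?scale1r//.
  by near: h; exact: nbhs_dnbhs_neq.
by split; [apply/cvg_ex; eexists; exact: cv|exact: cvg_lim cv].
Unshelve. all: by end_near. Qed.

Section SymmetricPart.
Context {R : realType} {n k : nat}.
Local Notation X := ('M[R]_n * 'M[R]_(n, k) * 'M[R]_n)%type.
(** The directions are symmetrised so that the entries (i, j) and (j, i) of the first measure are
    represented by the same charge. *)
Definition basisG (i j : 'I_n) : X := (2^-1 *: (delta_mx i j + delta_mx j i), 0, 0).
Definition basisq (i : 'I_n) (j : 'I_k) : X := (0, delta_mx i j, 0).
Definition basisR (i j : 'I_n) : X := (0, 0, delta_mx i j).

Lemma basisG_sym i j : basisG i j = basisG j i.
Proof. by rewrite /basisG addrC. Qed.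

Lemma symX_basis (u : X) : symX u = \sum_i \sum_j u.1.1 i j *: basisG i j
  + \sum_i \sum_j u.1.2 i j *: basisq i j + \sum_i \sum_j u.2 i j *: basisR i j.
Proof.
have p11 (I : finType) (F : I -> X) : (\sum_i F i).1.1 = \sum_i (F i).1.1.
  by rewrite (big_morph (fun v : X => v.1.1) (id1 := 0) (op1 := +%R)).
have p12 (I : finType) (F : I -> X) : (\sum_i F i).1.2 = \sum_i (F i).1.2.
  by rewrite (big_morph (fun v : X => v.1.2) (id1 := 0) (op1 := +%R)).
have p2 (I : finType) (F : I -> X) : (\sum_i F i).2 = \sum_i (F i).2.
  by rewrite (big_morph (fun v : X => v.2) (id1 := 0) (op1 := +%R)).
have z (I J : finType) m p (F : I -> J -> 'M[R]_(m, p)) :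
    (forall i j, F i j = 0) -> \sum_i \sum_j F i j = 0.
  by move=> F0; apply: big1 => i _; apply: big1 => j _.
have ext (a b : X) : a.1.1 = b.1.1 -> a.1.2 = b.1.2 -> a.2 = b.2 -> a = b.
  by case: a b => -[a1 a2] a3 [[b1 b2] b3] /= -> -> ->.
apply: ext; rewrite /= ?p11 ?p12 ?p2.
- under [X in _ = X + _ + _]eq_bigr do rewrite p11.
  under [X in _ = _ + X + _]eq_bigr do rewrite p11.
  under [X in _ = _ + _ + X]eq_bigr do rewrite p11.
  rewrite (z _ _ _ _ (fun i j => (u.1.2 i j *: basisq i j).1.1)); last first.
    by move=> i j; rewrite /= scaler0.
  rewrite (z _ _ _ _ (fun i j => (u.2 i j *: basisR i j).1.1)); last first.
    by move=> i j; rewrite /= scaler0.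
  rewrite !addr0 [in LHS](matrix_sum_delta u.1.1).
  have -> : (\sum_i \sum_j u.1.1 i j *: delta_mx i j)^T =
      \sum_i \sum_j u.1.1 i j *: delta_mx j i :> 'M[R]_n.
    rewrite linear_sum; apply: eq_bigr => i _; rewrite linear_sum; apply: eq_bigr => j _.
    by rewrite linearZ /= trmx_delta.
  rewrite -big_split scaler_sumr; apply: eq_bigr => i _ /=.
  rewrite -big_split scaler_sumr; apply: eq_bigr => j _ /=.
  by rewrite -scalerDr !scalerA mulrC.
- under [X in _ = X + _ + _]eq_bigr do rewrite p12.
  under [X in _ = _ + X + _]eq_bigr do rewrite p12.
  under [X in _ = _ + _ + X]eq_bigr do rewrite p12.
  rewrite (z _ _ _ _ (fun i j => (u.1.1 i j *: basisG i j).1.2)); last first.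
    by move=> i j; rewrite /= scaler0.
  rewrite (z _ _ _ _ (fun i j => (u.2 i j *: basisR i j).1.2)); last first.
    by move=> i j; rewrite /= scaler0.
  by rewrite add0r addr0 {1}(matrix_sum_delta u.1.2).
- under [X in _ = X + _ + _]eq_bigr do rewrite p2.
  under [X in _ = _ + X + _]eq_bigr do rewrite p2.
  under [X in _ = _ + _ + X]eq_bigr do rewrite p2.
  rewrite (z _ _ _ _ (fun i j => (u.1.1 i j *: basisG i j).2)); last first.
    by move=> i j; rewrite /= scaler0.
  rewrite (z _ _ _ _ (fun i j => (u.1.2 i j *: basisq i j).2)); last first.
    by move=> i j; rewrite /= scaler0.
  by rewrite !add0r {1}(matrix_sum_delta u.2).
Qed.

End SymmetricPart.

Lemma charge_of_difference {R : realType} {d} {T : measurableType d}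
  (m1 m2 : {finite_measure set T -> \bar R}) :
  exists nu : {charge set T -> \bar R}, forall A, (nu A = m1 A - m2 A)%E.
Proof.
exists (cadd (charge_of_finite_measure m1) (cscale (-1) (charge_of_finite_measure m2))) => A.
by rewrite /= /cadd /= cscaleN1.
Qed.

Section Representation.
Context {R : realType} {T : normedModType R} {n k : nat} (Q : set T).
Local Notation X := ('M[R]_n * 'M[R]_(n, k) * 'M[R]_n)%type.
Local Notation QB := (Q : set (borel T)).
Hypothesis cQ : compact Q.
Variable f : (T -> X) -> R.
Hypothesis f_lin : forall a (u v : T -> X), {within Q, continuous u} ->
  {within Q, continuous v} -> f (fun z => a *: u z + v z) = a * f u + f v.
Hypothesis f_bnd : forall e : X, exists M, forall phi : T -> R,
  {within Q, continuous phi} -> (forall x, Q x -> `|phi x| <= 1) ->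
  f (fun z => phi z *: e) <= M.

(** In a fixed direction [e] the functional becomes a bounded scalar one, to which [signed_riesz]
    applies. *)
Lemma charge_representation (e : X) : exists nu : {charge set (borel T) -> \bar R},
  concentrated nu QB /\ forall phi : T -> R, {within Q, continuous phi} ->
    cintegral nu QB phi = f (fun z => phi z *: e).
Proof.
have mQ := compact_borel cQ.
have ce (phi : T -> R) : {within Q, continuous phi} ->
    {within Q, continuous (fun z => phi z *: e)}.
  by move=> cphi; apply: withinZ => //; exact: within_cst.
have [M fM] := f_bnd e.
have [|m1 [m2 [m1Q m2Q fE]]] :=
    signed_riesz cQ (l := fun phi => f (fun z => phi z *: e)) (M := M) _ fM.
  move=> a phi psi cphi cpsi; rewrite -f_lin; [|exact: ce..].
  by congr f; apply/funext => z; rewrite scalerDl scalerA.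
have [nu nuE] := charge_of_difference m1 m2; exists nu; split.
  by move=> A mA AQ; rewrite nuE m1Q// m2Q// oppe0 adde0.
move=> phi cphi; rewrite (cintegral_diff (m1 := m1) (m2 := m2)).
- by rewrite fE.
- by move=> A mA; exact: nuE.
- exact: mQ.
- exact: within_bmf.
Qed.

Definition repr_charge (e : X) : {charge set (borel T) -> \bar R} :=
  sval (cid (charge_representation e)).

(** The basis directions span only the triples with symmetric first component, so pairing with this
    measure is [f] after symmetrisation. *)
Definition repr_measure : @Xmeas R _ (borel T) n k :=
  XMeas (\matrix_(i, j) repr_charge (basisG i j))
    (\matrix_(i, j) repr_charge (basisq i j)) (\matrix_(i, j) repr_charge (basisR i j)).

Lemma repr_chargeP e : concentrated (repr_charge e) QB /\
  forall phi : T -> R, {within Q, continuous phi} ->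
    cintegral (repr_charge e) QB phi = f (fun z => phi z *: e).
Proof. exact: svalP (cid (charge_representation e)). Qed.

Lemma repr_measure_X : X_measure repr_measure QB.
Proof.
split; try by move=> i j; rewrite mxE; exact: (repr_chargeP _).1.
by move=> A mA; apply/matrixP => i j; rewrite !mxE basisG_sym.
Qed.

Let f0 : f (fun=> 0) = 0.
Proof.
have c0 : {within Q, continuous (fun=> 0 : X)} by exact: within_cst.
have := f_lin (-1) c0 c0; rewrite mulN1r addNr => <-.
by congr f; apply/funext => z; rewrite scaler0 addr0.
Qed.

Let fD (u v : T -> X) : {within Q, continuous u} -> {within Q, continuous v} ->
  f (fun z => u z + v z) = f u + f v.
Proof.
move=> cu cv; have := f_lin 1 cu cv; rewrite mul1r => <-.
by congr f; apply/funext => z; rewrite scale1r.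
Qed.

Let f_sum (I : finType) (F : I -> T -> X) : (forall i, {within Q, continuous (F i)}) ->
  f (fun z => \sum_i F i z) = \sum_i f (F i).
Proof.
move=> cF; elim: (index_enum I) => [|i s IH].
  by under eq_fun do rewrite big_nil; rewrite big_nil f0.
under eq_fun do rewrite big_cons; rewrite big_cons -IH fD//.
exact: within_sum.
Qed.

Lemma repr_measure_pairing (u : T -> X) : {within Q, continuous u} ->
  X_pairing QB repr_measure u = f (fun z => symX (u z)).
Proof.
move=> cu.
have ent m p (F : T -> 'M[R]_(m, p)) i j : {within Q, continuous F} ->
    {within Q, continuous (fun z => F z i j)}.
  exact: (@entry_continuous _ (subspace Q)).
have [cG cq cR] := within_components cu.
have ce (phi : T -> R) e : {within Q, continuous phi} ->
    {within Q, continuous (fun z => phi z *: e : X)}.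
  by move=> cphi; apply: withinZ => //; exact: within_cst.
under eq_fun do rewrite symX_basis.
rewrite fD; last 2 first.
- by apply: withinD; apply: within_sum => i; apply: within_sum => j; apply: ce; exact: ent.
- by apply: within_sum => i; apply: within_sum => j; apply: ce; exact: ent.
rewrite fD; try (by apply: within_sum => i; apply: within_sum => j; apply: ce; exact: ent).
have half m p (F : T -> 'M[R]_(m, p)) (E : 'I_m -> 'I_p -> X) (M : @mxmeas R _ (borel T) m p) :
    {within Q, continuous F} -> (forall i j, M i j = repr_charge (E i j)) ->
    pairing M QB F = f (fun z => \sum_i \sum_j F z i j *: E i j).
  move=> cF ME; rewrite f_sum; last first.
    by move=> i; apply: within_sum => j; apply: ce; exact: ent.
  apply: eq_bigr => i _; rewrite f_sum; last by move=> j; apply: ce; exact: ent.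
  by apply: eq_bigr => j _; rewrite ME (repr_chargeP _).2//; exact: ent.
rewrite /X_pairing; congr (_ + _ + _); apply: half => // i j; by rewrite mxE.
Qed.

End Representation.

(** * Duality *)

Section Duality.
Context {R : realType} {n k d : nat}.
Variables (L1 : 'M[R]_k) (L2 : 'M[R]_n).
Hypotheses (L1_psd : psd L1) (L2_pd : pd L2).
Variable Om : set 'rV[R]_d.
Hypothesis Om_compact : compact Om.
Hypothesis Om_smooth : smooth_boundary Om.
Variables (D0 : {linear 'M[R]_n -> 'M[R]_(n, k)})
          (D1 : 'I_d -> {linear 'M[R]_n -> 'M[R]_(n, k)}).
Hypothesis D0_id : D0 1%:M = 0.
Variables G0 G1 : @mxmeas R _ (borel 'rV[R]_d) n n.
Hypotheses (G0_psd : psd_measure G0 Om) (G1_psd : psd_measure G1 Om).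

Local Notation ST := (R * 'rV[R]_d)%type.
Local Notation X := ('M[R]_n * 'M[R]_(n, k) * 'M[R]_n)%type.
Local Notation Q := (Q Om).
Local Notation QB := (Q : set (borel ST)).
Local Notation trip := (dual_triple Om D0 D1).
Local Notation bnd := (boundary_term Om G0 G1).
Local Notation obj := (dual_objective Om D0 D1 G0 G1 L1 L2).
Local Notation dual := (dual_value Om D0 D1 G0 G1 L1 L2).
Implicit Types Phi Psi : ST -> 'M[R]_n.

Let cQ : compact Q := Q_compact Om_compact.
Let QC : Q `<=` closure Q° :=
  Q_sub_closure_interior (smooth_sub_closure_interior Om_smooth).
Let mOm : measurable (Om : set (borel 'rV[R]_d)) := compact_borel Om_compact.

Definition feasible Phi : Prop := forall z, Q z -> K_set L1 L2 (trip Phi z).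

Let feasibleP Phi : C1sym Om Phi -> C_Q_O Om L1 L2 (trip Phi) <-> feasible Phi.
Proof. exact: dual_triple_K. Qed.

Lemma objective_feasible Phi : C1sym Om Phi -> feasible Phi -> obj Phi = (bnd Phi)%:E.
Proof.
move=> cPhi fPhi; rewrite /dual_objective /cvx_indic mem_set ?sube0//.
exact/feasibleP.
Qed.

Lemma objective_infeasible Phi : C1sym Om Phi -> ~ feasible Phi -> obj Phi = -oo%E.
Proof.
move=> cPhi fPhi; rewrite /dual_objective /cvx_indic memNset//.
by move=> /(feasibleP cPhi).
Qed.

Lemma boundary_lin a Phi Psi : C1sym Om Phi -> C1sym Om Psi ->
  bnd (fun z => a *: Phi z + Psi z) = a * bnd Phi + bnd Psi.
Proof.
move=> [[c1 _ _] _] [[c2 _ _] _]; have s0 : 0 <= (0 : R) <= 1 by rewrite lexx ler01.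
have s1 : 0 <= (1 : R) <= 1 by rewrite lexx ler01.
rewrite /boundary_term !pairing_lin//; try exact: slice_bmf.
ring.
Qed.

(** The semidefinite measures are paired with dual_bound - Phi_1 and dual_bound + Phi_0, both
    positive semidefinite by [dual_bound_ge]. *)
Lemma boundary_ub Phi : C1sym Om Phi -> feasible Phi ->
  bnd Phi <= pairing G1 Om (fun=> dual_bound L2) + pairing G0 Om (fun=> dual_bound L2).
Proof.
move=> cPhi fPhi; have [[c _ _] _] := cPhi.
have s0 : 0 <= (0 : R) <= 1 by rewrite lexx ler01.
have s1 : 0 <= (1 : R) <= 1 by rewrite lexx ler01.
have bc : bmf_mx (Om : set (borel 'rV[R]_d)) (fun=> dual_bound L2).
  by move=> i j; exact: bmf_cst.
have b1 := slice_bmf Om_compact s1 c; have b0 := slice_bmf Om_compact s0 c.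
have := psd_pairing_ge0 (F := fun x : borel 'rV[R]_d =>
    (-1) *: Phi (1, x) + dual_bound L2) mOm G1_psd.
have := psd_pairing_ge0 (F := fun x : borel 'rV[R]_d =>
    1 *: Phi (0, x) + dual_bound L2) mOm G0_psd.
rewrite !pairing_lin// /boundary_term => h0 h1.
have {}h0 : 0 <= 1 * pairing G0 Om (fun x => Phi (0, x)) + pairing G0 Om (fun=> dual_bound L2).
  apply: h0.
    move=> i j; have [m0 [M0 M0P]] := b0 i j.
    rewrite (_ : (fun _ => _) = fun x => Phi (0, x) i j + dual_bound L2 i j).
      by apply: bmfD; [exact: b0|exact: bmf_cst].
    by apply/funext => x; rewrite scale1r !mxE.
  move=> x Omx; rewrite scale1r addrC.
  exact: (dual_bound_ge L1_psd L2_pd Om_smooth cPhi fPhi Omx).2.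
have {}h1 : 0 <= -1 * pairing G1 Om (fun x => Phi (1, x)) + pairing G1 Om (fun=> dual_bound L2).
  apply: h1.
    move=> i j.
    rewrite (_ : (fun _ => _) = fun x => dual_bound L2 i j - Phi (1, x) i j).
      by apply: bmfB; [exact: bmf_cst|exact: b1].
    by apply/funext => x; rewrite scaleN1r addrC !mxE.
  move=> x Omx; rewrite scaleN1r addrC.
  exact: (dual_bound_ge L1_psd L2_pd Om_smooth cPhi fPhi Omx).1.
lra.
Qed.

Definition slater_fun (e : R) : ST -> 'M[R]_n := fun z => (- e * z.1) *: 1%:M.

Let slater_lin e : forall a (u w : ST),
  slater_fun e (a *: u + w) = a *: slater_fun e u + slater_fun e w.
Proof. by move=> a u w; rewrite /slater_fun /= mulrDr scalerDl scalerA mulrCA. Qed.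

Let slater_derive v e z : 'D_v (slater_fun e) z = slater_fun e v.
Proof. by have [] := derive_linear v z (slater_lin e). Qed.

Lemma slater_C1sym e : C1sym Om (slater_fun e).
Proof.
split; last by move=> z _; rewrite /slater_fun linearZ/= trmx1.
split.
- apply: continuous_subspaceT => z.
  apply: cvgZ; last exact: cvg_cst.
  by apply: cvgMr; exact: fst_cont.
- by move=> v z _; have [] := derive_linear v z (slater_lin e).
- move=> v; exists (fun=> slater_fun e v); split; first exact: within_cst.
  by move=> z _; rewrite slater_derive.
Qed.

Lemma slater_triple e z : Q z -> trip (slater_fun e) z = (- e *: 1%:M, 0, (- e * z.1) *: 1%:M).
Proof.
move=> Qz; have E v : ext_derive Q v (slater_fun e) z = slater_fun e v.
  by apply: (ext_derive_eq QC (g := fun=> slater_fun e v)) => //; exact: within_cst.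
rewrite /dual_triple /dt /Dstar /dx E /slater_fun /= mulr1; congr (_, _, _).
rewrite linearZ/= D0_id scaler0 add0r; apply: big1 => j _.
by rewrite E /slater_fun /= mulr0 scale0r linear0.
Qed.

Let time01 z : Q z -> 0 <= z.1 <= 1.
Proof. by case=> /=; rewrite in_itv. Qed.

Lemma dual_finite : exists S : R, dual = S%:E.
Proof.
(* With m = 0 and the zero perturbation, this is the feasibility of the Slater function, which keeps
   the supremum away from -oo. *)
have [e e0 /(_ 0 (lexx _))[r r0 H]] := slater L1_psd L2_pd.
have fs : feasible (slater_fun e).
  move=> z Qz; rewrite slater_triple//; have := H z.1 0 (time01 Qz).
  by rewrite !dotm0r scaler0 addr0; apply.
exists (fine dual); rewrite fineK// fin_numE; apply/andP; split.
  rewrite -ltNye; apply: (@lt_le_trans _ _ (obj (slater_fun e))).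
    by rewrite objective_feasible ?ltNyr//; exact: slater_C1sym.
  by apply: ereal_sup_ubound; exists (slater_fun e) => //; exact: slater_C1sym.
rewrite -ltey; apply: (@le_lt_trans _ _
  (pairing G1 Om (fun=> dual_bound L2) + pairing G0 Om (fun=> dual_bound L2))%:E).
  apply: ge_ereal_sup => _ [Phi cPhi <-].
  have [fPhi|nf] := pselect (feasible Phi); last by rewrite objective_infeasible ?leNye.
  by rewrite objective_feasible// lee_fin boundary_ub.
exact: ltry.
Qed.

Lemma CE_pairing mu Phi : CE Om D0 D1 G0 G1 mu -> C1sym Om Phi ->
  X_pairing QB mu (trip Phi) = bnd Phi.
Proof. by move=> [_ H] cPhi; exact: H. Qed.

Lemma trip_bmf Phi : C1sym Om Phi -> bmf_X QB (trip Phi).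
Proof. by move=> cPhi; apply: within_bmf_X => //; exact: dual_triple_within. Qed.

(** The inequality holds for every reference measure, hence for the infimum that defines
    [action]. *)
Lemma weak_duality mu : CE Om D0 D1 G0 G1 mu -> (dual <= action L1 L2 mu QB)%E.
Proof.
move=> CEmu; apply: ge_ereal_sup => _ [Phi cPhi <-].
apply: le_ereal_inf_tmp => _ [lam ref <-].
have [fPhi|nf] := pselect (feasible Phi); last by rewrite objective_infeasible ?leNye.
rewrite objective_feasible// -(CE_pairing CEmu cPhi).
apply: action_weak => //; first exact: (reference_dominated ref).
exact: trip_bmf.
Qed.

Let trip_sym Phi z : C1sym Om Phi -> Q z -> symX (trip Phi z) = trip Phi z.
Proof.
by move=> [c s] Qz; apply: symX_id; rewrite /= /dt ext_derive_sym.
Qed.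

Lemma strong_duality : exists mu lam, [/\ CE Om D0 D1 G0 G1 mu, reference mu lam QB &
  (action_wrt L1 L2 mu lam QB <= dual)%E].
Proof.
have [S dS] := dual_finite.
have [e e0 sl] := slater L1_psd L2_pd.
pose V : lmodType R := (ST -> X)%type.
pose D : set V := [set u | {within Q, continuous (u : ST -> X)}].
pose K : set V := [set u | forall z, Q z -> K_set L1 L2 (u z)].
(* Agreement with the triple is asked on [Q] only, so that later the symmetrised triple, equal to
   the triple just on [Q], can be used in its place. *)
pose A0 : set (V * R) := [set x | exists Phi, [/\ C1sym Om Phi,
  forall z, Q z -> x.1 z = trip Phi z & x.2 = bnd Phi]].
pose w0 : V := trip (slater_fun e).
have within_eq (u v : ST -> X) : (forall z, Q z -> u z = v z) ->
    {within Q, continuous u} -> {within Q, continuous v}.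
  move=> uv; apply: subspace_eq_continuous => z; rewrite inE => Qz; exact: uv.
have D_lin a u v : D u -> D v -> D (a *: u + v).
  by move=> cu cv; apply: withinD => //; apply: withinZ => //; exact: within_cst.
(* The radius depends on the bound m alone and not on u; this uniformity is what bounds [f]. *)
have K_abs_unif m : 0 <= m -> exists2 r, 0 < r & forall u : ST -> X,
    (forall z, Q z -> [/\ dotm (u z).1.1 (u z).1.1 <= m, dotm (u z).1.2 (u z).1.2 <= m &
      dotm (u z).2 (u z).2 <= m]) -> K (w0 + r *: (u : V)).
  move=> m0; have [r r0 H] := sl m m0; exists r => // u um z Qz.
  have [h1 h2 h3] := um z Qz.
  have -> : (w0 + r *: (u : V)) z = trip (slater_fun e) z + r *: u z by [].
  by rewrite slater_triple//; apply: H => //; exact: time01.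
have cw0 : C1sym Om (slater_fun e) := slater_C1sym e.
have [||||||f [f_lin f_le fA0]] := @convex_extension R V D K A0 w0 (bnd (slater_fun e)) S D_lin.
- move=> t u v t0 t1 Ku Kv z Qz.
  have -> : ((1 - t) *: u + t *: v) z = u z + t *: (v z - u z).
    by rewrite /= scalerBl scale1r scalerBr -addrA [- _ + _]addrC.
  by apply: K_conv; [exact: L1_psd|exact: L2_pd|rewrite t0|exact: Ku|exact: Kv].
- move=> [u b] [Phi [cPhi uPhi _]]; apply: (within_eq (trip Phi)).
    by move=> z /uPhi.
  exact: dual_triple_within.
- move=> a [u b] [v c] [Phi [cPhi /= uPhi ->]] [Psi [cPsi /= vPsi ->]].
  exists (fun z => a *: Phi z + Psi z); split.
  + exact: C1sym_lin.
  + move=> z Qz /=; rewrite (dual_triple_lin Om_smooth D0 D1 a cPhi cPsi Qz).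
    by rewrite -uPhi// -vPsi.
  + by rewrite /= boundary_lin.
- move=> [u b] [Phi [cPhi /= uPhi ->]] Ku.
  have fPhi : feasible Phi by move=> z Qz; rewrite -uPhi//; exact: Ku.
  rewrite -lee_fin -dS -objective_feasible//; apply: ereal_sup_ubound.
  by exists Phi.
- by exists (slater_fun e); split.
- move=> u Du; have b (F : ST -> R) : {within Q, continuous F} ->
      exists2 m, 0 <= m & forall z, Q z -> F z <= m.
    move=> cF; have [M M0 MP] := within_bounded cQ cF; exists M => // z Qz.
    exact: le_trans (ler_norm _) (MP z Qz).
  have [cG cq cR] := within_components (Du : {within Q, continuous (u : ST -> X)}).
  have dc m p (F : ST -> 'M[R]_(m, p)) : {within Q, continuous F} ->
      {within Q, continuous (fun z => dotm (F z) (F z))}.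
    by move=> cF; apply: (@dotm_continuous R (subspace Q)).
  have [m1 m10 h1] := b _ (dc _ _ _ cG).
  have [m2 m20 h2] := b _ (dc _ _ _ cq).
  have [m3 m30 h3] := b _ (dc _ _ _ cR).
  have [|r r0 H] := K_abs_unif (m1 + m2 + m3); first by rewrite !addr_ge0.
  exists r => //; apply: H => z Qz.
  by have := h1 z Qz; have := h2 z Qz; have := h3 z Qz; split; lra.
have fV_lin a (u v : ST -> X) : {within Q, continuous u} ->
    {within Q, continuous v} -> f (fun z => a *: u z + v z) = a * f u + f v.
  by move=> cu cv; exact: f_lin.
have f_bnd (x : X) : exists M, forall phi : ST -> R, {within Q, continuous phi} ->
    (forall z, Q z -> `|phi z| <= 1) -> f (fun z => phi z *: x) <= M.
  pose m := dotm x.1.1 x.1.1 + dotm x.1.2 x.1.2 + dotm x.2 x.2.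
  have x1 := dotm_ge0 x.1.1; have x2 := dotm_ge0 x.1.2; have x3 := dotm_ge0 x.2.
  have [|r r0 H] := K_abs_unif m; first by rewrite !addr_ge0.
  (* As w0 + r phi x lies in [K], f w0 + r f(phi x) <= S. *)
  exists ((S - f w0) / r) => phi cphi phi1.
  pose u : ST -> X := fun z => phi z *: x.
  have cu : {within Q, continuous u} by apply: withinZ => //; exact: within_cst.
  have cw : {within Q, continuous (w0 : ST -> X)} by exact: dual_triple_within.
  have := f_le (r *: (u : V) + w0) (D_lin r u w0 cu cw).
  rewrite f_lin// ler_pdivlMr// [_ * r]mulrC lerBrDr; apply.
  rewrite addrC; apply: H => z Qz; have p1 := phi1 z Qz.
  have p2 : phi z * phi z <= 1.
    by rewrite -expr2 -real_normK ?num_real// expr_le1.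
  have p0 : 0 <= phi z * phi z by rewrite -expr2 sqr_ge0.
  rewrite /u /= !dotmZl !dotmZr !mulrA.
  have le1 y : 0 <= y -> phi z * phi z * y <= y by move=> y0; rewrite ler_piMl.
  have := le1 _ x1; have := le1 _ x2; have := le1 _ x3.
  by rewrite /m; split; lra.
pose mu := repr_measure cQ fV_lin f_bnd.
have muX : X_measure mu QB by exact: repr_measure_X.
have muP (u : ST -> X) : {within Q, continuous u} ->
    X_pairing QB mu u = f (fun z => symX (u z)) by exact: repr_measure_pairing.
have [lam ref] := exists_reference muX.
have symc (u : ST -> X) : {within Q, continuous u} -> D (fun z => symX (u z)).
  move=> /within_components[cG cq cR]; apply: within_pair => //; apply: within_pair => //.
  apply: withinZ; first exact: within_cst.
  by apply: withinD => //; exact: (@trmx_continuous R (subspace Q)).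
exists mu, lam; split => //.
- split => // Phi cPhi; have cT : {within Q, continuous (trip Phi)} by exact: dual_triple_within.
  transitivity (X_pairing QB mu (trip Phi)); first by [].
  rewrite muP//; apply: (fA0 (_, _)); exists Phi; split => //= z Qz.
  exact: trip_sym.
- rewrite dS; apply: action_strong => //; first exact: (reference_dominated ref).
  (* Pairing with [mu] evaluates [f] at the symmetrisation of u, which is again in [K]. *)
  move=> u cu Ku; rewrite muP//; apply: f_le; first exact: symc.
  by move=> z Qz; apply: K_set_sym; exact: Ku.
Qed.

(** The chain dual <= WB2 <= action <= action_wrt <= dual collapses to equalities for the measure
    and reference measure of [strong_duality]. *)
Lemma primal_dual : WB2 Om D0 D1 G0 G1 L1 L2 = dual /\
  exists mu lam, [/\ CE Om D0 D1 G0 G1 mu, reference mu lam QB &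
    action_wrt L1 L2 mu lam QB = dual] /\ is_minimizer Om D0 D1 G0 G1 L1 L2 mu.
Proof.
have [mu [lam [CEmu ref act]]] := strong_duality.
have le : (action L1 L2 mu QB <= action_wrt L1 L2 mu lam QB)%E.
  by apply: ereal_inf_lbound; exists lam.
have WBle : (WB2 Om D0 D1 G0 G1 L1 L2 <= action L1 L2 mu QB)%E.
  by apply: ereal_inf_lbound; exists mu.
have leWB : (dual <= WB2 Om D0 D1 G0 G1 L1 L2)%E.
  by apply: le_ereal_inf_tmp => _ [nu CEnu <-]; exact: weak_duality.
have E : WB2 Om D0 D1 G0 G1 L1 L2 = dual.
  by apply/eqP; rewrite eq_le leWB andbT (le_trans WBle (le_trans le act)).
split => //; exists mu, lam; split.
  split => //; apply/eqP; rewrite eq_le act/=.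
  by apply: le_trans leWB (le_trans WBle le).
split => //; apply/eqP; rewrite eq_le WBle andbT E.
exact: le_trans le act.
Qed.

(** The two conditions differ by a transpose of Phi, which is symmetric on [Q]. *)
Lemma optimalityP Phi mu (lam : {finite_measure set (borel ST) -> \bar R}) : C1sym Om Phi ->
  optimality Om D0 D1 L1 L2 Phi mu lam <->
  {ae lam, forall z, Q z -> optimal_at L1 L2 (mxdensity (measG mu) lam z)
    (mxdensity (measq mu) lam z) (mxdensity (measR mu) lam z) (trip Phi z)}.
Proof.
move=> [_ s].
split=> H; apply: (@filterS _ (almost_everywhere lam) _ _ _ _ H) => z + Qz => /(_ Qz) [H1 H2 H3 H4];
  split => //; by move: H4; rewrite /Nmx /= !addrA s.
Qed.

Lemma optimality_action Phi mu (lam : {finite_measure set (borel ST) -> \bar R}) :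
  C1sym Om Phi -> CE Om D0 D1 G0 G1 mu -> reference mu lam Q ->
  optimality Om D0 D1 L1 L2 Phi mu lam -> action_wrt L1 L2 mu lam QB = (bnd Phi)%:E.
Proof.
move=> cPhi CEmu ref /(optimalityP mu lam cPhi) opt.
rewrite -(CE_pairing CEmu cPhi); apply: action_optimal => //.
- exact: (reference_dominated ref).
- exact: trip_bmf.
- by apply: (@filterS _ (almost_everywhere lam) _ _ _ _ opt) => z + Qz => /(_ Qz); exact: optimal_J.
Qed.

(** Optimality makes the action at most the boundary term, which is at most the dual value, which is
    at most the action by weak duality. *)
Lemma optimality_minimizer Phi mu (lam : {finite_measure set (borel ST) -> \bar R}) :
  C1sym Om Phi -> feasible Phi -> CE Om D0 D1 G0 G1 mu -> reference mu lam Q ->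
  optimality Om D0 D1 L1 L2 Phi mu lam ->
  obj Phi = dual /\ is_minimizer Om D0 D1 G0 G1 L1 L2 mu.
Proof.
move=> cPhi fPhi CEmu ref opt; have [E _] := primal_dual.
have act := optimality_action cPhi CEmu ref opt.
have le : (action L1 L2 mu QB <= (bnd Phi)%:E)%E.
  by rewrite -act; apply: ereal_inf_lbound; exists lam.
have ub : (obj Phi <= dual)%E by apply: ereal_sup_ubound; exists Phi.
have wk := weak_duality CEmu.
rewrite (objective_feasible cPhi fPhi) in ub *.
split; first by apply/eqP; rewrite eq_le ub (le_trans wk le).
by split => //; rewrite E; apply/eqP; rewrite eq_le wk andbT (le_trans le ub).
Qed.

(** For the minimizer and the reference measure of [primal_dual], the action equals the dual value
    and so the pairing with the triple of Phi; the Fenchel inequality is then an equality almost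
    everywhere. *)
Lemma attained_optimality Phi : C1sym Om Phi -> obj Phi = dual ->
  feasible Phi /\ exists mu lam, [/\ CE Om D0 D1 G0 G1 mu, reference mu lam Q &
    optimality Om D0 D1 L1 L2 Phi mu lam].
Proof.
move=> cPhi objE; have [S dS] := dual_finite.
(* An infeasible Phi has objective -oo, while the dual value is finite. *)
have fPhi : feasible Phi.
  by apply: contrapT => nf; move: objE; rewrite objective_infeasible// dS.
split => //; have [_ [mu [lam [[CEmu ref act] _]]]] := primal_dual.
exists mu, lam; split => //; apply/optimalityP => //.
have mul := reference_dominated ref.
have := action_weak_eq L1_psd L2_pd cQ mul (trip_bmf cPhi) fPhi.
rewrite (CE_pairing CEmu cPhi) act -objE objective_feasible// => /(_ (lexx _)).
apply: (@filterS _ (almost_everywhere lam)) => z + Qz => /(_ Qz); apply: fenchel_eq => //.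
by have [_] := (feasibleP cPhi).2 fPhi; apply.
Qed.

End Duality.

Theorem theorem4p2 (R : realType) (n k d : nat)
  (n_gt0 : (0 < n)%N) (k_gt0 : (0 < k)%N) (d_gt0 : (0 < d)%N)
  (L1 : 'M[R]_k) (L2 : 'M[R]_n) (L1_psd : psd L1) (L2_pd : pd L2)
  (Om : set 'rV[R]_d) (Om_compact : compact Om) (Om_int : Om° !=set0)
  (Om_smooth : smooth_boundary Om)
  (D0 : {linear 'M[R]_n -> 'M[R]_(n, k)})
  (D1 : 'I_d -> {linear 'M[R]_n -> 'M[R]_(n, k)})
  (D0_id : D0 1%:M = 0)
  (G0 G1 : @mxmeas R _ (borel 'rV[R]_d) n n)
  (G0_psd : psd_measure G0 Om) (G1_psd : psd_measure G1 Om) :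
  [/\ exists mu, is_minimizer Om D0 D1 G0 G1 L1 L2 mu,
      WB2 Om D0 D1 G0 G1 L1 L2 = dual_value Om D0 D1 G0 G1 L1 L2 &
      forall Phi, C1sym Om Phi ->
        (dual_objective Om D0 D1 G0 G1 L1 L2 Phi
           = dual_value Om D0 D1 G0 G1 L1 L2 <->
         C_Q_O Om L1 L2 (dual_triple Om D0 D1 Phi) /\
         exists mu lam, [/\ CE Om D0 D1 G0 G1 mu, reference mu lam (Q Om) &
                           optimality Om D0 D1 L1 L2 Phi mu lam]) /\
        (forall mu lam,
           C_Q_O Om L1 L2 (dual_triple Om D0 D1 Phi) ->
           CE Om D0 D1 G0 G1 mu -> reference mu lam (Q Om) ->
           optimality Om D0 D1 L1 L2 Phi mu lam ->
           is_minimizer Om D0 D1 G0 G1 L1 L2 mu)].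
Proof.
have [E [mu [lam [_ mumin]]]] := primal_dual L1_psd L2_pd Om_compact Om_smooth D1 D0_id
  G0_psd G1_psd.
split; [by exists mu|exact: E|move=> Phi cPhi].
have fP := dual_triple_K L1_psd L2_pd Om_smooth D0 D1 cPhi.
have om := optimality_minimizer L1_psd L2_pd Om_compact Om_smooth D0_id G0_psd G1_psd cPhi.
split; last by move=> nu l /fP fPhi CEnu ref opt; case: (om _ nu l fPhi CEnu ref opt).
split=> [objE|[/fP fPhi [nu [l [CEnu ref opt]]]]].
  have [fPhi H] := attained_optimality L1_psd L2_pd Om_compact Om_smooth D0_id
    G0_psd G1_psd cPhi objE.
  by split => //; exact/fP.
by case: (om _ nu l fPhi CEnu ref opt).
Qed.
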